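(* Let $G$ be a finite directed graph (finitely many vertices, possibly infinitely many edges). Then $H^1(\mathcal{A}_G,\mathfrak{L}_G)=0$ if and only if every connected component of $G$ is either strongly connected or a fruit tree.
   Context: A directed graph $G=(\mathcal{V},\mathcal{E},s,r)$ has a vertex set $\mathcal{V}$ and an edge set $\mathcal{E}$ (loops and multiple edges allowed) and source and range maps $s,r\colon\mathcal{E}\to\mathcal{V}$; an edge $e$ is an arrow from $s(e)$ to $r(e)$. A directed graph is called finite if $\mathcal{V}$ is finite; $\mathcal{E}$ may be infinite (countable or uncountable). $\mathbb{F}_G^+$ is the set of all directed paths of finite length: vertices $v$ are paths of length $0$ with $r(v)=s(v)=v$, and a path of length $n\geq1$ is $p=e_1e_2\cdots e_n$ with $s(e_j)=r(e_{j+1})$, $r(p)=r(e_1)$, $s(p)=s(e_n)$; if $s(p_1)=r(p_2)$, the product $p_1p_2$ is the concatenation. Let $\mathcal{H}_G=\ell^2(\mathbb{F}_G^+)$ with orthonormal basis $\{\xi_w\}$. For $e\in\mathcal{E}$, $L_e\xi_w=\xi_{ew}$ if $r(w)=s(e)$ and $0$ otherwise; for $x\in\mathcal{V}$, $L_x\xi_w=\xi_w$ if $r(w)=x$ and $0$ otherwise. $\mathfrak{L}_G$ is the weak-operator closed algebra, and $\mathcal{A}_G$ the norm-closed algebra, generated by $\{L_e,L_x\}$ in $B(\mathcal{H}_G)$. A derivation from a Banach algebra $\mathcal{A}$ into a Banach $\mathcal{A}$-bimodule $\mathcal{X}$ is a linear map with $\delta(AB)=\delta(A)B+A\delta(B)$;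 it is inner if $\delta(A)=\delta_T(A):=AT-TA$ for some $T\in\mathcal{X}$. $H^1(\mathcal{A},\mathcal{X})$ is the quotient of the space of bounded derivations from $\mathcal{A}$ into $\mathcal{X}$ by the space of inner derivations; so $H^1(\mathcal{A},\mathcal{X})=0$ means every bounded derivation is inner. $G$ is strongly connected if for any vertices $x,y$ there is a directed path from $x$ to $y$ (a single vertex with no edge is strongly connected). Connected components are those of the underlying undirected graph. The $n$-circle graph $\mathscr{C}_n$ ($n\geq1$) has distinct vertices $v_1,\dots,v_n$ and edges $e_1,\dots,e_n$ with $r(e_j)=v_j$, $s(e_j)=v_{j+1\,(\mathrm{mod}\,n)}$. A polygon of length $n\geq1$ is a set of distinct vertices $v_1,\dots,v_n$ and distinct edges $e_1,\dots,e_n$ with $\{r(e_j),s(e_j)\}=\{v_j,v_{j+1\,(\mathrm{mod}\,n)}\}$. A generalized tree is a connected directed graph with at least two vertices containing no polygon; a leaf is a vertex of it of degree one (total number of incident edges). Let $G_t$ be a generalized tree with vertex set $\mathcal{V}_t$, $V=\{v_\lambda\}$ a (possibly empty) subset of its leaves with $V\neq\mathcal{V}_t$, and $G_f$ a directed graph whose connected components are circle graphs $\mathscr{C}_{n_\lambda}$, one for each $v_\lambda$. The graph $G_t\sqcup_V G_f$ obtained by identifying each $v_\lambda$ with a vertex of $\mathscr{C}_{n_\lambda}$ (no other identifications; the edge set is the disjoint union) is called a generalized fruit tree, and a fruit tree if it has finitely many vertices. *)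

(* Defs.v *)
From HB Require Import structures.
From mathcomp Require Import all_boot all_order all_algebra finmap complex.
From mathcomp Require Import ring lra.
From mathcomp Require Import all_classical all_reals all_analysis.
From mathcomp Require Import summability.
From Stdlib Require Import Relation_Operators.

Set Implicit Arguments.
Unset Strict Implicit.
Unset Printing Implicit Defensive.

Import numFieldNormedType.Exports.
Import Order.TTheory GRing.Theory Num.Theory.
Import ComplexField.

Local Open Scope classical_set_scope.
Local Open Scope ring_scope.
Local Open Scope complex_scope.

Section SqNorm.
Variables (R : realType) (W : choiceType).
Implicit Types (f g : W -> R[i]).

Definition sqnorm f : \bar R :=
  (\esum_(w in [set: W]) (Normc.normc (f w) ^+ 2)%:E)%E.

Definition square_summable : {pred (W -> R[i])} :=
  fun f => (sqnorm f < +oo)%E.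

Lemma sqnorm_ge0 f : (0 <= sqnorm f)%E.
Proof. by apply: esum_ge0 => w _; rewrite lee_fin sqr_ge0. Qed.

Lemma normc_ge0 (z : R[i]) : 0 <= Normc.normc z.
Proof. by case: z => a b; rewrite /= sqrtr_ge0. Qed.

Lemma esumZ_le (c : R) (a : W -> \bar R) : (0 <= c)%R ->
  (forall w, 0 <= a w)%E ->
  (\esum_(w in [set: W]) (c%:E * a w) <= c%:E * \esum_(w in [set: W]) a w)%E.
Proof.
move=> c0 a0; apply: ge_ereal_sup => _ [X [finX XT] <-].
rewrite -ge0_mule_fsumr//.
apply: lee_wpmul2l; first by rewrite lee_fin.
by apply: ereal_sup_ubound; exists X.
Qed.

Lemma sqnormZ_le (c : R[i]) f :
  (sqnorm (c *: f) <= (Normc.normc c ^+ 2)%:E * sqnorm f)%E.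
Proof.
apply: le_trans (esumZ_le _ _); last 2 first.
- exact: sqr_ge0.
- by move=> w; rewrite lee_fin sqr_ge0.
by apply: le_esum => w _; rewrite -EFinM -exprMn -Normc.normcM.
Qed.

Lemma sqnormD_le f g :
  (sqnorm (f + g)%R <= 2%:E * (sqnorm f + sqnorm g))%E.
Proof.
have sq0 h w : (0 <= (Normc.normc (h w) ^+ 2)%:E :> \bar R)%E.
  by move=> *; rewrite lee_fin sqr_ge0.
rewrite /sqnorm -esumD//.
apply: le_trans (esumZ_le _ _) => //; last by move=> w; rewrite adde_ge0.
apply: le_esum => w _; rewrite -EFinD -EFinM lee_fin.
have := le_normcD (f w) (g w); rewrite -[(f + g) w]/(f w + g w).
have := normc_ge0 (f w); have := normc_ge0 (g w).
have := normc_ge0 (f w + g w).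
set x := Normc.normc _; set y := Normc.normc _; set z := Normc.normc _.
move=> x0 z0 y0 xyz; have : x ^+ 2 <= (y + z) ^+ 2 by rewrite ler_sqr ?nnegrE//; lra.
by have := sqr_ge0 (y - z); lra.
Qed.

Lemma square_summable_submod : GRing.submod_closed square_summable.
Proof.
split=> [|c f g].
  rewrite unfold_in; apply: (@le_lt_trans _ _ 0%E); last exact: ltry.
  by rewrite /sqnorm esum1// => w _; rewrite Normc.normc0 expr0n.
rewrite /square_summable !unfold_in => ff gg.
have cf : (sqnorm (c *: f) < +oo)%E.
  apply: le_lt_trans (sqnormZ_le _ _) _.
  by rewrite -ge0_fin_numE ?sqnorm_ge0// in ff; rewrite -(fineK ff) -EFinM ltry.
apply: le_lt_trans (sqnormD_le _ _) _.
rewrite -!ge0_fin_numE ?sqnorm_ge0// in cf gg.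
by rewrite -(fineK cf) -(fineK gg) -EFinD -EFinM ltry.
Qed.

HB.instance Definition _ := GRing.isSubmodClosed.Build R[i] (W -> R[i])
  square_summable square_summable_submod.

Record ell2 := Ell2 {
  ell2_fun :> W -> R[i];
  ell2_funP : ell2_fun \in square_summable }.

HB.instance Definition _ := [isSub for ell2_fun].
HB.instance Definition _ := [Choice of ell2 by <:].
HB.instance Definition _ := [SubChoice_isSubLmodule of ell2 by <:].

End SqNorm.

Section Hilbert.
Variables (R : realType) (W : choiceType).
Notation H := (ell2 R W).
Implicit Types (f g : H).

Definition ell2_norm f : R := Num.sqrt (fine (sqnorm f)).

(* Convergence is along the net of finite subsets of W. *)
Definition ell2_inner f g : R[i] :=
  summability.sum (fun w => f w * conjc (g w) : R[i]^o).

Lemma sqnorm_fin f : sqnorm f \is a fin_num.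
Proof. by rewrite ge0_fin_numE ?sqnorm_ge0//; exact: (ell2_funP f). Qed.

Lemma ell2_normZ_le (c : R[i]) f :
  ell2_norm (c *: f) <= Normc.normc c * ell2_norm f.
Proof.
have -> : Normc.normc c = Num.sqrt (Normc.normc c ^+ 2).
  by rewrite sqrtr_sqr ger0_norm// normc_ge0.
rewrite -sqrtrM ?sqr_ge0// ler_wsqrtr//.
rewrite -[X in X * _]/(fine (_)%:E) -fineM ?sqnorm_fin//.
by rewrite fine_le ?sqnormZ_le ?fin_numM ?sqnorm_fin.
Qed.

Lemma ell2_normD_le f g :
  ell2_norm (f + g) <= 2 * (ell2_norm f + ell2_norm g).
Proof.
have n0 h : 0 <= ell2_norm h by exact: sqrtr_ge0.
have sq h : ell2_norm h ^+ 2 = fine (sqnorm h).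
  by rewrite sqr_sqrtr// fine_ge0// sqnorm_ge0.
have : ell2_norm (f + g) ^+ 2 <= 2 * (ell2_norm f ^+ 2 + ell2_norm g ^+ 2).
  rewrite !sq -fineD ?sqnorm_fin// -[X in X * _]/(fine (_)%:E).
  rewrite -fineM ?fin_numD ?sqnorm_fin//.
  by rewrite fine_le ?sqnormD_le ?fin_numM ?fin_numD ?sqnorm_fin.
move: (n0 f) (n0 g) (n0 (f + g)) => f0 g0 fg0 h.
rewrite -ler_sqr ?nnegrE//; last by lra.
by have := mulr_ge0 f0 g0; nra.
Qed.

Definition bounded_linear : {pred (H -> H)} := fun T =>
  `[< linear T /\ exists M, forall f, ell2_norm (T f) <= M * ell2_norm f >].

Lemma bounded_linear_submod : GRing.submod_closed bounded_linear.
Proof.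
split=> [|c S T].
  apply/asboolP; split=> [a f g|]; first by rewrite scaler0 addr0.
  exists 0 => f; rewrite mul0r.
  by have := ell2_normZ_le 0 f; rewrite Normc.normc0 mul0r scale0r.
move=> /asboolP[linS [M HM]] /asboolP[linT [N HN]]; apply/asboolP; split.
  move=> a f g; rewrite -![(c *: S + T) _]/(c *: S _ + T _) linS linT.
  by rewrite !scalerDr !scalerA (mulrC c a) addrACA.
exists (2 * (Normc.normc c * M + N)) => f.
rewrite -[(c *: S + T) _]/(c *: S _ + T _).
apply: le_trans (ell2_normD_le _ _) _; rewrite -mulrA ler_wpM2l// mulrDl.
apply: lerD => //; apply: le_trans (ell2_normZ_le _ _) _.
by rewrite -mulrA ler_wpM2l ?normc_ge0.
Qed.

HB.instance Definition _ := GRing.isSubmodClosed.Build R[i] (H -> H)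
  bounded_linear bounded_linear_submod.

Record bop := Bop {
  bop_fun :> H -> H;
  bop_funP : bop_fun \in bounded_linear }.

HB.instance Definition _ := [isSub for bop_fun].
HB.instance Definition _ := [Choice of bop by <:].
HB.instance Definition _ := [SubChoice_isSubLmodule of bop by <:].

Implicit Types (S T U : bop).

Lemma bop_linear T : linear T.
Proof. by move: (bop_funP T) => /asboolP[]. Qed.

Lemma bop_one_subproof : @idfun H \in bounded_linear.
Proof. by apply/asboolP; split=> [//|]; exists 1 => f; rewrite mul1r. Qed.

Lemma bop_mul_subproof S T : S \o T \in bounded_linear.
Proof.
apply/asboolP; split=> [c f g /=|]; first by rewrite !bop_linear.
move: (bop_funP S) (bop_funP T) => /asboolP[_ [M HM]] /asboolP[_ [N HN]].
exists (`|M| * N) => f; apply: le_trans (HM _) _.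
apply: (@le_trans _ _ (`|M| * ell2_norm (T f))).
  by rewrite ler_wpM2r ?sqrtr_ge0// ler_norm.
by rewrite -mulrA ler_wpM2l.
Qed.

Definition bop_one : bop := Bop bop_one_subproof.
Definition bop_mul S T : bop := Bop (bop_mul_subproof S T).

Lemma bopP S T : S =1 T -> S = T.
Proof. by move=> ST; apply: val_inj; apply: funext. Qed.

Lemma bop_mulA : associative bop_mul.
Proof. by move=> S T U; apply: bopP. Qed.

Lemma bop_mul1l : left_id bop_one bop_mul.
Proof. by move=> S; apply: bopP. Qed.

Lemma bop_mul1r : right_id bop_one bop_mul.
Proof. by move=> S; apply: bopP. Qed.

Lemma bop_mulDl : left_distributive bop_mul +%R.
Proof. by move=> S T U; apply: bopP. Qed.

Lemma bop_mulDr : right_distributive bop_mul +%R.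
Proof.
move=> S T U; apply: bopP => f /=.
rewrite -[LHS]/(S (T f + U f)) -[RHS]/(S (T f) + S (U f)).
by rewrite -[T f in LHS]scale1r bop_linear scale1r.
Qed.

HB.instance Definition _ := GRing.Zmodule_isPzRing.Build bop
  bop_mulA bop_mul1l bop_mul1r bop_mulDl bop_mulDr.

Definition opnorm T : R :=
  sup [set ell2_norm (T f) | f in [set f | ell2_norm f <= 1]].

Definition norm_closed (A : set bop) : Prop :=
  forall T, (forall e : R, 0 < e -> exists S, A S /\ opnorm (T - S) < e) -> A T.

(* The weak operator topology is the coarsest one making every matrix
   coefficient T |-> <T f, g> continuous. *)
Definition matrix_coef (T : bop) : {ptws (H * H)%type -> R[i]^o} :=
  fun fg => ell2_inner (T fg.1) fg.2.

Definition wot_closed (A : set bop) : Prop :=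
  closed (A : set (initial_topology matrix_coef)).

Definition subalgebra (A : set bop) : Prop :=
  [/\ A 0, (forall (c : R[i]) S T, A S -> A T -> A (c *: S + T))
     & (forall S T, A S -> A T -> A (S * T))].

Definition norm_closed_algebra (X : set bop) : set bop :=
  smallest [set A | subalgebra A /\ norm_closed A] X.

Definition wot_closed_algebra (X : set bop) : set bop :=
  smallest [set A | subalgebra A /\ wot_closed A] X.

(* Only the values of delta on A matter. *)
Definition bounded_derivation (A X : set bop) (delta : bop -> bop) : Prop :=
  [/\ forall S, A S -> X (delta S),
      forall (c : R[i]) S T, A S -> A T ->
        delta (c *: S + T) = c *: delta S + delta T,
      forall S T, A S -> A T -> delta (S * T) = delta S * T + S * delta T
    & exists M : R, forall S, A S -> opnorm (delta S) <= M * opnorm S].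

Definition inner_derivation (A X : set bop) (delta : bop -> bop) : Prop :=
  exists2 T, X T & forall S, A S -> delta S = S * T - T * S.

Definition H1_vanishes (A X : set bop) : Prop :=
  forall delta, bounded_derivation A X delta -> inner_derivation A X delta.

Lemma basis_subproof (w : W) :
  (fun q => (q == w)%:R : R[i]) \in @square_summable R W.
Proof.
rewrite unfold_in /sqnorm.
have -> : (\esum_(q in [set: W]) (Normc.normc ((q == w)%:R : R[i]) ^+ 2)%:E =
  \esum_(q in [set w]) 1%:E :> \bar R)%E.
  rewrite [RHS]esum_mkcond; apply: eq_esum => q _.
  have [->|qw] := eqVneq q w; first by rewrite mem_set// Normc.normc1 expr1n.
  by rewrite memNset ?Normc.normc0 ?expr0n//; exact/eqP.
by rewrite esum_set1 ?lee_fin// ltry.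
Qed.

Definition ell2_basis (w : W) : H := Ell2 (basis_subproof w).

Section PartialInjection.
Variable sigma : W -> option W.
Hypothesis sigma_inj :
  forall w w' q, sigma w = Some q -> sigma w' = Some q -> w = w'.

(* The operator mapping the basis vector of w to that of sigma w, or to 0 where
   sigma is undefined: see shift_basis below. *)
Definition shift_fun (f : W -> R[i]) : W -> R[i] := fun q =>
  if pselect (exists w, sigma w = Some q) is left ex_w
  then f (projT1 (cid ex_w)) else 0.

Lemma shift_fun_some (f : W -> R[i]) w q : sigma w = Some q -> shift_fun f q = f w.
Proof.
move=> wq; rewrite /shift_fun; case: pselect => [ex_w|[]]; last by exists w.
by case: cid => w' /= w'q; rewrite (sigma_inj wq w'q).
Qed.

Lemma shift_fun_none (f : W -> R[i]) q :
  (forall w, sigma w <> Some q) -> shift_fun f q = 0.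
Proof. by move=> h; rewrite /shift_fun; case: pselect => // ex; exfalso; case: ex => w; exact: h. Qed.

Lemma sqnorm_shift f : (sqnorm (shift_fun f) <= sqnorm f)%E.
Proof.
pose e w := odflt w (sigma w).
pose D : set W := [set w | sigma w <> None].
rewrite /sqnorm.
have -> : (\esum_(q in [set: W]) (Normc.normc (shift_fun f q) ^+ 2)%:E =
    \esum_(q in e @` D) (Normc.normc (shift_fun f q) ^+ 2)%:E)%E.
  rewrite [RHS]esum_mkcond; apply: eq_esum => q _.
  case: ifPn => // /negP qD; rewrite shift_fun_none ?Normc.normc0 ?expr0n//.
  move=> w wq; apply: qD; rewrite inE; exists w; first by rewrite /D /= wq.
  by rewrite /e wq.
rewrite esum_image.
  rewrite esum_mkcond; apply: le_esum => w _; case: ifPn => [|_].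
    rewrite inE /D /e /=; case sw: (sigma w) => [q|//] _ /=.
    by rewrite (shift_fun_some _ sw).
  by rewrite lee_fin sqr_ge0.
move=> w w'; rewrite !inE /D /e /=.
case sw: (sigma w) => [q|//]; case sw': (sigma w') => [q'|//] _ _ /= qq'.
by apply: sigma_inj sw _; rewrite qq'.
Qed.

Lemma shift_ell2_subproof f : shift_fun f \in @square_summable R W.
Proof. exact: le_lt_trans (sqnorm_shift f) (ell2_funP f). Qed.

Definition shift_ell2 f : H := Ell2 (shift_ell2_subproof f).

Lemma shift_subproof : shift_ell2 \in bounded_linear.
Proof.
apply/asboolP; split=> [c f g|].
  apply: val_inj; apply: funext => q /=.
  rewrite -[LHS]/(shift_fun (fun p => c * f p + g p) q).
  rewrite -[RHS]/(c * shift_fun f q + shift_fun g q).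
  have [[w wq]|nq] := pselect (exists w, sigma w = Some q).
    by rewrite !(shift_fun_some _ wq).
  have {}nq w : sigma w <> Some q by move=> wq; apply: nq; exists w.
  by rewrite !shift_fun_none // mulr0 addr0.
exists 1 => f; rewrite mul1r ler_wsqrtr// fine_le ?sqnorm_fin//.
exact: sqnorm_shift.
Qed.

Definition basis_shift : bop := Bop shift_subproof.

Lemma shift_basis w :
  basis_shift (ell2_basis w) = if sigma w is Some q then ell2_basis q else 0.
Proof.
apply: val_inj; apply: funext => q /=.
have [[w' w'q]|nq] := pselect (exists w, sigma w = Some q).
  rewrite (shift_fun_some _ w'q) /=; case sw: (sigma w) => [q'|] /=.
    congr (nat_of_bool _)%:R; apply/eqP/eqP => [ww'|qq'].
      by move: w'q; rewrite ww' sw => -[].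
    by rewrite qq' in w'q; rewrite (sigma_inj sw w'q).
  by have [ww'|//] := eqVneq w' w; rewrite ww' sw in w'q.
rewrite shift_fun_none; last by move=> w' w'q; apply: nq; exists w'.
case sw: (sigma w) => [q'|] //=.
by have [qq'|//] := eqVneq q q'; case: nq; exists w; rewrite qq'.
Qed.

End PartialInjection.

End Hilbert.

Record digraph := Digraph {
  vertex : Type;
  edge : Type;
  src : edge -> vertex;
  rng : edge -> vertex }.

Arguments src {_} _.
Arguments rng {_} _.

Section Paths.
Variable G : digraph.

(* The path e_1 ... e_n is stored as its list of edges together with its source
   vertex, which is redundant for n >= 1 and is the path itself for n = 0. *)
Definition word_range (v : vertex G) (w : seq (edge G)) : vertex G :=
  if w is e :: _ then rng e else v.

Fixpoint composable (v : vertex G) (w : seq (edge G)) : Prop :=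
  if w is e :: w' then src e = word_range v w' /\ composable v w' else True.

Record dpath := DPath {
  path_src : vertex G;
  path_edges : seq (edge G);
  pathP : composable path_src path_edges }.

HB.instance Definition _ := gen_eqMixin dpath.
HB.instance Definition _ := gen_choiceMixin dpath.

Definition path_range (p : dpath) : vertex G :=
  word_range (path_src p) (path_edges p).

Definition path_cons (e : edge G) (p : dpath) (h : src e = path_range p) : dpath :=
  @DPath (path_src p) (e :: path_edges p) (conj h (pathP p)).

Lemma path_inj (p q : dpath) :
  path_src p = path_src q -> path_edges p = path_edges q -> p = q.
Proof.
case: p q => [v w h] [v' w' h'] /= vv' ww'; subst v' w'.
by rewrite (Prop_irrelevance h h').
Qed.

Definition strongly_connected : Prop :=
  forall x y, exists2 p : dpath, path_src p = x & path_range p = y.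

Variable R : realType.

Definition edge_action (e : edge G) (p : dpath) : option dpath :=
  if pselect (src e = path_range p) is left h then Some (path_cons h) else None.

Definition vertex_action (x : vertex G) (p : dpath) : option dpath :=
  if pselect (path_range p = x) is left _ then Some p else None.

Lemma edge_action_inj e p p' q :
  edge_action e p = Some q -> edge_action e p' = Some q -> p = p'.
Proof.
rewrite /edge_action; case: pselect => // h [<-]; case: pselect => // h' [].
by move=> *; apply: path_inj.
Qed.

Lemma vertex_action_inj x p p' q :
  vertex_action x p = Some q -> vertex_action x p' = Some q -> p = p'.
Proof.
rewrite /vertex_action.
by case: pselect => // h [->]; case: pselect => // h' [->].
Qed.

Definition L_edge (e : edge G) : bop R dpath := basis_shift R (@edge_action_inj e).
Definition L_vertex (x : vertex G) : bop R dpath := basis_shift R (@vertex_action_inj x).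

Lemma L_edge_basis e p (h : src e = path_range p) :
  L_edge e (ell2_basis R p) = ell2_basis R (path_cons h).
Proof.
rewrite shift_basis /edge_action; case: pselect => // h'.
by congr ell2_basis; apply: path_inj.
Qed.

Lemma L_edge_basis0 e p :
  src e <> path_range p -> L_edge e (ell2_basis R p) = 0.
Proof. by move=> h; rewrite shift_basis /edge_action; case: pselect. Qed.

Lemma L_vertex_basis p : L_vertex (path_range p) (ell2_basis R p) = ell2_basis R p.
Proof. by rewrite shift_basis /vertex_action; case: pselect. Qed.

Lemma L_vertex_basis0 x p :
  path_range p <> x -> L_vertex x (ell2_basis R p) = 0.
Proof. by move=> h; rewrite shift_basis /vertex_action; case: pselect. Qed.

Definition generators : set (bop R dpath) := range L_edge `|` range L_vertex.

Definition A_alg : set (bop R dpath) := norm_closed_algebra generators.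
Definition L_alg : set (bop R dpath) := wot_closed_algebra generators.

End Paths.

Arguments A_alg : clear implicits.
Arguments L_alg : clear implicits.

Section Components.
Variable G : digraph.

Definition adjacent (x y : vertex G) : Prop :=
  exists e : edge G, src e = x /\ rng e = y.

Definition linked : vertex G -> vertex G -> Prop := clos_refl_sym_trans _ adjacent.

Definition connected : Prop := forall x y, linked x y.

Lemma linked_rng x (e : edge G) : linked x (src e) -> linked x (rng e).
Proof.
by move=> h; apply: rst_trans h _; apply: rst_step; exists e.
Qed.

Definition component (x : vertex G) : digraph :=
  @Digraph {y | linked x y} {e : edge G | linked x (src e)}
    (fun e => exist _ (src (sval e)) (svalP e))
    (fun e => exist _ (rng (sval e)) (linked_rng (svalP e))).

End Components.

Definition circle_graph (n : nat) : digraph :=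
  @Digraph 'I_n 'I_n (fun j => ordS j) id.

Section Trees.
Variable G : digraph.

Definition polygon (n : nat) (v : 'I_n -> vertex G) (e : 'I_n -> edge G) : Prop :=
  [/\ injective v, injective e &
      forall j, [set rng (e j); src (e j)] = [set v j; v (ordS j)]].

Definition generalized_tree : Prop :=
  [/\ connected G,
      exists x y : vertex G, x <> y &
      forall n v e, (0 < n)%N -> ~ @polygon n v e].

(* The single incident edge is not a loop when G is a generalized tree. *)
Definition leaf (x : vertex G) : Prop :=
  exists! e : edge G, src e = x \/ rng e = x.

End Trees.

Definition graph_sum (G1 G2 : digraph) : digraph :=
  @Digraph (vertex G1 + vertex G2) (edge G1 + edge G2)
    (fun e => match e with inl e1 => inl (src e1) | inr e2 => inr (src e2) end)
    (fun e => match e with inl e1 => inl (rng e1) | inr e2 => inr (rng e2) end).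

Definition graph_bigsum (I : Type) (G : I -> digraph) : digraph :=
  @Digraph {i & vertex (G i)} {i & edge (G i)}
    (fun e => existT _ (projT1 e) (src (projT2 e)))
    (fun e => existT _ (projT1 e) (rng (projT2 e))).

(* Up to isomorphism, G is obtained from K by identifying the vertices related
   by r, the edges being unchanged. *)
Definition obtained_by_identifying (K : digraph)
    (r : vertex K -> vertex K -> Prop) (G : digraph) : Prop :=
  exists (phi : vertex K -> vertex G) (psi : edge K -> edge G),
    [/\ forall y, exists x, phi x = y,
        forall x x', phi x = phi x' <-> clos_refl_sym_trans _ r x x',
        bijective psi &
        forall e, src (psi e) = phi (src e) /\ rng (psi e) = phi (rng e)].

(* The circles are indexed by the elements of V; base lam is the vertex of the
   circle of length n lam which is identified with the leaf lam. *)
Definition generalized_fruit_tree (G : digraph) : Prop :=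
  exists (Gt : digraph) (V : set (vertex Gt)) (n : {v | V v} -> nat)
         (base : forall lam, 'I_(n lam)),
    [/\ generalized_tree Gt, V `<=` @leaf Gt, V <> [set: vertex Gt],
        forall lam, (0 < n lam)%N &
        obtained_by_identifying
          (K := graph_sum Gt (graph_bigsum (fun lam => circle_graph (n lam))))
          (fun x y => exists lam, x = inl (sval lam) /\
                                  y = inr (existT _ lam (base lam)))
          G].

Definition finite_graph (G : digraph) : Prop := finite_set [set: vertex G].

Definition fruit_tree (G : digraph) : Prop :=
  generalized_fruit_tree G /\ finite_graph G.

(* Main.v *)
Require Import Defs.
From mathcomp Require Import all_boot all_order all_algebra finmap complex.
From mathcomp Require Import ring lra.
From mathcomp Require Import all_classical all_reals all_analysis.
From mathcomp Require Import summability zify.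
From Stdlib Require Import Relation_Operators Operators_Properties.

Set Implicit Arguments.
Unset Strict Implicit.
Unset Printing Implicit Defensive.

Import numFieldNormedType.Exports.
Import Order.TTheory GRing.Theory Num.Theory.
Import ComplexField.

Local Open Scope classical_set_scope.
Local Open Scope ring_scope.
Local Open Scope complex_scope.

(** An operator X lies in L_alg exactly when it acts as a convolution
(X f)(q) = sum_{q = w p} a_w f(p) with its symbol a_w = <X xi_{s(w)}, xi_w>:
convolutions form a weakly closed algebra, and conversely a bounded convolution
is the weak limit of its Fejer means.

Both sides of the theorem are equivalent to a condition [star] on every edge e
that lies on no directed cycle: deleting e separates its ends; at most one end
lies on a cycle; and an end lying on a cycle belongs to a strong component which
has, apart from e, at most one edge into and one edge out of each vertex.

If H^1 vanishes, take closed words alpha at r(e) and beta at s(e).  The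
commutator with the operator xi_{u e p} -> xi_{u alpha e beta p} is a bounded
derivation, mapping L_e to L_{alpha e beta} and the other generators to 0.
Comparing symbols in an equation making it inner yields the clauses of [star].

Conversely, let delta be a bounded derivation, normalized to vanish on the L_x,
and for closed words u, q at x let D u q be the coefficient of q in delta(L_u).
Boundedness on the powers of u forces D u (u^a) = 0, and t(w) = lim_k D(u^k)(u^k w)
is the symbol of a bounded operator T with D u = [u, T], for u a first return.
Subtracting T, a second first return v is killed in the same way, after which
all others vanish; dividing by paths back to x extends this to the strong
component of x.  At a circle attached to an edge e, T has to be read off from
delta(L_e) instead; when the circle is at r(e), T is bounded because delta is
bounded on the span of the L_{u^b e}, which makes a Toeplitz operator bounded.
There remains delta(L_e) = c_e L_e on the edges of a finite forest, where c is
the difference of a potential on the vertices. *)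

(** * Norms, matrix entries and weak limits *)

(** Symbols turn every equation into a statement about words; the analytic difficulty is to show
    that the T read off from delta is bounded. Words act from the left, and this makes the two sides
    unequal. A left factor w is divided out of an operator at no cost, by composing with the adjoint
    of the partial isometry L_w, and nearly every T arises as such a quotient of some delta(L_w). A
    right factor cannot be removed in this way, because T L_e only sees T on the range of L_e; hence
    the separate Toeplitz argument for a circle at r(e).

    The closed words at x are the free monoid on the first returns. A correction that settles one
    first return u is determined up to series in the powers of u, which commute with L_u; this
    freedom is what settles a second one.

    As there may be infinitely many edges, the part of a symbol of a given length can have
    infinitely many coefficients, so Fejer means need not be finite combinations of the L_w and are
    approximated in turn. Finiteness of the vertex set makes the sums over vertices finite, in the
    Fejer means, in the normalization of delta and in the global T. *)

Local Notation nc := Normc.normc.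

Section Norms.
Variables (R : realType) (W : choiceType).
Notation H := (ell2 R W).
Implicit Types (f g : H).

Lemma nc0 : nc (0 : R[i]) = 0. Proof. exact: Normc.normc0. Qed.
Lemma ncM (a b : R[i]) : nc (a * b) = nc a * nc b. Proof. exact: Normc.normcM. Qed.
Lemma ncD (a b : R[i]) : nc (a + b) <= nc a + nc b. Proof. exact: le_normcD. Qed.
Lemma ncN (a : R[i]) : nc (- a) = nc a. Proof. exact: normcN. Qed.

Lemma ell2_norm_ge0 f : 0 <= ell2_norm f.
Proof. exact: sqrtr_ge0. Qed.

Lemma ell2_norm_sqr f : ell2_norm f ^+ 2 = fine (sqnorm f).
Proof. by rewrite sqr_sqrtr// fine_ge0// sqnorm_ge0. Qed.

Lemma ell2_norm_sum f (s : seq W) : uniq s ->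
  \sum_(w <- s) nc (f w) ^+ 2 <= ell2_norm f ^+ 2.
Proof.
move=> us; rewrite ell2_norm_sqr -lee_fin fineK ?sqnorm_fin//.
apply: esum_ge; exists [set` s]; first by split.
by rewrite -fsbig_seq// sumEFin.
Qed.

Lemma ell2_of_bound (h : W -> R[i]) (M : R) :
  (forall s, uniq s -> \sum_(w <- s) nc (h w) ^+ 2 <= M) ->
  exists f, (f : W -> R[i]) = h /\ ell2_norm f ^+ 2 <= M.
Proof.
move=> hM.
have hb : (sqnorm h <= M%:E)%E.
  apply: ge_ereal_sup => _ [X [finX XT] <-].
  rewrite fsbig_finite//= sumEFin lee_fin; apply: hM.
  exact: fset_uniq.
have hs : h \in @square_summable R W by apply: le_lt_trans hb (ltry _).
exists (Ell2 hs); split=> //; rewrite ell2_norm_sqr.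
by rewrite -lee_fin fineK ?sqnorm_fin.
Qed.

Lemma ell2P f g : (f : W -> R[i]) =1 g -> f = g.
Proof. by move=> fg; apply: val_inj; apply: funext. Qed.

Lemma ell2_norm_le f (M : R) : 0 <= M ->
  (forall s, uniq s -> \sum_(w <- s) nc (f w) ^+ 2 <= M ^+ 2) -> ell2_norm f <= M.
Proof.
move=> M0 /ell2_of_bound[g [gf]].
have -> : g = f by apply: val_inj.
by rewrite ler_sqr ?nnegrE ?ell2_norm_ge0.
Qed.

Lemma nc_le_ell2_norm f w : nc (f w) <= ell2_norm f.
Proof.
have := @ell2_norm_sum f [:: w] isT; rewrite big_seq1.
by rewrite ler_sqr ?nnegrE ?ell2_norm_ge0 ?normc_ge0.
Qed.

Lemma ell2_norm_basis w : ell2_norm (ell2_basis R w : H) <= 1.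
Proof.
apply: ell2_norm_le => // s us; rewrite expr1n.
have [ws|ws] := boolP (w \in s).
  rewrite (bigD1_seq w)//= eqxx Normc.normc1 expr1n big1 ?addr0// => q /negPf->.
  by rewrite Normc.normc0 expr0n.
rewrite big_seq big1// => q qs /=.
have [qw|_] := eqVneq q w; first by rewrite -qw qs in ws.
by rewrite Normc.normc0 expr0n.
Qed.

Lemma ell2_normZ (c : R[i]) f : ell2_norm (c *: f) = nc c * ell2_norm f.
Proof.
apply/eqP; rewrite eq_le ell2_normZ_le /=.
have [->|c0] := eqVneq c 0; first by rewrite nc0 mul0r ell2_norm_ge0.
have nc_gt0 : 0 < nc c.
  by rewrite lt_def normc_ge0 andbT; apply: contra c0 => /eqP/Normc.eq0_normc ->.
rewrite -ler_pdivlMl//.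
have := ell2_normZ_le c^-1 (c *: f).
by rewrite scalerA mulVf// scale1r Normc.normcV.
Qed.

Lemma ell2_norm0 : ell2_norm (0 : H) = 0.
Proof. by rewrite -(scale0r (0:H)) ell2_normZ nc0 mul0r. Qed.

(** If no finite sum came within e of the squared norm, [ell2_of_bound] would bound the squared norm
    by itself minus e. *)
Lemma ell2_norm_tail f (e : R) : 0 < e -> exists2 s, uniq s &
  forall s', uniq s' -> (forall w, w \in s' -> w \notin s) ->
    \sum_(w <- s') nc (f w) ^+ 2 <= e.
Proof.
move=> e0.
have [s us hs] : exists2 s, uniq s &
    ell2_norm f ^+ 2 - e < \sum_(w <- s) nc (f w) ^+ 2.
  apply: contrapT => hn.
  have h : forall s, uniq s -> \sum_(w <- s) nc (f w) ^+ 2 <= ell2_norm f ^+ 2 - e.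
    by move=> s us; rewrite leNgt; apply/negP => lt; apply: hn; exists s.
  have [g [gf]] := ell2_of_bound h.
  have -> : g = f by apply: val_inj.
  by rewrite lerBrDr gerDl leNgt e0.
exists s => // s' us' ss'.
have := @ell2_norm_sum f (s ++ s').
rewrite cat_uniq us us' andbT big_cat /=.
have -> : ~~ has (in_mem^~ (mem s)) s' by apply/hasPn.
move=> /(_ isT); lra.
Qed.

Implicit Types (S T : bop R W).

Lemma bop_bound T : exists2 M : R, 0 <= M & forall f, ell2_norm (T f) <= M * ell2_norm f.
Proof.
have /asboolP[_ [M HM]] := bop_funP T.
exists `|M| => // f; apply: le_trans (HM f) _.
by rewrite ler_wpM2r ?ell2_norm_ge0 ?ler_norm.
Qed.

Lemma bop0 T : T 0 = 0.
Proof. by apply: (addrI (T 0)); have := bop_linear T 1 0 0; rewrite !scale1r !addr0. Qed.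
Lemma bopZ T c f : T (c *: f) = c *: T f.
Proof. by have := bop_linear T c f 0; rewrite bop0 !addr0. Qed.

Lemma opnorm_sup T : has_sup [set ell2_norm (T f) | f in [set f | ell2_norm f <= 1]].
Proof.
have [M M0 HM] := bop_bound T; split.
  by exists (ell2_norm (T 0)); exists 0 => //=; rewrite ell2_norm0.
exists M => _ [f /= f1 <-]; apply: le_trans (HM f) _.
by rewrite -[leRHS]mulr1 ler_wpM2l.
Qed.

Lemma opnorm_ge0 T : 0 <= opnorm T.
Proof.
apply: le_trans (ell2_norm_ge0 (T 0)) _; apply: ub_le_sup.
  by case: (opnorm_sup T).
by exists 0 => //=; rewrite ell2_norm0.
Qed.

Lemma ell2_norm0_eq0 f : ell2_norm f = 0 -> f = 0.
Proof.
move=> f0; apply: ell2P => w; apply: Normc.eq0_normc; apply/eqP.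
by rewrite eq_le normc_ge0 andbT -f0 nc_le_ell2_norm.
Qed.

Lemma opnormP T f : ell2_norm (T f) <= opnorm T * ell2_norm f.
Proof.
have [f0|f0] := eqVneq (ell2_norm f) 0.
  by rewrite (ell2_norm0_eq0 f0) bop0 ell2_norm0 mulr0.
have fgt : 0 < ell2_norm f by rewrite lt_def f0 ell2_norm_ge0.
rewrite -ler_pdivrMr//.
have ncf : nc (((ell2_norm f)^-1)%:C) = (ell2_norm f)^-1.
  by rewrite /= expr0n /= addr0 sqrtr_sqr ger0_norm// invr_ge0 ltW.
have -> : ell2_norm (T f) / ell2_norm f = ell2_norm (T (((ell2_norm f)^-1)%:C *: f)).
  by rewrite bopZ ell2_normZ ncf mulrC.
apply: ub_le_sup; first by case: (opnorm_sup T).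
exists (((ell2_norm f)^-1)%:C *: f) => //=.
by rewrite ell2_normZ ncf mulVf.
Qed.

Lemma opnorm_le T (M : R) : 0 <= M ->
  (forall f, ell2_norm (T f) <= M * ell2_norm f) -> opnorm T <= M.
Proof.
move=> M0 HM; apply: ge_sup; first by case: (opnorm_sup T).
move=> _ [f /= f1 <-]; apply: le_trans (HM f) _.
by rewrite -[leRHS]mulr1 ler_wpM2l.
Qed.

Lemma bop_addE S T f : (S + T) f = S f + T f. Proof. by []. Qed.
Lemma bop_oppE T f : (- T) f = - T f. Proof. by []. Qed.
Lemma bop_scaleE c T f : (c *: T) f = c *: T f. Proof. by []. Qed.
Lemma bop_mulE S T f : (S * T) f = S (T f). Proof. by []. Qed.

Lemma ell2_normN f : ell2_norm (- f) = ell2_norm f.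
Proof. by rewrite -scaleN1r ell2_normZ ncN Normc.normc1 mul1r. Qed.

(** The factor 2 is inherited from [ell2_normD_le]; norms of sums of operators are only ever
    estimated up to a constant. *)
Lemma opnormD_le S T : opnorm (S + T) <= 2 * (opnorm S + opnorm T).
Proof.
apply: opnorm_le => [|f]; first by rewrite mulr_ge0// addr_ge0 ?opnorm_ge0.
apply: le_trans (ell2_normD_le _ _) _.
by rewrite -mulrA ler_wpM2l// mulrDl lerD// opnormP.
Qed.

Lemma opnormM_le S T : opnorm (S * T) <= opnorm S * opnorm T.
Proof.
apply: opnorm_le => [|f]; first by rewrite mulr_ge0// opnorm_ge0.
apply: le_trans (opnormP S (T f)) _.
by rewrite -mulrA ler_wpM2l ?opnorm_ge0// opnormP.
Qed.

Lemma opnormN T : opnorm (- T) = opnorm T.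
Proof.
suff h (U : bop R W) : opnorm (- U) <= opnorm U.
  by apply/eqP; rewrite eq_le h /= -{1}[T]opprK h.
apply: opnorm_le; first exact: opnorm_ge0.
by move=> f; rewrite bop_oppE ell2_normN opnormP.
Qed.

Lemma opnorm_entry T f w : nc (T f w) <= opnorm T * ell2_norm f.
Proof. exact: le_trans (nc_le_ell2_norm _ _) (opnormP _ _). Qed.

End Norms.

#[local] Existing Instance totally_filter.

Lemma cvg_initial (X : choiceType) (Y : topologicalType) (p : X -> Y) (I : Type)
    (F : set_system I) (u : I -> X) (x : X) : Filter F ->
  p (u i) @[i --> F] --> p x -> u i @[i --> F] --> (x : initial_topology p).
Proof.
move=> FF ux A /= [_ [[B Bop <-] Bfs sBfA]].
rewrite nbhs_filterE /=; have := ux B; rewrite nbhs_filterE /=.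
have nB : nbhs (p x) B by rewrite nbhsE; exists B.
by move=> /(_ nB); apply: filterS => i; exact: sBfA.
Qed.

Lemma cvg_ptws (U : Type) (V : topologicalType) (I : Type) (F : set_system I)
    (u : I -> U -> V) (v : U -> V) : Filter F ->
  (forall t, u i t @[i --> F] --> v t) -> u i @[i --> F] --> (v : {ptws U -> V}).
Proof. by move=> FF uv; apply/cvg_sup => t; apply: cvg_initial; exact: uv. Qed.

Section InnerProduct.
Variables (R : realType) (W : choiceType).
Notation H := (ell2 R W).
Implicit Types (f g : H).

Lemma ncE (z : R[i]) : `|z| = (nc z)%:C.
Proof. by rewrite normc_def; case: z. Qed.

Lemma cvgcP (I : Type) (F : set_system I) (u : I -> R[i]) (l : R[i]) :
  Filter F -> (forall e : R, 0 < e -> \forall i \near F, nc (l - u i) <= e) <->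
  u i @[i --> F] --> (l : R[i]^o).
Proof.
move=> FF; split.
  move=> h; apply/(@cvgrPdist_le R[i] R[i]^o I F _ u l) => e e0.
  have ee : e = (complex.Re e)%:C.
    by move: e0; rewrite ltcE; case: (e) => a b /= /andP[/eqP -> _].
  have re0 : 0 < complex.Re e by move: e0; rewrite ltcE => /andP[].
  apply: filterS (h _ re0) => i hi.
  by rewrite ee -[X in X <= _]/(`|l - u i|) ncE lecR.
move=> /(@cvgrPdist_le R[i] R[i]^o I F _ u l) h e e0.
have e0' : 0 < e%:C by rewrite ltcR.
apply: filterS (h _ e0') => i.
by rewrite -[X in X <= _]/(`|l - u i|) ncE lecR.
Qed.

Lemma partial_sumE (x : W -> R[i]^o) (A : {fset W}) : partial_sum x A = \sum_(w <- A) x w.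
Proof. by rewrite /partial_sum big_seq_fsetE. Qed.

Lemma sq_cvg f : partial_sum (fun w => f w * conjc (f w) : R[i]^o) A
  @[A --> totally] --> ((ell2_norm f ^+ 2)%:C : R[i]^o).
Proof.
apply/cvgcP => e e0.
have [s us hs] := ell2_norm_tail f e0.
exists [fset x in s]%fset => // A /= sA.
rewrite partial_sumE.
have -> : \sum_(w <- A) f w * conjc (f w) = (\sum_(w <- A) nc (f w) ^+ 2)%:C.
  rewrite rmorph_sum; apply: eq_bigr => w _.
  by rewrite -sqr_normc ncE -rmorphXn.
rewrite -rmorphB /= expr0n addr0 sqrtr_sqr ger0_norm; last first.
  by rewrite subr_ge0 ell2_norm_sum.
rewrite lerBlDr.
(* A finite sum splits into a part inside A and a part disjoint from s, and the latter is at most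
   e. *)
have h : ell2_norm f ^+ 2 <= (Num.sqrt (e + \sum_(w <- A) nc (f w) ^+ 2)) ^+ 2.
  rewrite ler_sqr ?nnegrE ?sqrtr_ge0 ?ell2_norm_ge0//.
  have pos : 0 <= e + \sum_(w <- A) nc (f w) ^+ 2.
    by rewrite addr_ge0 ?(ltW e0) ?sumr_ge0// => *; rewrite sqr_ge0.
  apply: ell2_norm_le; first exact: sqrtr_ge0.
  move=> s' us'; rewrite sqr_sqrtr// addrC.
  rewrite (bigID (fun w => w \in A))/=; apply: lerD.
    rewrite -big_filter; rewrite (perm_big [seq w <- A | w \in s']).
      rewrite big_filter [leRHS](bigID (fun w => w \in s'))/= lerDl.
      by rewrite sumr_ge0// => *; rewrite sqr_ge0.
    apply: uniq_perm; rewrite ?filter_uniq// ?fset_uniq//.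
    by move=> w; rewrite !mem_filter andbC.
  rewrite -big_filter; apply: hs; first by rewrite filter_uniq.
  move=> w; rewrite mem_filter => /andP[wA _].
  apply: contra wA => ws; move/fsubsetP: sA; apply.
  by rewrite inE.
rewrite sqr_sqrtr// in h.
by rewrite addr_ge0 ?(ltW e0) ?sumr_ge0// => *; rewrite sqr_ge0.
Qed.

Lemma polarize (x y : R[i]) : x * conjc y =
  4^-1 * ((x + 1 * y) * conjc (x + 1 * y)) - 4^-1 * ((x + (-1) * y) * conjc (x + (-1) * y))
  + ((4^-1 * 'i%C) * ((x + 'i%C * y) * conjc (x + 'i%C * y))
     - (4^-1 * 'i%C) * ((x + (- 'i%C) * y) * conjc (x + (- 'i%C) * y))).
Proof.
have k4 : (4 : R[i]) != 0 by rewrite pnatr_eq0.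
apply: (mulfI k4); rewrite !mulrDr !mulrN !mulrA divff// !mul1r.
have -> : (4 : R[i]) = (4 : R)%:C by rewrite rmorph_nat.
case: x y => [a b] [c d].
apply/eqP; rewrite eq_complex /=; apply/andP; split; apply/eqP; ring.
Qed.

Definition pvec (f g : H) (c : R[i]) : H := f + c *: g.
Lemma pvecE f g c w : pvec f g c w = f w + c * g w. Proof. by []. Qed.
Definition pol (f g : H) (c : R[i]) : R[i] := (ell2_norm (pvec f g c) ^+ 2)%:C.

(** [ell2_inner] is defined as a limit, which might be a default value. By polarization its partial
    sums are a combination of four sums of squares, each convergent by [sq_cvg]. *)
Lemma inner_cvg f g : partial_sum (fun w => f w * conjc (g w) : R[i]^o) A
  @[A --> totally] --> (ell2_inner f g : R[i]^o).
Proof.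
suff [l hl] : exists l : R[i]^o, partial_sum (fun w => f w * conjc (g w) : R[i]^o) A
  @[A --> totally] --> l.
  rewrite /ell2_inner /sum.
  have -> : lim (partial_sum (fun w => f w * conjc (g w) : R[i]^o) @ totally) = l.
    exact: (@cvg_lim R[i]^o).
  exact: hl.
pose k : R[i] := 4^-1.
exists (k *: (pol f g 1 : R[i]^o) - k *: (pol f g (-1) : R[i]^o)
  + ((k * 'i%C) *: (pol f g 'i%C : R[i]^o) - (k * 'i%C) *: (pol f g (- 'i%C) : R[i]^o))).
have key : partial_sum (fun w => f w * conjc (g w) : R[i]^o) =
   (fun A => k *: partial_sum (fun w => pvec f g 1 w * conjc (pvec f g 1 w) : R[i]^o) A
   - k *: partial_sum (fun w => pvec f g (-1) w * conjc (pvec f g (-1) w) : R[i]^o) A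
   + ((k * 'i%C) *: partial_sum (fun w => pvec f g 'i%C w * conjc (pvec f g 'i%C w) : R[i]^o) A
   - (k * 'i%C) *: partial_sum (fun w => pvec f g (- 'i%C) w * conjc (pvec f g (- 'i%C) w) : R[i]^o) A)).
  apply: funext => A; rewrite !partial_sumE !scaler_sumr -!sumrB -big_split.
  by apply: eq_bigr => w _; rewrite !pvecE polarize.
rewrite key.
apply: cvgD; apply: cvgB; apply: cvgZl_tmp; exact: sq_cvg.
Qed.
End InnerProduct.

#[local] Existing Instance totally_filter.
#[local] Arguments partial_sum : simpl never.

Section WeakLimits.
Variables (R : realType) (W : choiceType).
Notation H := (ell2 R W).
Implicit Types (f g : H).

Lemma nc_partial_sum (x : W -> R[i]) (A : seq W) :
  nc (\sum_(w <- A) x w) <= \sum_(w <- A) nc (x w).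
Proof.
elim: A => [|a A IH]; first by rewrite !big_nil nc0.
by rewrite !big_cons; apply: le_trans (ncD _ _) _; rewrite lerD2l.
Qed.

Lemma ell2_innerB f f' g : ell2_inner (f - f') g = ell2_inner f g - ell2_inner f' g.
Proof.
apply: (@cvg_unique R[i]^o (@norm_hausdorff _ R[i]^o) (partial_sum (fun w => (f - f') w * conjc (g w) : R[i]^o) @ totally)).
  exact: inner_cvg.
have -> : partial_sum (fun w => (f - f') w * conjc (g w) : R[i]^o) =
   fun A => partial_sum (fun w => f w * conjc (g w) : R[i]^o) A -
            partial_sum (fun w => f' w * conjc (g w) : R[i]^o) A.
  apply: funext => A; rewrite !partial_sumE -sumrB; apply: eq_bigr => w _.
  by rewrite -mulrBl.
by apply: cvgB; exact: inner_cvg.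
Qed.

Lemma ell2_inner_basis f w : ell2_inner f (ell2_basis R w) = f w.
Proof.
apply: (@cvg_unique R[i]^o (@norm_hausdorff _ R[i]^o) (partial_sum (fun q => f q * conjc (ell2_basis R w q) : R[i]^o) @ totally)).
  exact: inner_cvg.
have h A : w \in A -> partial_sum (fun q => f q * conjc (ell2_basis R w q) : R[i]^o) A = f w.
  move=> wA; rewrite partial_sumE (bigD1_seq w) ?fset_uniq//= eqxx rmorph1 mulr1.
  by rewrite big1 ?addr0// => q /negPf ->; rewrite rmorph0 mulr0.
apply/cvgcP => e e0; exists [fset w]%fset => // A wA.
by rewrite [X in nc (_ - X)]h ?subrr ?nc0 ?ltW// -fsub1set.
Qed.

(* Splitting off a finite part of g; AM-GM [ab <= e a^2 + b^2/e] on the rest. *)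
Lemma ell2_inner_small g (K e : R) : 0 <= K -> 0 < e -> exists2 s, uniq s &
  forall f, ell2_norm f <= K -> nc (ell2_inner f g) <=
    \sum_(w <- s) nc (f w) * nc (g w) + e * (K ^+ 2 + 1).
Proof.
move=> K0 e0.
have [s us hs] := ell2_norm_tail g (exprn_gt0 2 e0).
exists s => // f fK.
apply/ler_addgt0Pr => d d0.
have := @inner_cvg R W f g; move/cvgcP => /(_ d d0)[B _ hB].
have {hB} := hB (B `|` [fset x in s])%fset (fsubsetUl _ _).
set A := (_ `|` _)%fset => hA.
have {}hA : nc (ell2_inner f g - \sum_(w <- A) f w * conjc (g w)) <= d.
  by rewrite -[X in _ - X](partial_sumE (fun w => f w * conjc (g w) : R[i]^o)).
have sA : {subset s <= A} by move=> w ws; rewrite !inE ws orbT.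
apply: (@le_trans _ _ (nc (\sum_(w <- A) f w * conjc (g w)) + d)).
  rewrite -[X in nc X](subrK (\sum_(w <- A) f w * conjc (g w))) addrC.
  by apply: le_trans (ncD _ _) _; rewrite lerD2l.
rewrite lerD2r; apply: le_trans (nc_partial_sum _ _) _.
have ncJ (z : R[i]) : nc (conjc z) = nc z by case: z => a b /=; rewrite sqrrN.
under eq_bigr do rewrite ncM ncJ.
rewrite (bigID (mem s))/=; apply: lerD.
  rewrite -big_filter (perm_big s)//.
  apply: uniq_perm => //; first by rewrite filter_uniq ?fset_uniq.
  by move=> w; rewrite mem_filter; case ws: (w \in s); rewrite //= sA.
apply: (@le_trans _ _ (\sum_(w <- A | w \notin s) (e * nc (f w) ^+ 2 + e^-1 * nc (g w) ^+ 2))).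
  apply: ler_sum => w _; set a := nc _; set b := nc _.
  have a0 : 0 <= a by exact: normc_ge0.
  have b0 : 0 <= b by exact: normc_ge0.
  have ev : e * e^-1 = 1 by rewrite divff// gt_eqF.
  have ie : 0 < e^-1 by rewrite invr_gt0.
  have h1 : 0 <= e * (a - e^-1 * b) ^+ 2 by rewrite mulr_ge0 ?sqr_ge0// ltW.
  have h2 : 0 <= a * b by rewrite mulr_ge0.
  have : e * (a - e^-1 * b) ^+ 2 = e * a ^+ 2 - (2 * (e * e^-1)) * (a * b) + (e * e^-1) * (e^-1 * b ^+ 2).
    by ring.
  rewrite ev mul1r mulr1.
  lra.
rewrite big_split/= -!mulr_sumr mulrDr mulr1; apply: lerD.
  rewrite ler_wpM2l ?(ltW e0)//; rewrite -big_filter.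
  apply: le_trans (ell2_norm_sum f _) _; first by rewrite filter_uniq ?fset_uniq.
  by rewrite ler_sqr ?nnegrE ?ell2_norm_ge0.
rewrite -big_filter.
have := hs [seq w <- A | w \notin s]; rewrite filter_uniq ?fset_uniq// => /(_ isT).
have h w : w \in [seq w <- A | w \notin s] -> w \notin s by rewrite mem_filter => /andP[].
move=> /(_ h) {}h; rewrite ler_pdivrMl//.
Qed.

(** Against a fixed g, [ell2_inner_small] leaves finitely many entries, on which convergence is
    uniform; the bound K on the norms controls the rest. *)
Lemma ell2_weak_cvg (h : nat -> H) f g (K : R) :
  (forall n, ell2_norm (h n) <= K) ->
  (forall w (e : R), 0 < e -> exists N, forall n, (N <= n)%N -> nc (f w - h n w) <= e) ->
  ell2_inner (h n) g @[n --> \oo] --> (ell2_inner f g : R[i]^o).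
Proof.
move=> hK hf; apply/cvgcP => e e0.
have K0 : 0 <= K by apply: le_trans (ell2_norm_ge0 (h 0%N)) _.
pose K' := 2 * (ell2_norm f + K).
have K'0 : 0 <= K' by rewrite mulr_ge0// addr_ge0// ell2_norm_ge0.
have e'0 : 0 < e / 2 / (K' ^+ 2 + 1).
  by rewrite divr_gt0// ?divr_gt0// ltr_wpDl// sqr_ge0.
have [s us hs] := ell2_inner_small g K'0 e'0.
pose G := ell2_norm g + 1.
have G0 : 0 < G by rewrite ltr_wpDl ?ell2_norm_ge0.
(* The [size s] products are each at most d * G, so they add up to at most e / 2; the successor
   avoids a division by zero. *)
pose d := e / 2 / (G * (size s).+1%:R).
have d0 : 0 < d by rewrite divr_gt0 ?divr_gt0 ?mulr_gt0.
have [N hN] : exists N, forall n, (N <= n)%N -> forall w, w \in s -> nc (f w - h n w) <= d.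
  elim: (s) => [|w r [N1 IH]]; first by exists 0%N.
  have [N2 h2] := hf w _ d0.
  exists (maxn N1 N2) => n; rewrite geq_max => /andP[n1 n2] q.
  by rewrite inE => /orP[/eqP ->|]; [exact: h2|exact: IH].
exists N => // n /= Nn; rewrite -ell2_innerB.
have nb : ell2_norm (f - h n) <= K'.
  apply: le_trans (ell2_normD_le _ _) _; rewrite ell2_normN ler_wpM2l// lerD2l.
  exact: hK.
apply: le_trans (hs _ nb) _.
rewrite divfK; last by rewrite gt_eqF// ltr_wpDl// sqr_ge0.
rewrite [leRHS](splitr e) lerD2r.
apply: (@le_trans _ _ (\sum_(w <- s) d * G)).
  rewrite big_seq [leRHS]big_seq; apply: ler_sum => w ws.
  rewrite ler_pM ?normc_ge0//; first exact: (hN n Nn w ws).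
  by apply: le_trans (nc_le_ell2_norm _ _) _; rewrite lerDl.
rewrite big_const_seq count_predT iter_addr_0 -mulr_natl /d.
rewrite [leLHS](_ : _ = e / 2 * ((size s)%:R / (size s).+1%:R)); last first.
  by field; rewrite gt_eqF ?ltr_pwDl ?ler0n ?ltr01//= gt_eqF.
apply: (@le_trans _ _ (e / 2 * 1)); last by rewrite !mulr1.
rewrite ler_wpM2l ?divr_ge0 ?(ltW e0)//.
by rewrite ler_pdivrMr// mul1r ler_nat.
Qed.

Implicit Types (S T : bop R W).

(** Every approximation inside [L_alg] goes through this criterion: uniform boundedness turns
    convergence of entries into weak convergence. *)
Lemma wot_closed_seq (A : set (bop R W)) (S : nat -> bop R W) T (K : R) :
  wot_closed A -> (forall n, A (S n)) ->
  (forall n f, ell2_norm (S n f) <= K * ell2_norm f) ->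
  (forall f w (e : R), 0 < e -> exists N, forall n, (N <= n)%N -> nc (T f w - S n f w) <= e) ->
  A T.
Proof.
move=> cA AS SK ST.
apply: (@closed_cvg nat (initial_topology (@matrix_coef R W)) \oo _ S A cA _ T).
  by exists 0%N.
apply: cvg_initial; apply: cvg_ptws => -[f g] /=.
apply: ell2_weak_cvg => [n|w e e0]; first exact: SK.
exact: ST.
Qed.

Lemma wot_entry_continuous f w :
  continuous ((fun T => T f w : R[i]^o) : initial_topology (@matrix_coef R W) -> R[i]^o).
Proof.
have -> : (fun T : bop R W => T f w : R[i]^o) =
   (fun x : {ptws (H * H)%type -> R[i]^o} => x (f, ell2_basis R w)) \o @matrix_coef R W.
  by apply: funext => T /=; rewrite /matrix_coef /= ell2_inner_basis.
move=> T; apply: continuous_comp; first exact: initial_continuous.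
exact: (@proj_continuous _ (fun _ => R[i]^o)).
Qed.

(* Closed because it is defined by linear equations between matrix entries. *)
Lemma wot_closed_entries (I : Type) (J : I -> seq nat) (u u0 : I -> nat -> H) (q q0 : I -> nat -> W) (c : I -> nat -> R[i]) :
  wot_closed [set T : bop R W | forall i, \sum_(j <- J i) c i j * T (u i j) (q i j) = T (u0 i 0%N) (q0 i 0%N)].
Proof.
have -> : [set T : bop R W | forall i, \sum_(j <- J i) c i j * T (u i j) (q i j) = T (u0 i 0%N) (q0 i 0%N)]
  = \bigcap_(i in setT) ((fun T : initial_topology (@matrix_coef R W) => \sum_(j <- J i) c i j * T (u i j) (q i j) - T (u0 i 0%N) (q0 i 0%N) : R[i]^o) @^-1` [set 0]).
  apply/seteqP; split=> T /= h i; first by move=> _; rewrite /preimage /= (h i) subrr.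
  by apply/eqP; rewrite -subr_eq0; have := h i Logic.I; rewrite /preimage /= => ->.
apply: closed_bigI => i _; apply: preimage_closed; last first.
  apply: accessible_closed_set1; apply: hausdorff_accessible.
  exact: (@norm_hausdorff _ R[i]^o).
pose Z := initial_topology (@matrix_coef R W).
have cs r : continuous ((fun T : Z => \sum_(j <- r) c i j * (T : bop R W) (u i j) (q i j)) : Z -> R[i]^o).
  elim: r => [|j r IH].
    rewrite (_ : (fun _ => _) = cst 0 :> (Z -> R[i]^o)); first exact: cst_continuous.
    by apply: funext => T; rewrite big_nil.
  rewrite (_ : (fun _ => _) = (fun T : Z => c i j * (T : bop R W) (u i j) (q i j) +
     \sum_(j <- r) c i j * (T : bop R W) (u i j) (q i j)) :> (Z -> R[i]^o)).
    move=> T; have FF : Filter (nbhs (T : Z)) by exact: nbhs_filter.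
    apply: (@cvgD _ R[i]^o _ _ FF); last exact: IH.
    exact: (@cvgZl_tmp _ R[i]^o _ _ FF (c i j) _ _ (@wot_entry_continuous (u i j) (q i j) T)).
  by apply: funext => T; rewrite big_cons.
move=> T _; have FF : Filter (nbhs (T : Z)) by exact: nbhs_filter.
by apply: (@cvgB _ R[i]^o _ _ FF); [exact: cs|exact: wot_entry_continuous].
Qed.
End WeakLimits.

(** * Words and convolutions *)

Section Words.
Variables (R : realType) (G : digraph).
Notation V := (vertex G).
Notation E := (edge G).
Notation P := (dpath G).
Notation sym := (V -> seq E -> R[i]).
Implicit Types (X Y : bop R P) (x y : V) (e : E) (u v w : seq E) (a b F : sym).

Lemma word_range_cat x u v : word_range x (u ++ v) = word_range (word_range x v) u.
Proof. by case: u. Qed.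

Lemma composable_cat x u v :
  composable x (u ++ v) <-> composable (word_range x v) u /\ composable x v.
Proof.
elim: u => [|e u IH] /=; first by tauto.
by rewrite word_range_cat IH; tauto.
Qed.

(* Functions on paths, extended by 0 to all pairs of a source and a word. *)
Definition at_ (f : P -> R[i]) : sym := fun x w =>
  if pselect (composable x w) is left h then f (DPath h) else 0.

Lemma at_path (f : P -> R[i]) (p : P) : at_ f (path_src p) (path_edges p) = f p.
Proof.
rewrite /at_; case: pselect => [h|[]]; last exact: Defs.pathP.
by congr f; apply: path_inj.
Qed.

Lemma at_comp (f : P -> R[i]) x w (h : composable x w) : at_ f x w = f (DPath h).
Proof. by rewrite -(at_path f (DPath h)). Qed.

Lemma at_ncomp (f : P -> R[i]) x w : ~ composable x w -> at_ f x w = 0.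
Proof. by rewrite /at_; case: pselect. Qed.

(** The sum over the factorizations w = u v of a(u) F(v), where a also takes the source of u, that
    is, the range of v; see [conv_sum]. Moving the letters of w into a one at a time makes
    associativity an induction on w. *)
Fixpoint cnv a F x w : R[i] :=
  if w is e :: w' then a (rng e) [::] * F x w + cnv (fun y u => a y (e :: u)) F x w'
  else a x [::] * F x [::].

Lemma conv_sum a F x w : cnv a F x w =
  \sum_(i <- iota 0 (size w).+1) a (word_range x (drop i w)) (take i w) * F x (drop i w).
Proof.
elim: w a => [|e w IH] a; first by rewrite /= big_seq1.
have -> : iota 0 (size (e :: w)).+1 = 0%N :: [seq i.+1 | i <- iota 0 (size w).+1].
  exact: (congr1 (cons 0%N) (iotaDl 1 0 (size w).+1)).
rewrite big_cons big_map [LHS]/= IH.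
by congr (_ + _).
Qed.

Lemma conv_addl a b F x w :
  cnv (fun y u => a y u + b y u) F x w = cnv a F x w + cnv b F x w.
Proof.
elim: w a b => [|e w IH] a b /=; first by rewrite mulrDl.
by rewrite IH mulrDl addrACA.
Qed.

Lemma conv_scalel c a F x w :
  cnv (fun y u => c * a y u) F x w = c * cnv a F x w.
Proof.
elim: w a => [|e w IH] a /=; first by rewrite mulrA.
by rewrite IH mulrDr mulrA.
Qed.

Lemma conv_addr a F F' x w :
  cnv a (fun y u => F y u + F' y u) x w = cnv a F x w + cnv a F' x w.
Proof.
elim: w a => [|e w IH] a /=; first by rewrite mulrDr.
by rewrite IH mulrDr addrACA.
Qed.

Lemma conv_scaler c a F x w :
  cnv a (fun y u => c * F y u) x w = c * cnv a F x w.
Proof.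
elim: w a => [|e w IH] a /=; first by rewrite mulrCA.
by rewrite IH mulrDr mulrCA.
Qed.

Lemma eq_convl a b F x w : (forall y u, a y u = b y u) -> cnv a F x w = cnv b F x w.
Proof. by move=> ab; congr (cnv _ F x w); apply: funext => y; apply: funext => u. Qed.

Lemma eq_convr a F F' x w : (forall u, F x u = F' x u) -> cnv a F x w = cnv a F' x w.
Proof.
move=> FF'; elim: w a => [|e w IH] a /=; first by rewrite FF'.
by rewrite IH FF'.
Qed.

Lemma convA a b F x w : cnv (cnv a b) F x w = cnv a (cnv b F) x w.
Proof.
elim: w a b => [|e w IH] a b /=; first by rewrite mulrA.
rewrite (@conv_addl (fun y u => a (rng e) [::] * b y (e :: u))).
by rewrite conv_scalel IH mulrDr mulrA addrA.
Qed.

Definition vpath x : P := @DPath G x [::] I.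
Definition one_ x : ell2 R P := ell2_basis R (vpath x).

Lemma at_one x y w : at_ (one_ x) y w = (`[< y = x /\ w = [::] >])%:R.
Proof.
have [h|h] := pselect (composable y w).
  rewrite (at_comp _ h) /=; congr (nat_of_bool _)%:R.
  apply/eqP/asboolP => [[]//|[yx w0]]; first by move: h; rewrite yx w0 => h; apply: path_inj.
rewrite at_ncomp//; case: asboolP => // -[_ w0]; case: h; rewrite w0; exact: I.
Qed.

(* The coefficient of xi_w in the image of the path of length 0 at the source of w. *)
Definition cf (X : bop R P) : sym := at_ (fun p => X (one_ (path_src p)) p).

Lemma cfE X x w : cf X x w = at_ (X (one_ x)) x w.
Proof.
have [h|h] := pselect (composable x w); last by rewrite /cf !at_ncomp.
by rewrite /cf !(at_comp _ h).
Qed.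

Lemma cf_path X (p : P) : cf X (path_src p) (path_edges p) = X (one_ (path_src p)) p.
Proof. by rewrite /cf at_path. Qed.

Lemma cf_ncomp X x w : ~ composable x w -> cf X x w = 0.
Proof. exact: at_ncomp. Qed.

Definition supp a := forall x w, ~ composable x w -> a x w = 0.

Lemma conv_ncomp a F : supp a -> supp F -> supp (cnv a F).
Proof.
move=> sa sF x w h; rewrite conv_sum big1// => i _.
have [h1|h1] := pselect (composable x (drop i w)); last by rewrite sF// mulr0.
rewrite sa ?mul0r// => h2; apply: h.
by rewrite -(cat_take_drop i w) composable_cat.
Qed.

Lemma atD (f g : ell2 R P) x w : at_ (f + g) x w = at_ f x w + at_ g x w.
Proof. by rewrite /at_; case: pselect => // _; rewrite addr0. Qed.
Lemma atZ c (f : ell2 R P) x w : at_ (c *: f) x w = c * at_ f x w.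
Proof. by rewrite /at_; case: pselect => // _; rewrite mulr0. Qed.
Lemma at0 x w : at_ (0 : ell2 R P) x w = 0.
Proof. by rewrite /at_; case: pselect. Qed.
Lemma atN (f : ell2 R P) x w : at_ (- f) x w = - at_ f x w.
Proof. by rewrite /at_; case: pselect => // _; rewrite oppr0. Qed.

Lemma at_inj (f g : ell2 R P) : (forall x w, at_ f x w = at_ g x w) -> f = g.
Proof. by move=> fg; apply: ell2P => p; rewrite -!at_path fg. Qed.

Definition convform (X : bop R P) := forall f x w, at_ (X f) x w = cnv (cf X) (at_ f) x w.

Lemma conv_one a x w : cnv a (at_ (one_ x)) x w = a x w.
Proof.
elim: w a => [|e w IH] a /=.
  by rewrite at_one asboolT// mulr1.
by rewrite IH at_one asboolF ?mulr0 ?add0r// => -[].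
Qed.

(** The symbol is forced: convolving a with the basis vector of a path of length 0 returns a
    ([conv_one]). *)
Lemma convformP (X : bop R P) a : supp a -> (forall f x w, composable x w -> at_ (X f) x w = cnv a (at_ f) x w) ->
  convform X /\ cf X = a.
Proof.
move=> sa h.
have ca : cf X = a.
  apply: funext => x; apply: funext => w; rewrite cfE.
  have [c|c] := pselect (composable x w); last by rewrite sa// at_ncomp.
  by rewrite h// conv_one.
split=> // f x w; rewrite ca.
have [c|c] := pselect (composable x w); first exact: h.
by rewrite conv_ncomp ?at_ncomp// => ? ? ?; rewrite at_ncomp.
Qed.

Lemma convform_inj X Y : convform X -> convform Y -> (forall x w, cf X x w = cf Y x w) -> X = Y.
Proof.
move=> cX cY h; apply: bopP => f; apply: at_inj => x w.
by rewrite cX cY; apply: eq_convl.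
Qed.

Lemma cfD X Y x w : cf (X + Y) x w = cf X x w + cf Y x w.
Proof. by rewrite !cfE bop_addE atD. Qed.
Lemma cfZ c X x w : cf (c *: X) x w = c * cf X x w.
Proof. by rewrite !cfE bop_scaleE atZ. Qed.
Lemma cfN X x w : cf (- X) x w = - cf X x w.
Proof. by rewrite !cfE bop_oppE atN. Qed.
Lemma cfB X Y x w : cf (X - Y) x w = cf X x w - cf Y x w.
Proof. by rewrite cfD cfN. Qed.
Lemma cf0 x w : cf 0 x w = 0.
Proof. by rewrite !cfE at0. Qed.
Lemma cfM X Y x w : convform X -> cf (X * Y) x w = cnv (cf X) (cf Y) x w.
Proof. by move=> cX; rewrite cfE bop_mulE cX; apply: eq_convr => u; rewrite cfE. Qed.

Lemma convform0 : convform 0.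
Proof.
by move=> f x w; rewrite at0 conv_sum big1// => i _; rewrite cf0 mul0r.
Qed.

Lemma convformD c X Y : convform X -> convform Y -> convform (c *: X + Y).
Proof.
move=> cX cY f x w; rewrite atD atZ cX cY.
rewrite (@eq_convl (cf (c *: X + Y)) (fun y u => c * cf X y u + cf Y y u)).
  by rewrite conv_addl conv_scalel.
by move=> y u; rewrite cfD cfZ.
Qed.

Lemma convformM X Y : convform X -> convform Y -> convform (X * Y).
Proof.
move=> cX cY f x w.
rewrite (@eq_convl _ (cnv (cf X) (cf Y))); last by move=> y u; rewrite cfM.
by rewrite convA bop_mulE cX; apply: eq_convr => u; rewrite cY.
Qed.

Lemma at_L_edge_nil e (f : ell2 R P) x : at_ (L_edge R e f) x [::] = 0.
Proof.
rewrite (@at_comp _ x [::] I) /=; apply: shift_fun_none => p.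
by rewrite /edge_action; case: pselect => // h [].
Qed.

Lemma at_L_edge_cons e (f : ell2 R P) x w : src e = word_range x w ->
  at_ (L_edge R e f) x (e :: w) = at_ f x w.
Proof.
move=> xw.
have [h|h] := pselect (composable x w); last by rewrite !at_ncomp// => -[].
have h' : composable x (e :: w) by [].
rewrite (at_comp _ h) (at_comp _ h') /=; apply: shift_fun_some.
  exact: edge_action_inj.
rewrite /edge_action; case: pselect => [k|[]//].
by congr Some; apply: path_inj.
Qed.

Lemma at_L_edge_neq e e' (f : ell2 R P) x w : e' <> e ->
  at_ (L_edge R e f) x (e' :: w) = 0.
Proof.
move=> ee'.
have [h|h] := pselect (composable x (e' :: w)); last by rewrite !at_ncomp.
rewrite (at_comp _ h) /=; apply: shift_fun_none => p.
rewrite /edge_action; case: pselect => // k [] _ ee _; apply: ee'; by rewrite ee.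
Qed.

Lemma at_L_vertex (y : V) (f : ell2 R P) x w :
  at_ (L_vertex R y f) x w = if pselect (word_range x w = y) then at_ f x w else 0.
Proof.
have [h|h] := pselect (composable x w); last by rewrite !at_ncomp//; case: pselect.
rewrite !(at_comp _ h) /=; case: pselect => xw.
  apply: shift_fun_some; first exact: vertex_action_inj.
  by rewrite /vertex_action; case: pselect.
apply: shift_fun_none => p.
by rewrite /vertex_action; case: pselect => // k [] pw; apply: xw; rewrite -k pw.
Qed.

Lemma cf_L_vertex y x w : cf (L_vertex R y) x w = (`[< x = y /\ w = [::] >])%:R.
Proof.
rewrite cfE at_L_vertex at_one; case: pselect => xw.
  congr (nat_of_bool _)%:R; apply: asbool_equiv_eq.
  by split=> -[_ w0]; split=> //; rewrite w0 in xw.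
by rewrite [in RHS]asboolF// => -[xy w0]; apply: xw; rewrite w0.
Qed.

Lemma conv_nil (c : V -> R[i]) F x w :
  cnv (fun y u => if u is [::] then c y else 0) F x w = c (word_range x w) * F x w.
Proof.
case: w => [//|e w] /=; rewrite [X in _ + X](_ : _ = 0) ?addr0//.
by rewrite conv_sum big1// => i _; rewrite mul0r.
Qed.

Lemma convform_L_vertex y : convform (L_vertex R y).
Proof.
move=> f x w; rewrite at_L_vertex.
rewrite (@eq_convl _ (fun y' u => if u is [::] then (`[< y' = y >])%:R else 0)).
  by rewrite conv_nil; case: pselect => h; [rewrite asboolT// mul1r|rewrite asboolF// mul0r].
move=> y' [|e u]; rewrite cf_L_vertex; last by rewrite asboolF// => -[].
by congr (nat_of_bool _)%:R; apply: asbool_equiv_eq; split=> [[]|].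
Qed.

Lemma convform_L_edge e : convform (L_edge R e).
Proof.
move=> f x [|e' w].
  by rewrite at_L_edge_nil /= cfE at_L_edge_nil mul0r.
rewrite /= cfE at_L_edge_nil mul0r add0r.
have [->|ee'] := pselect (e' = e); last first.
  rewrite at_L_edge_neq// conv_sum big1// => i _.
  by rewrite cfE at_L_edge_neq ?mul0r.
have [xw|xw] := pselect (src e = word_range x w); last first.
  rewrite at_ncomp; last by move=> [].
  rewrite conv_sum big1// => i _.
  rewrite cfE; set y := word_range _ _.
  have [ey|ey] := pselect (src e = word_range y (take i w)); last first.
    by rewrite at_ncomp ?mul0r// => -[].
  by case: xw; rewrite ey /y -word_range_cat cat_take_drop.
rewrite at_L_edge_cons// (@eq_convl _ (fun y u => if u is [::] then (`[< src e = y >])%:R else 0)).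
  by rewrite conv_nil asboolT// mul1r.
move=> y [|e0 u]; rewrite cfE.
  have [sy|sy] := pselect (src e = y).
    by rewrite at_L_edge_cons// at_one !asboolT.
  by rewrite asboolF// at_ncomp// => -[].
have [sy|sy] := pselect (src e = word_range y (e0 :: u)).
  by rewrite at_L_edge_cons// at_one asboolF// => -[].
by rewrite at_ncomp// => -[].
Qed.

(** The values of [cf X] are entries of X, so for each f and each path the convolution identity is
    one linear equation between finitely many entries. *)
Lemma convform_wot_closed : wot_closed convform.
Proof.
pose lp (p : P) (i : nat) : P :=
  DPath (proj1 (proj1 (composable_cat (path_src p) (take i (path_edges p)) (drop i (path_edges p)))
    (eq_ind_r (composable (path_src p)) (Defs.pathP p) (cat_take_drop i (path_edges p))))).
have -> : convform = [set T : bop R P | forall i : ell2 R P * P,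
    \sum_(j <- iota 0 (size (path_edges i.2)).+1)
      at_ i.1 (path_src i.2) (drop j (path_edges i.2)) * T (one_ (path_src (lp i.2 j))) (lp i.2 j)
    = T i.1 i.2].
  apply/seteqP; split=> X /= h.
    move=> [f p] /=; rewrite -at_path h conv_sum; apply: eq_bigr => j _.
    by rewrite mulrC; congr (_ * _); exact: (esym (cf_path X (lp p j))).
  move=> f x w; have [c|c] := pselect (composable x w); last first.
    by rewrite conv_ncomp ?at_ncomp//; exact: at_ncomp.
  rewrite (at_comp _ c); have := h (f, DPath c) => /= <-.
  rewrite conv_sum; apply: eq_bigr => j _; rewrite mulrC; congr (_ * _).
  exact: (esym (cf_path X (lp (DPath c) j))).
exact: (@wot_closed_entries _ _ (ell2 R P * P) (fun i => iota 0 (size (path_edges i.2)).+1)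
  (fun i j => one_ (path_src (lp i.2 j))) (fun i _ => i.1) (fun i j => lp i.2 j) (fun i _ => i.2)
  (fun i j => at_ i.1 (path_src i.2) (drop j (path_edges i.2)))).
Qed.

Lemma L_alg_convform X : L_alg G R X -> convform X.
Proof.
apply; split; last first.
  move=> _ [[e _ <-]|[y _ <-]]; [exact: convform_L_edge|exact: convform_L_vertex].
split; last exact: convform_wot_closed.
split; [exact: convform0|exact: convformD|exact: convformM].
Qed.

End Words.

Lemma sum_le_sub (R : realDomainType) (J : eqType) (F : J -> R) (s t : seq J) :
  (forall j, 0 <= F j) -> uniq s -> {subset s <= t} -> \sum_(j <- s) F j <= \sum_(j <- t) F j.
Proof.
move=> F0; elim: s t => [|j s IH] t /=; first by rewrite big_nil sumr_ge0.
move=> /andP[js us] st.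
have jt : j \in t by apply: st; rewrite inE eqxx.
rewrite (perm_big _ (perm_to_rem jt)) !big_cons lerD2l; apply: IH => // i is_.
have : i \in j :: rem j t by rewrite -(perm_mem (perm_to_rem jt)) st// inE is_ orbT.
by rewrite inE => /orP[/eqP ij|//]; rewrite -ij is_ in js.
Qed.

Lemma sum_le_inj (R : realDomainType) (I J : eqType) (g : I -> J) (F : J -> R)
    (s : seq I) (t : seq J) :
  (forall j, 0 <= F j) -> uniq s -> {in s &, injective g} -> (forall i, i \in s -> g i \in t) ->
  \sum_(i <- s) F (g i) <= \sum_(j <- t) F j.
Proof.
move=> F0 us gi gt; rewrite -(big_map g predT F); apply: sum_le_sub => //.
  by rewrite map_inj_in_uniq.
by move=> _ /mapP[i si ->]; exact: gt.
Qed.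

Section Words.
Variables (R : realType) (G : digraph).
Notation V := (vertex G).
Notation E := (edge G).
Notation P := (dpath G).
Notation sym := (V -> seq E -> R[i]).
Implicit Types (X Y : bop R P) (x y : V) (e : E) (u v w : seq E) (a b F : sym) (p q : P).

Lemma rpath_subproof p i : composable (path_src p) (drop i (path_edges p)).
Proof.
have := Defs.pathP p; rewrite -{1}(cat_take_drop i (path_edges p)).
by move=> /composable_cat[].
Qed.

Lemma lpath_subproof p i :
  composable (word_range (path_src p) (drop i (path_edges p))) (take i (path_edges p)).
Proof.
have := Defs.pathP p; rewrite -{1}(cat_take_drop i (path_edges p)).
by move=> /composable_cat[].
Qed.

Definition rpath p i := DPath (rpath_subproof p i).
Definition lpath p i := DPath (lpath_subproof p i).

Lemma lrpath_inj p q i j : lpath p i = lpath q j -> rpath p i = rpath q j -> p = q.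
Proof.
move=> [_ h1] [h2 h3]; apply: path_inj => //.
by rewrite -(cat_take_drop i (path_edges p)) h1 h3 cat_take_drop.
Qed.

Definition val_ a p := a (path_src p) (path_edges p).

Lemma conv_path a (f : ell2 R P) p : val_ (cnv a (at_ f)) p =
  \sum_(i <- iota 0 (size (path_edges p)).+1) val_ a (lpath p i) * f (rpath p i).
Proof.
rewrite /val_ conv_sum; apply: eq_bigr => i _; congr (_ * _).
by rewrite -(at_path f (rpath p i)).
Qed.

(** Operators known only by their symbol are built here; what remains is an estimate on finite sets
    of paths. *)
Lemma bounded_conv a (M : R) : supp a -> 0 <= M ->
  (forall (f : ell2 R P) s, uniq s ->
    \sum_(q <- s) nc (val_ (cnv a (at_ f)) q) ^+ 2 <= M ^+ 2 * ell2_norm f ^+ 2) ->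
  exists X : bop R P, [/\ convform X, cf X = a & forall f, ell2_norm (X f) <= M * ell2_norm f].
Proof.
move=> sa M0 h.
have /choice[T hT] (f : ell2 R P) : exists g : ell2 R P, (g : P -> R[i]) = val_ (cnv a (at_ f)) /\
    ell2_norm g <= M * ell2_norm f.
  have [g [gE gn]] := ell2_of_bound (h f); exists g; split=> //.
  by rewrite -ler_sqr ?nnegrE ?mulr_ge0 ?ell2_norm_ge0// exprMn.
have TP : T \in @bounded_linear R P.
  apply/asboolP; split; last by exists M => f; case: (hT f).
  move=> c f g; apply: ell2P => p.
  rewrite -[RHS]/(c * T f p + T g p) !(proj1 (hT _)) /val_.
  rewrite -conv_scaler -conv_addr; apply: eq_convr => u.
  by rewrite atD atZ.
exists (Bop TP).
have [|c1 c2] := @convformP _ _ (Bop TP) a sa.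
  by move=> f x w c; rewrite (at_comp _ c) /= (proj1 (hT f)).
by split=> // f; case: (hT f).
Qed.

(** If each path has at most one left factor in the support of a, the convolution has a single term
    at each q, and q is recovered from its two factors. The sum over s is thus at most a product of
    two sums of squares. *)
Lemma unique_prefix_bound a (A : R) (f : ell2 R P) s :
  supp a -> 0 <= A ->
  (forall s, uniq s -> \sum_(p <- s) nc (val_ a p) ^+ 2 <= A ^+ 2) ->
  (forall p i j, (i <= size (path_edges p))%N -> (j <= size (path_edges p))%N ->
     val_ a (lpath p i) != 0 -> val_ a (lpath p j) != 0 -> i = j) ->
  uniq s -> \sum_(q <- s) nc (val_ (cnv a (at_ f)) q) ^+ 2 <= A ^+ 2 * ell2_norm f ^+ 2.
Proof.
move=> sa A0 hA ha us.
have /choice[i hi] q : exists i, (i <= size (path_edges q))%N /\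
    val_ (cnv a (at_ f)) q = val_ a (lpath q i) * f (rpath q i).
  have [[i [iq ai]]|hn] := pselect (exists i, (i <= size (path_edges q))%N /\ val_ a (lpath q i) != 0).
    exists i; split=> //.
    have im : i \in iota 0 (size (path_edges q)).+1 by rewrite mem_iota add0n ltnS.
    rewrite conv_path (bigD1_seq i im (iota_uniq _ _)).
    rewrite big_seq_cond big1 => [|j]; first by rewrite /= addr0.
    rewrite mem_iota add0n ltnS => /andP[/andP[_ jq] ji].
    apply/eqP; rewrite mulf_eq0; apply/orP; left; apply/negPn/negP => aj.
    by rewrite (ha q j i) ?eqxx in ji.
  (* No left factor of q is in the support, so any index will do. *)
  exists 0%N; split=> //; rewrite conv_path big_seq big1.
    have [/eqP ->|a0] := boolP (val_ a (lpath q 0) == 0); first by rewrite mul0r.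
    by case: hn; exists 0%N.
  move=> j; rewrite mem_iota add0n ltnS => /andP[_ jq].
  have [/eqP ->|a0] := boolP (val_ a (lpath q j) == 0); first by rewrite mul0r.
  by case: hn; exists j.
pose l q := lpath q (i q); pose r q := rpath q (i q).
pose Ls := undup (map l s); pose Rs := undup (map r s).
pose F (z : P * P) := nc (val_ a z.1) ^+ 2 * nc (f z.2) ^+ 2.
apply: (@le_trans _ _ (\sum_(q <- s) F (l q, r q))).
  by apply: ler_sum => q _; rewrite (proj2 (hi q)) ncM exprMn.
apply: (@le_trans _ _ (\sum_(z <- [seq (l', r') | l' <- Ls, r' <- Rs]) F z)).
  apply: (@sum_le_inj _ _ _ (fun q => (l q, r q))) => //.
  - by move=> z; rewrite mulr_ge0// sqr_ge0.
  - by move=> q q' _ _ E; apply: (@lrpath_inj _ _ (i q) (i q')); [exact: (congr1 fst E)|exact: (congr1 snd E)].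
  by move=> q qs; apply: allpairs_f; rewrite mem_undup map_f.
rewrite big_allpairs /F /=.
under eq_bigr do rewrite -mulr_sumr.
rewrite -mulr_suml ler_pM//.
- by apply: sumr_ge0 => *; rewrite sqr_ge0.
- by apply: sumr_ge0 => *; rewrite sqr_ge0.
- by apply: hA; exact: undup_uniq.
- by apply: ell2_norm_sum; exact: undup_uniq.
Qed.

Definition Lw x w : bop R P := foldr (fun e T => L_edge R e * T) (L_vertex R x) w.

Lemma Lw_cons x e w f : Lw x (e :: w) f = L_edge R e (Lw x w f).
Proof. by []. Qed.

Lemma at_Lw_cat x w (f : ell2 R P) y v : composable x w -> word_range y v = x ->
  at_ (Lw x w f) y (w ++ v) = at_ f y v.
Proof.
move=> + yv; elim: w => [_|e w IH [ew cw]].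
  by rewrite at_L_vertex; case: pselect.
rewrite Lw_cons at_L_edge_cons ?IH//.
by rewrite word_range_cat yv.
Qed.

Lemma at_Lw0 x w (f : ell2 R P) y v :
  ~ (exists2 v', v = w ++ v' & word_range y v' = x) -> at_ (Lw x w f) y v = 0.
Proof.
elim: w v => [|e w IH] v h.
  rewrite at_L_vertex; case: pselect => // yv; case: h; exists v => //.
rewrite Lw_cons; case: v h => [|e' v] h; first exact: at_L_edge_nil.
have [ee'|ee'] := pselect (e' = e); last exact: at_L_edge_neq.
rewrite ee' in h *.
have [ev|ev] := pselect (src e = word_range y v); last by rewrite at_ncomp// => -[].
rewrite at_L_edge_cons// IH// => -[v' vv' yv']; apply: h.
by exists v' => //; rewrite vv'.
Qed.

Lemma cf_Lw x w y v : composable x w -> cf (Lw x w) y v = (`[< y = x /\ v = w >])%:R.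
Proof.
move=> cw; rewrite cfE; case: asboolP => [[-> ->]|h].
  by rewrite -{2}(cats0 w) at_Lw_cat// at_one asboolT.
have [[v' vv' yv']|h'] := pselect (exists2 v', v = w ++ v' & word_range y v' = x).
  rewrite vv' at_Lw_cat// at_one asboolF// => -[_ v0]; apply: h.
  by rewrite vv' v0 cats0; split=> //; rewrite v0 in yv'.
exact: at_Lw0.
Qed.

Lemma L_alg_sub : subalgebra (L_alg G R).
Proof.
split.
- by move=> A [[[h _ _] _] _].
- by move=> c S T hS hT A hA; have [[[_ h _] _] _] := hA; apply: h; [apply: hS|apply: hT].
- by move=> S T hS hT A hA; have [[[_ _ h] _] _] := hA; apply: h; [apply: hS|apply: hT].
Qed.

Lemma L_alg_wot : wot_closed (L_alg G R).
Proof.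
have -> : L_alg G R = \bigcap_(A in [set A | (subalgebra A /\ wot_closed A) /\ generators (G := G) (R := R) `<=` A]) A.
  by [].
by apply: closed_bigI => A [[_ ?] _].
Qed.

Lemma L_alg_gen : generators (G := G) (R := R) `<=` L_alg G R.
Proof. by move=> X gX A [_]; apply. Qed.

Lemma L_alg_D X Y : L_alg G R X -> L_alg G R Y -> L_alg G R (X + Y).
Proof. by move=> hX hY; rewrite -[X]scale1r; have [_ h _] := L_alg_sub; exact: h. Qed.
Lemma L_alg_Z c X : L_alg G R X -> L_alg G R (c *: X).
Proof. by move=> hX; rewrite -[_ *: X]addr0; have [h0 h _] := L_alg_sub; exact: h. Qed.
Lemma L_alg_N X : L_alg G R X -> L_alg G R (- X).
Proof. by move=> hX; rewrite -scaleN1r; exact: L_alg_Z. Qed.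
Lemma L_alg_B X Y : L_alg G R X -> L_alg G R Y -> L_alg G R (X - Y).
Proof. by move=> hX hY; apply: L_alg_D => //; exact: L_alg_N. Qed.
Lemma L_alg_M X Y : L_alg G R X -> L_alg G R Y -> L_alg G R (X * Y).
Proof. by have [_ _ h] := L_alg_sub; exact: h. Qed.
Lemma L_alg_sum I (s : seq I) (F : I -> bop R P) :
  (forall i, L_alg G R (F i)) -> L_alg G R (\sum_(i <- s) F i).
Proof.
move=> h; elim: s => [|i s IH]; first by rewrite big_nil; case: L_alg_sub.
by rewrite big_cons; exact: L_alg_D.
Qed.
Lemma L_alg_vertex x : L_alg G R (L_vertex R x).
Proof. by apply: L_alg_gen; right; exists x. Qed.
Lemma L_alg_edge e : L_alg G R (L_edge R e).
Proof. by apply: L_alg_gen; left; exists e. Qed.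
Lemma L_alg_Lw x w : L_alg G R (Lw x w).
Proof.
elim: w => [|e w IH]; first exact: L_alg_vertex.
by apply: L_alg_M => //; exact: L_alg_edge.
Qed.

Lemma cf_sum I (s : seq I) (F : I -> bop R P) x w :
  cf (\sum_(i <- s) F i) x w = \sum_(i <- s) cf (F i) x w.
Proof.
elim: s => [|i s IH]; first by rewrite !big_nil cf0.
by rewrite !big_cons cfD IH.
Qed.

Lemma ell2_norm_cf_sum X x s : uniq s ->
  \sum_(p <- s | `[< path_src p = x >]) nc (val_ (cf X) p) ^+ 2 <= ell2_norm (X (one_ R x)) ^+ 2.
Proof.
move=> us; rewrite -big_filter.
have -> : \sum_(p <- [seq p <- s | `[< path_src p = x >]]) nc (val_ (cf X) p) ^+ 2 =
  \sum_(p <- [seq p <- s | `[< path_src p = x >]]) nc (X (one_ R x) p) ^+ 2.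
  rewrite big_seq [RHS]big_seq; apply: eq_bigr => p; rewrite mem_filter => /andP[/asboolP px _].
  by rewrite /val_ cf_path px.
by apply: ell2_norm_sum; rewrite filter_uniq.
Qed.

(** Infinitely many paths of length n may start at x, so X is approximated by truncating its symbol:
    S k keeps a finite set of coefficients, outside of which all are at most 1 / (k + 1). Words of
    equal length are prefix-free, so the truncations are uniformly bounded by
    [unique_prefix_bound]. *)
Lemma homogeneous_L_alg X n x : convform X ->
  (forall y w, cf X y w != 0 -> y = x /\ size w = n) -> L_alg G R X.
Proof.
move=> cX hX.
set h := X (one_ R x).
have hb s : uniq s -> \sum_(p <- s) nc (val_ (cf X) p) ^+ 2 <= ell2_norm h ^+ 2.
  move=> us; apply: le_trans (ell2_norm_cf_sum X x us).
  rewrite [leRHS]big_mkcond; apply: ler_sum => p _; case: asboolP => // px.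
  have [->|/hX[/px]//] := eqVneq (val_ (cf X) p) 0.
  by rewrite nc0 expr0n.
have /choice[s hs] (k : nat) : exists s : seq P, uniq s /\
    (forall p, p \notin s -> nc (val_ (cf X) p) <= k.+1%:R^-1).
  have k0 : 0 < (k.+1%:R^-1 : R) ^+ 2 by rewrite exprn_gt0// invr_gt0.
  have [s us hs] := ell2_norm_tail h k0; exists s; split=> // p ps.
  have := hs [:: p] isT; rewrite big_seq1 => /(_ _).
  have [->|/hX[px _]] := eqVneq (val_ (cf X) p) 0.
    by rewrite nc0 invr_ge0.
  rewrite ler_sqr ?nnegrE ?normc_ge0 ?invr_ge0//.
  rewrite /val_ cf_path px; apply=> q.
  by rewrite inE => /eqP ->.
pose S k : bop R P := \sum_(p <- s k) val_ (cf X) p *: Lw (path_src p) (path_edges p).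
have cS k : L_alg G R (S k).
  by apply: L_alg_sum => p; apply: L_alg_Z; exact: L_alg_Lw.
have cfS k p : val_ (cf (S k)) p = if p \in s k then val_ (cf X) p else 0.
  rewrite /val_ cf_sum.
  have E q : cf (val_ (cf X) q *: Lw (path_src q) (path_edges q)) (path_src p) (path_edges p)
     = if q == p then val_ (cf X) p else 0.
    rewrite cfZ cf_Lw; last exact: Defs.pathP.
    have [->|qp] := eqVneq q p; first by rewrite asboolT// mulr1.
    rewrite asboolF ?mulr0// => -[h1 h2]; move/eqP: qp; apply; exact: path_inj.
  under eq_bigr do rewrite E.
  have [us _] := hs k.
  case: ifP => ps; last first.
    rewrite big_seq big1// => q qs; case: eqP => // qp.
    by rewrite -qp qs in ps.
  by rewrite (bigD1_seq p)//= eqxx big1 ?addr0// => q /negPf ->.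
have sS k : supp (cf (S k)) by move=> ? ?; exact: cf_ncomp.
have UP a p : (forall q, val_ a q != 0 -> size (path_edges q) = n) -> forall i j, (i <= size (path_edges p))%N -> (j <= size (path_edges p))%N ->
     val_ a (lpath p i) != 0 -> val_ a (lpath p j) != 0 -> i = j.
  move=> ha i j ip jp /ha /= + /ha /=.
  by rewrite !size_takel// => -> ->.
have hX' q : val_ (cf X) q != 0 -> size (path_edges q) = n by move=> /hX[].
have hS' k q : val_ (cf (S k)) q != 0 -> size (path_edges q) = n.
  by rewrite cfS; case: ifP; rewrite ?eqxx// => _; exact: hX'.
apply: (@wot_closed_seq _ _ _ S X (ell2_norm h)) => //.
- exact: L_alg_wot.
- move=> k f.
  have hSb s' : uniq s' -> \sum_(p <- s') nc (val_ (cf (S k)) p) ^+ 2 <= ell2_norm h ^+ 2.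
    move=> us'; apply: le_trans (hb _ us'); apply: ler_sum => p _; rewrite cfS; case: ifP => // _.
    by rewrite nc0 expr0n sqr_ge0.
  have h0 := ell2_norm_ge0 h.
  apply: ell2_norm_le; first by rewrite mulr_ge0 ?ell2_norm_ge0.
  move=> s' us'; rewrite exprMn.
  apply: le_trans (unique_prefix_bound f (sS k) h0 hSb (fun p => UP _ p (hS' k)) us').
  apply: ler_sum => p _; rewrite -at_path.
  by rewrite (L_alg_convform (cS k)).
- move=> f q d d0.
  pose N := \sum_(i <- iota 0 (size (path_edges q)).+1) nc (f (rpath q i)).
  have N0 : 0 <= N by apply: sumr_ge0 => *; exact: normc_ge0.
  exists (Num.bound (N / d)) => k hk.
  rewrite -!at_path cX (L_alg_convform (cS k)) -![cnv _ _ _ _]/(val_ (cnv _ _) _) !conv_path -sumrB.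
  apply: le_trans (nc_partial_sum _ _) _.
  apply: (@le_trans _ _ (\sum_(i <- iota 0 (size (path_edges q)).+1) k.+1%:R^-1 * nc (f (rpath q i)))).
    apply: ler_sum => i _; rewrite -mulrBl ncM ler_wpM2r ?normc_ge0//.
    rewrite cfS; case: ifPn => ps; first by rewrite subrr nc0 invr_ge0.
    by rewrite subr0; apply: (proj2 (hs k)).
  rewrite -mulr_sumr -/N ler_pdivrMl// mulrC -ler_pdivrMl// mulrC.
  apply: ltW; apply: (@lt_le_trans _ _ (Num.bound (N / d))%:R).
    by apply: archi_boundP; rewrite divr_ge0 ?(ltW d0).
  by rewrite ler_nat leqW.
Qed.
End Words.

(** * Fejer means *)

Lemma sqr_sum_le (R : realDomainType) (I : Type) (s : seq I) (a : I -> R) :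
  (\sum_(k <- s) a k) ^+ 2 <= (size s)%:R * \sum_(k <- s) a k ^+ 2.
Proof.
elim: s => [|k s IH]; first by rewrite !big_nil expr0n mul0r.
rewrite !big_cons /=.
have h : 2 * a k * \sum_(j <- s) a j <= (size s)%:R * a k ^+ 2 + \sum_(j <- s) a j ^+ 2.
  elim: (s) => [|j r IHr]; first by rewrite !big_nil mulr0 mul0r addr0.
  rewrite !big_cons /= -natr1; have := sqr_ge0 (a k - a j).
  move: IHr; set S := \sum_(j <- r) a j; set Q := \sum_(j <- r) _; nra.
move: IH h; rewrite -natr1; set S := \sum_(j <- s) a j; set Q := \sum_(j <- s) _; nra.
Qed.

(** The Fejer weight as a count: a suffix of length l - i lies in n - i of the n windows that
    [fejer_bound] uses at a word of length l. *)
Lemma count_iota_lt l n i : (i <= l)%N ->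
  (\sum_(m <- iota l n) ((l - i <= m) && (m < l - i + n)))%N = (n - i)%N.
Proof.
move=> il.
have -> : n = ((n - i) + minn i n)%N by lia.
rewrite iotaD big_cat /= [X in (X + _)%N](_ : _ = \sum_(m <- iota l (n - i)) 1)%N.
  rewrite [X in (_ + X)%N](_ : _ = 0%N); last first.
    rewrite big_seq big1// => m; rewrite mem_iota => h.
    by apply/eqP; rewrite eqb0; lia.
  rewrite sum1_size size_iota; lia.
rewrite big_seq [RHS]big_seq; apply: eq_bigr => m; rewrite mem_iota => h.
by apply/eqP; rewrite eqb1; lia.
Qed.

Lemma count_window_le l n N :
  (\sum_(m <- iota 0 N) ((l <= m) && (m < l + n)) <= n)%N.
Proof.
rewrite -big_mkcond /= -big_filter sum1_size -[leqRHS](size_iota l n).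
apply: uniq_leq_size; first by rewrite filter_uniq ?iota_uniq.
by move=> m; rewrite mem_filter !mem_iota => /andP[].
Qed.

Section Words.
Variables (R : realType) (G : digraph).
Notation V := (vertex G).
Notation E := (edge G).
Notation P := (dpath G).
Notation sym := (V -> seq E -> R[i]).
Implicit Types (X Y : bop R P) (x y : V) (e : E) (u v w : seq E) (a b F : sym) (p q : P).

Lemma ell2_restrict (f : ell2 R P) (t : seq P) (c : pred P) : uniq t ->
  exists g : ell2 R P, (forall p, g p = if (p \in t) && c p then f p else 0) /\
    ell2_norm g ^+ 2 <= \sum_(p <- t | c p) nc (f p) ^+ 2.
Proof.
move=> ut.
have h s : uniq s -> \sum_(p <- s) nc (if (p \in t) && c p then f p else 0) ^+ 2
    <= \sum_(p <- t | c p) nc (f p) ^+ 2.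
  move=> us; rewrite (bigID (fun p => (p \in t) && c p))/= [X in _ + X]big1 ?addr0; last first.
    by move=> p /negPf ->; rewrite nc0 expr0n.
  rewrite -big_filter -[leRHS]big_filter.
  apply: (@le_trans _ _ (\sum_(p <- [seq p <- s | (p \in t) && c p]) nc (f p) ^+ 2)).
    rewrite big_seq [leRHS]big_seq; apply: ler_sum => p.
    by rewrite mem_filter => /andP[-> _].
  apply: sum_le_sub => [p||p]; first by rewrite sqr_ge0.
    by rewrite filter_uniq.
  by rewrite !mem_filter => /andP[/andP[-> ->]].
have [g [gE gn]] := ell2_of_bound h; exists g; split=> // p.
by rewrite gE.
Qed.

(** Words of equal length are prefix-free, so [unique_prefix_bound] applies, with the norm of the
    image of the path x as constant. *)
Lemma homogeneous_part X n x : convform X ->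
  exists Y : bop R P, L_alg G R Y /\
    cf Y = (fun y w => if `[< y = x /\ size w = n >] then cf X y w else 0).
Proof.
move=> cX; pose a : sym := fun y w => if `[< y = x /\ size w = n >] then cf X y w else 0.
have sa : supp a by move=> y w cw; rewrite /a; case: asboolP => // _; exact: cf_ncomp.
have [f s us|Y [cY cfY _]] := bounded_conv sa (ell2_norm_ge0 (X (one_ R x))).
  apply: unique_prefix_bound => //.
  - exact: ell2_norm_ge0.
  - move=> s' us'; apply: le_trans (ell2_norm_cf_sum X x us').
    rewrite [leRHS]big_mkcond; apply: ler_sum => p _.
    rewrite /a /val_; case: asboolP => [[px _]|_]; first by rewrite asboolT.
    by rewrite nc0 expr0n; case: asboolP => // _; rewrite sqr_ge0.
  - move=> p i j ip jp; rewrite /val_ /a /=.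
    case: asboolP; last by rewrite eqxx.
    move=> [_ + _]; case: asboolP; last by rewrite eqxx.
    by move=> [_]; rewrite !size_takel// => -> ->.
exists Y; split=> //; apply: (@homogeneous_L_alg _ _ Y n x) => //.
move=> y w; rewrite cfY /a; case: asboolP => //; by rewrite eqxx.
Qed.

(** A discrete substitute for integrating over rotations of the circle. Let f_m be the restriction
    of f to the paths of length in (m - n, m]. At a path q the Fejer mean is the average of X f_m
    over the n values of m from the length of q on, since a suffix of q shorter by i survives in n -
    i of these f_m. Each path belongs to at most n of the f_m, which balances the average. *)
Lemma fejer_bound X (T : bop R P) n : convform X -> convform T -> (0 < n)%N ->
  (forall y w, cf T y w = (n - size w)%:R / n%:R * cf X y w) ->
  forall f, ell2_norm (T f) <= opnorm X * ell2_norm f.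
Proof.
move=> cX cT n0 hT f.
have nR : 0 < (n%:R : R) by rewrite ltr0n.
apply: ell2_norm_le; first by rewrite mulr_ge0 ?opnorm_ge0 ?ell2_norm_ge0.
move=> s us.
(* The values at s only involve f on the finite set t of right factors of the paths in s. *)
pose t := undup [seq rpath q i | q <- s, i <- iota 0 (size (path_edges q)).+1].
have ut : uniq t by exact: undup_uniq.
have tin q i : q \in s -> (i <= size (path_edges q))%N -> rpath q i \in t.
  by move=> qs iq; rewrite mem_undup; apply: allpairs_f_dep => //; rewrite mem_iota add0n ltnS.
pose c m (p : P) := (size (path_edges p) <= m)%N && (m < size (path_edges p) + n)%N.
have /choice[fm hfm] m := ell2_restrict f (c m) ut.
have key q : q \in s -> T f q = n%:R^-1 * \sum_(m <- iota (size (path_edges q)) n) X (fm m) q.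
  move=> qs; rewrite -at_path cT -[cnv _ _ _ _]/(val_ (cnv _ _) _) conv_path.
  under [in RHS]eq_bigr do rewrite -at_path cX -[cnv _ _ _ _]/(val_ (cnv _ _) _) conv_path.
  rewrite exchange_big /= mulr_sumr -[0%N :: _]/(iota 0 (size (path_edges q)).+1).
  rewrite big_seq [RHS]big_seq; apply: eq_bigr => i; rewrite mem_iota add0n ltnS => /andP[_ iq].
  rewrite -mulr_sumr {1}/val_ hT size_takel//.
  have -> : \sum_(m <- iota (size (path_edges q)) n) fm m (rpath q i) = (n - i)%:R * f (rpath q i).
    rewrite -(count_iota_lt n iq) natr_sum mulr_suml; apply: eq_bigr => m _.
    rewrite (proj1 (hfm m)) tin// /c /= size_drop.
    by case: (_ && _); rewrite ?mul1r ?mul0r.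
  by rewrite /val_; ring.
pose N := (\sum_(q <- s) size (path_edges q) + n)%N.
(* Jensen's inequality for the average over the windows of q; N lies beyond the windows of all paths
   in s. *)
have jensen q : q \in s -> nc (T f q) ^+ 2 <= n%:R^-1 * \sum_(m <- iota 0 N) nc (X (fm m) q) ^+ 2.
  move=> qs; rewrite key// ncM exprMn.
  have -> : nc (n%:R^-1 : R[i]) = n%:R^-1.
    rewrite Normc.normcV; congr (_^-1).
    have -> : (n%:R : R[i]) = (n%:R : R)%:C by rewrite rmorph_nat.
    by rewrite /= expr0n addr0 sqrtr_sqr ger0_norm.
  rewrite expr2 -mulrA ler_wpM2l ?invr_ge0 ?(ltW nR)// ler_pdivrMl//.
  apply: (@le_trans _ _ ((\sum_(m <- iota (size (path_edges q)) n) nc (X (fm m) q)) ^+ 2)).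
    rewrite ler_sqr ?nnegrE ?normc_ge0 ?sumr_ge0//; last by move=> *; exact: normc_ge0.
    exact: nc_partial_sum.
  apply: le_trans (sqr_sum_le _ _) _; rewrite size_iota ler_wpM2l// ?(ltW nR)//.
  apply: sum_le_sub => [m||m]; first exact: sqr_ge0; first exact: iota_uniq.
  rewrite !mem_iota add0n /N => /andP[_ h] /=; apply: leq_trans h _.
  by rewrite leq_add2r (bigD1_seq q)//= leq_addr.
apply: (@le_trans _ _ (n%:R^-1 * \sum_(m <- iota 0 N) \sum_(q <- s) nc (X (fm m) q) ^+ 2)).
  rewrite exchange_big mulr_sumr big_seq [leRHS]big_seq; apply: ler_sum => q; exact: jensen.
rewrite ler_pdivrMl//.
apply: (@le_trans _ _ (\sum_(m <- iota 0 N) opnorm X ^+ 2 * \sum_(p <- t) nc (f p) ^+ 2 *+ c m p)).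
  apply: ler_sum => m _; apply: le_trans (ell2_norm_sum (X (fm m)) us) _.
  apply: (@le_trans _ _ (opnorm X ^+ 2 * ell2_norm (fm m) ^+ 2)).
    by rewrite -exprMn ler_sqr ?nnegrE ?mulr_ge0 ?opnorm_ge0 ?ell2_norm_ge0// opnormP.
  rewrite ler_wpM2l ?sqr_ge0//; apply: le_trans (proj2 (hfm m)) _.
  by rewrite big_mkcond; apply: ler_sum => p _; case: (c m p).
rewrite -mulr_sumr exprMn mulrCA ler_wpM2l ?sqr_ge0// exchange_big /=.
(* A path p lies in at most n windows; this n cancels the 1 / n from Jensen's inequality. *)
apply: (@le_trans _ _ (\sum_(p <- t) n%:R * nc (f p) ^+ 2)).
  apply: ler_sum => p _; rewrite sumrMnr -[leLHS]mulr_natl ler_wpM2r ?sqr_ge0// ler_nat.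
  exact: count_window_le.
by rewrite -mulr_sumr ler_wpM2l ?(ltW nR)// ell2_norm_sum.
Qed.

Lemma finite_graph_seq : finite_graph G -> exists vs : seq {classic V}, uniq vs /\ forall x : {classic V}, x \in vs.
Proof.
move=> /(@finite_seqP {classic V})[vs hvs]; exists (undup vs); split; first exact: undup_uniq.
move=> x; rewrite mem_undup; have : [set: {classic V}] x by [].
by rewrite hvs.
Qed.

(** As there are finitely many vertices, a Fejer mean is a finite sum of homogeneous parts, over
    lengths up to n and all vertices. Its entries converge because each weight (n + 1 - i) / (n + 1)
    tends to 1. *)
Lemma L_algP X : finite_graph G -> L_alg G R X <-> convform X.
Proof.
move=> /finite_graph_seq[vs [uvs hvs]]; split; first exact: L_alg_convform.
move=> cX.
have /choice[Y hY] (nx : nat * V) := homogeneous_part nx.1 nx.2 cX.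
pose T (n : nat) : bop R P := \sum_(j <- iota 0 n.+1) \sum_(x <- vs) ((n.+1 - j)%:R / n.+1%:R) *: Y (j, x).
have LT n : L_alg G R (T n).
  apply: L_alg_sum => j; apply: L_alg_sum => x; apply: L_alg_Z.
  exact: (proj1 (hY (j, x))).
have hT n y w : cf (T n) y w = (n.+1 - size w)%:R / n.+1%:R * cf X y w.
  rewrite cf_sum; under eq_bigr do rewrite cf_sum.
  have E j : \sum_(x <- vs) cf (((n.+1 - j)%:R / n.+1%:R) *: Y (j, x)) y w =
    if j == size w then (n.+1 - size w)%:R / n.+1%:R * cf X y w else 0.
    rewrite (bigD1_seq (y : {classic V}))//= cfZ (proj2 (hY (j, y))) /=.
    rewrite big1 ?addr0.
      have [->|jw] := eqVneq j (size w); first by rewrite asboolT.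
      by rewrite asboolF ?mulr0// => -[_ wj]; rewrite wj eqxx in jw.
    move=> x xy; rewrite cfZ (proj2 (hY (j, x))) /= asboolF ?mulr0// => -[yx _].
    by rewrite yx eqxx in xy.
  under eq_bigr do rewrite E.
  have [wn|wn] := ltnP (size w) n.+1.
    have im : size w \in iota 0 n.+1 by rewrite mem_iota.
    rewrite (bigD1_seq _ im (iota_uniq _ _)) eqxx big1 => [|j /negPf ->//].
    by rewrite /= addr0.
  rewrite (eqP (_ : (n.+1 - size w)%N == 0%N)) ?subn_eq0// !mul0r big_seq big1// => j.
  rewrite mem_iota => jn; case: eqP => // jw.
apply: (@wot_closed_seq _ _ _ T X (opnorm X)) => //.
- exact: L_alg_wot.
- move=> n f; apply: (@fejer_bound X (T n) n.+1) => //; exact: L_alg_convform.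
- move=> f q d d0.
  pose N := \sum_(i <- iota 0 (size (path_edges q)).+1) i%:R * nc (val_ (cf X) (lpath q i) * f (rpath q i)).
  have N0 : 0 <= N by apply: sumr_ge0 => *; rewrite mulr_ge0 ?normc_ge0.
  exists (Num.bound (N / d) + size (path_edges q))%N => k hk.
  rewrite -!at_path cX (L_alg_convform (LT k)) -![cnv _ _ _ _]/(val_ (cnv _ _) _) !conv_path -sumrB.
  apply: le_trans (nc_partial_sum _ _) _.
  have k0 : (k.+1%:R : R[i]) != 0 by rewrite pnatr_eq0.
  apply: (@le_trans _ _ (\sum_(i <- iota 0 (size (path_edges q)).+1) k.+1%:R^-1 * (i%:R * nc (val_ (cf X) (lpath q i) * f (rpath q i))))).
    rewrite big_seq [leRHS]big_seq; apply: ler_sum => i; rewrite mem_iota add0n ltnS => /andP[_ iq].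
    rewrite {2}/val_ hT size_takel// -[cf X _ _]/(val_ (cf X) (lpath q i)).
    have -> : val_ (cf X) (lpath q i) * f (rpath q i) -
      (k.+1 - i)%:R / k.+1%:R * val_ (cf X) (lpath q i) * f (rpath q i) =
      (k.+1%:R^-1 * i%:R) * (val_ (cf X) (lpath q i) * f (rpath q i)).
      rewrite natrB; last by lia.
      by field.
    rewrite [leLHS]ncM [leRHS]mulrA ler_wpM2r ?normc_ge0// ncM Normc.normcV.
    have nn m : nc (m%:R : R[i]) = m%:R.
      have -> : (m%:R : R[i]) = (m%:R : R)%:C by rewrite rmorph_nat.
      by rewrite /= expr0n addr0 sqrtr_sqr ger0_norm.
    by rewrite !nn.
  rewrite -mulr_sumr -/N ler_pdivrMl// mulrC -ler_pdivrMl// mulrC.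
  apply: ltW; apply: (@lt_le_trans _ _ (Num.bound (N / d))%:R).
    by apply: archi_boundP; rewrite divr_ge0 ?(ltW d0).
  by rewrite ler_nat; lia.
Qed.
End Words.

(** * Derivations *)

Section Der.
Variables (R : realType) (G : digraph).
Hypothesis finG : finite_graph G.
Notation V := (vertex G).
Notation E := (edge G).
Notation P := (dpath G).
Notation A := (A_alg G R).
Notation L := (L_alg G R).
Implicit Types (S T X Y : bop R P) (x y z : V) (e : E) (u v w : seq E) (p q : P).

Lemma opnorm_eq0 X : opnorm X = 0 -> X = 0.
Proof.
move=> X0; apply: bopP => f; apply: ell2_norm0_eq0; apply/eqP.
by rewrite eq_le ell2_norm_ge0 andbT; have := opnormP X f; rewrite X0 mul0r.
Qed.

Lemma eq0_of_small (r K : R) : 0 <= r -> 0 <= K -> (forall t : R, 0 < t -> r <= K * t) -> r = 0.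
Proof.
move=> r0 K0 h; apply/eqP; rewrite eq_le r0 andbT; apply/ler_addgt0Pr => e e0.
have K1 : 0 < K + 1 by rewrite ltr_wpDl.
apply: le_trans (h (e / (K + 1)) _) _; first by rewrite divr_gt0.
by rewrite add0r mulrCA -[leRHS]mulr1 ler_wpM2l ?(ltW e0)// ler_pdivrMr// mul1r lerDl.
Qed.

(** At a given path the defect of the convolution identity is linear in the operator and bounded by
    its norm times a constant K that depends only on f and the path. *)
Lemma convform_norm_closed : norm_closed (@convform R G).
Proof.
move=> T hT f x w.
have [c|c] := pselect (composable x w); last first.
  rewrite conv_ncomp ?at_ncomp//; exact: at_ncomp.
pose p := DPath c; rewrite -[at_ _ _ _]/(val_ _ p) -[cnv _ _ _ _]/(val_ _ p).
apply/eqP; rewrite -subr_eq0; apply/eqP; apply: Normc.eq0_normc.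
pose K := ell2_norm f + \sum_(i <- iota 0 (size (path_edges p)).+1) nc (f (rpath p i)).
have K0 : 0 <= K by rewrite addr_ge0 ?ell2_norm_ge0 ?sumr_ge0// => *; exact: normc_ge0.
apply: (eq0_of_small (normc_ge0 _) K0) => e e0; have [S [cS]] := hT e e0.
set X := T - S => /ltW Xe.
have -> : val_ (at_ (T f)) p - val_ (cnv (cf T) (at_ f)) p =
          val_ (at_ (X f)) p - val_ (cnv (cf X) (at_ f)) p.
  have -> : X f = T f - S f by [].
  rewrite /val_ atD atN.
  rewrite (@eq_convl _ _ (cf X) (fun y u => cf T y u + -1 * cf S y u)); last first.
    by move=> y u; rewrite cfB mulN1r.
  by rewrite conv_addl conv_scalel -cS; ring.
apply: le_trans (ncD _ _) _; rewrite ncN /K mulrDl; apply: lerD.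
  rewrite /val_ at_path mulrC; apply: le_trans (opnorm_entry _ _ _) _.
  by rewrite ler_wpM2r ?ell2_norm_ge0.
rewrite conv_path mulr_suml; apply: le_trans (nc_partial_sum _ _) _.
apply: ler_sum => i _; rewrite ncM mulrC ler_wpM2l ?normc_ge0// /val_ cf_path.
apply: le_trans (opnorm_entry _ _ _) _; rewrite -[leRHS]mulr1 ler_pM ?opnorm_ge0 ?ell2_norm_ge0//.
exact: ell2_norm_basis.
Qed.

Lemma A_sub : subalgebra A.
Proof.
split.
- by move=> Q [[[h _ _] _] _].
- by move=> c S T hS hT Q hQ; have [[[_ h _] _] _] := hQ; apply: h; [apply: hS|apply: hT].
- by move=> S T hS hT Q hQ; have [[[_ _ h] _] _] := hQ; apply: h; [apply: hS|apply: hT].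
Qed.

Lemma A_norm_closed : norm_closed A.
Proof.
move=> T hT Q hQ; have [[_ h] _] := hQ; apply: h => e /hT[S [AS Se]].
by exists S; split=> //; exact: AS.
Qed.

Lemma A_gen : generators (G := G) (R := R) `<=` A.
Proof. by move=> X gX Q [_]; apply. Qed.

Lemma A_min (Q : set (bop R P)) : subalgebra Q -> norm_closed Q ->
  generators (G := G) (R := R) `<=` Q -> A `<=` Q.
Proof. by move=> h1 h2 h3 X; apply. Qed.

Lemma A_L : A `<=` L.
Proof.
apply: A_min; [exact: L_alg_sub| |exact: L_alg_gen].
move=> T hT; apply/(L_algP _ finG); apply: convform_norm_closed => e /hT[S [LS Se]].
by exists S; split=> //; apply/(L_algP _ finG).
Qed.

Lemma A_vertex x : A (L_vertex R x). Proof. by apply: A_gen; right; exists x. Qed.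
Lemma A_edge e : A (L_edge R e). Proof. by apply: A_gen; left; exists e. Qed.
Lemma A_D S T : A S -> A T -> A (S + T).
Proof. by move=> hS hT; rewrite -[S]scale1r; have [_ h _] := A_sub; exact: h. Qed.
Lemma A_Z c S : A S -> A (c *: S).
Proof. by move=> hS; rewrite -[_ *: S]addr0; have [h0 h _] := A_sub; exact: h. Qed.
Lemma A_B S T : A S -> A T -> A (S - T).
Proof. by move=> hS hT; rewrite -scaleN1r; apply: A_D => //; exact: A_Z. Qed.
Lemma A_M S T : A S -> A T -> A (S * T).
Proof. by have [_ _ h] := A_sub; exact: h. Qed.
Lemma A_0 : A 0. Proof. by case: A_sub. Qed.
Lemma A_Lw x w : A (Lw R x w).
Proof.
elim: w => [|e w IH]; first exact: A_vertex.
by apply: A_M => //; exact: A_edge.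
Qed.
Lemma A_sum I (s : seq I) (F : I -> bop R P) : (forall i, A (F i)) -> A (\sum_(i <- s) F i).
Proof.
move=> h; elim: s => [|i s IH]; first by rewrite big_nil; exact: A_0.
by rewrite big_cons; exact: A_D.
Qed.

Definition der (d : bop R P -> bop R P) := bounded_derivation A L d.

Lemma der_L d S : der d -> A S -> L (d S). Proof. by move=> [h _ _ _]; exact: h. Qed.
Lemma derM d S T : der d -> A S -> A T -> d (S * T) = d S * T + S * d T.
Proof. by move=> [_ _ h _]; exact: h. Qed.
Lemma der0 d : der d -> d 0 = 0.
Proof.
move=> [_ h _ _]; have := h (-1) 0 0 A_0 A_0; rewrite scaler0 addr0 => E.
by rewrite E scaleN1r addrC subrr.
Qed.
Lemma derD d S T : der d -> A S -> A T -> d (S + T) = d S + d T.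
Proof. by move=> [_ h _ _] hS hT; have := h 1 S T hS hT; rewrite !scale1r. Qed.
Lemma derZ d c S : der d -> A S -> d (c *: S) = c *: d S.
Proof. by move=> dd hS; have [_ h _ _] := dd; have := h c S 0 hS A_0; rewrite !addr0 der0// addr0. Qed.
Lemma derB d S T : der d -> A S -> A T -> d (S - T) = d S - d T.
Proof.
move=> dd hS hT; rewrite -scaleN1r derD//; last exact: A_Z.
by rewrite derZ// scaleN1r.
Qed.
Lemma der_sum d I (s : seq I) (F : I -> bop R P) : der d -> (forall i, A (F i)) ->
  d (\sum_(i <- s) F i) = \sum_(i <- s) d (F i).
Proof.
move=> dd h; elim: s => [|i s IH]; first by rewrite !big_nil der0.
by rewrite !big_cons derD// ?IH//; exact: A_sum.
Qed.

Definition der_sub (d : bop R P -> bop R P) T : bop R P -> bop R P := fun S => d S - (S * T - T * S).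

Lemma der_der_sub d T : der d -> L T -> der (der_sub d T).
Proof.
move=> dd LT; have [d1 d2 d3 [M dM]] := dd; split.
- move=> S AS; apply: L_alg_B; first exact: d1.
  by apply: L_alg_B; apply: L_alg_M => //; exact: A_L.
- move=> c S S' AS AS'; rewrite /der_sub d2//.
  have -> : (c *: S + S') * T - T * (c *: S + S') = c *: (S * T - T * S) + (S' * T - T * S').
    rewrite mulrDl mulrDr.
    have -> : (c *: S) * T = c *: (S * T) by apply: bopP.
    have -> : T * (c *: S) = c *: (T * S) by apply: bopP => f; rewrite bop_mulE !bop_scaleE bopZ.
    by rewrite opprD addrACA scalerBr.
  set U := S * T - T * S; set U' := S' * T - T * S'.
  by rewrite [in RHS]scalerBr opprD addrACA.
- move=> S S' AS AS'; rewrite /der_sub d3// !mulrBl !mulrBr !mulrA.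
  by rewrite !opprB [RHS]addrACA; congr (_ + _); rewrite [RHS]addrA subrK.
- exists (2 * (`|M| + 2 * (2 * opnorm T))) => S AS.
  apply: le_trans (opnormD_le _ _) _; rewrite -mulrA ler_wpM2l// mulrDl opnormN; apply: lerD.
    apply: le_trans (dM S AS) _; by rewrite ler_wpM2r ?opnorm_ge0// ler_norm.
  apply: le_trans (opnormD_le _ _) _; rewrite -!mulrA ler_wpM2l// opnormN.
  have := opnormM_le S T; have := opnormM_le T S; lra.
Qed.

Lemma der_eq0 d : der d -> (forall e, d (L_edge R e) = 0) -> (forall x, d (L_vertex R x) = 0) ->
  forall S, A S -> d S = 0.
Proof.
(* The kernel is intersected with [A], as nothing is known of d outside it; the bound M makes it
   norm closed. *)
move=> dd de dv S AS; suff : (A `&` [set S | d S = 0]) S by case.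
have [_ _ _ [M dM]] := dd.
move: S AS; apply: A_min; first split.
- by split; [exact: A_0|exact: der0].
- move=> c S T [AS /= S0] [AT /= T0]; split; first by apply: A_D => //; exact: A_Z.
  by rewrite /= derD ?derZ ?S0 ?T0 ?scaler0 ?addr0//; exact: A_Z.
- move=> S T [AS /= S0] [AT /= T0]; split; first exact: A_M.
  by rewrite /= derM// S0 T0 mul0r mulr0 addr0.
- move=> T hT; have AT : A T by apply: A_norm_closed => e /hT[S [[AS _] Se]]; exists S.
  split=> //=; apply: opnorm_eq0; apply: (eq0_of_small (opnorm_ge0 _) (normr_ge0 M)) => e /hT[S [[AS /= S0] Se]].
  have -> : d T = d (T - S) by rewrite derB// S0 subr0.
  apply: le_trans (dM _ (A_B AT AS)) _.
  apply: (@le_trans _ _ (`|M| * opnorm (T - S))).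
    by rewrite ler_wpM2r ?opnorm_ge0 ?ler_norm.
  by rewrite ler_wpM2l// ltW.
- move=> _ [[e _ <-]|[x _ <-]]; split=> //=; [exact: A_edge|exact: A_vertex].
Qed.

Lemma inner_of_gens d T : der d -> L T ->
  (forall e, d (L_edge R e) = L_edge R e * T - T * L_edge R e) ->
  (forall x, d (L_vertex R x) = L_vertex R x * T - T * L_vertex R x) -> inner_derivation A L d.
Proof.
move=> dd LT de dv; exists T => // S AS.
apply/eqP; rewrite -subr_eq0; apply/eqP.
apply: (@der_eq0 (der_sub d T)) => //; first exact: der_der_sub.
  by move=> e; rewrite /der_sub de subrr.
by move=> x; rewrite /der_sub dv subrr.
Qed.

Lemma inner_der_sub d T : L T -> inner_derivation A L (der_sub d T) -> inner_derivation A L d.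
Proof.
move=> LT [U LU h]; exists (T + U); first exact: L_alg_D.
move=> S AS; have /eqP := h S AS; rewrite /der_sub subr_eq => /eqP ->.
by rewrite mulrDr mulrDl opprD [RHS]addrACA [RHS]addrC.
Qed.

Lemma cf_vertexM z X y v : convform X ->
  cf (L_vertex R z * X) y v = if pselect (word_range y v = z) then cf X y v else 0.
Proof. by move=> cX; rewrite !cfE bop_mulE at_L_vertex. Qed.

Lemma cf_Mvertex X x y v : convform X ->
  cf (X * L_vertex R x) y v = if pselect (y = x) then cf X y v else 0.
Proof.
move=> cX; rewrite cfM// conv_sum.
case: (pselect (y = x)) => yx /=.
  rewrite -[RHS](@conv_one _ _ (cf X)) conv_sum; apply: eq_bigr => i _; congr (_ * _).
  rewrite cf_L_vertex at_one; congr (nat_of_bool _)%:R; apply: asbool_equiv_eq.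
  by split=> -[_ ?]; split.
by rewrite big1// => i _; rewrite cf_L_vertex asboolF ?mulr0// => -[].
Qed.

Lemma vertexM x y : L_vertex R x * L_vertex R y = if pselect (x = y) then L_vertex R x else 0.
Proof.
apply: bopP => f; apply: at_inj => z v; rewrite bop_mulE !at_L_vertex.
case: pselect => zx; case: pselect => zy; case: pselect => xy /=; rewrite ?at0 ?at_L_vertex//.
- by case: pselect.
- by case: xy; rewrite -zx zy.
- by case: pselect => // zx'; case: zy; rewrite zx' xy.
- by case: pselect.
- by case: pselect.
Qed.

Lemma Lw_cat x u v : composable x (u ++ v) ->
  Lw R x (u ++ v) = Lw R (word_range x v) u * Lw R x v.
Proof.
elim: u => [|e u IH]; last first.
  by move=> [_ c]; rewrite -[LHS]/(L_edge R e * Lw R x (u ++ v)) IH// mulrA.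
move=> c; apply: bopP => f; apply: at_inj => z q; rewrite bop_mulE.
rewrite at_L_vertex; case: pselect => // h; rewrite at_Lw0//.
by move=> [q' qq' zx]; apply: h; rewrite qq' word_range_cat zx.
Qed.

Lemma vertex_Lw x w : composable x w -> Lw R x w = L_vertex R (word_range x w) * Lw R x w.
Proof. by move=> c; exact: (@Lw_cat x [::] w c). Qed.

Lemma Lw_vertex x w : composable x w -> Lw R x w = Lw R x w * L_vertex R x.
Proof. by move=> c; rewrite -{1}(cats0 w) Lw_cat ?cats0. Qed.

Lemma Lw_edge e : Lw R (src e) [:: e] = L_edge R e.
Proof.
apply: bopP => f; apply: at_inj => z v; rewrite Lw_cons.
case: v => [|e' v]; first by rewrite !at_L_edge_nil.
have [->|ee] := pselect (e' = e); last by rewrite !at_L_edge_neq.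
have [ev|ev] := pselect (src e = word_range z v); last by rewrite !at_ncomp// => -[].
rewrite !at_L_edge_cons// -[Lw R _ _]/(L_vertex R (src e)) at_L_vertex.
by case: pselect => // -[].

Qed.

Section Finite.
Variable vs : seq {classic V}.
Hypothesis uvs : uniq vs.
Hypothesis hvs : forall x : {classic V}, x \in vs.

Lemma sum_vertex : \sum_(x <- vs) L_vertex R x = 1.
Proof.
apply: bopP => f; apply: at_inj => z v.
have -> : (\sum_(x <- vs) L_vertex R x) f = \sum_(x <- vs) L_vertex R x f.
  by elim: (vs) => [|x s IH]; rewrite ?big_nil// !big_cons bop_addE IH.
have -> : at_ (\sum_(x <- vs) L_vertex R x f) z v = \sum_(x <- vs) at_ (L_vertex R x f) z v.
  by elim: (vs) => [|x s IH]; rewrite ?big_nil ?at0// !big_cons atD IH.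
rewrite (bigD1_seq (word_range z v : {classic V}))//= at_L_vertex.
rewrite big1 ?addr0; first by case: pselect.
by move=> x /eqP xz; rewrite at_L_vertex; case: pselect => // h; case: xz.
Qed.
End Finite.

(** The L_x are orthogonal projections with finite sum 1, and averaging over them suggests T = - sum
    of d(L_x) L_x. The Leibniz rule for L_y L_x, which is L_y or 0, evaluates its commutator with
    L_y. *)
Lemma normalize_vertices d : der d -> exists2 T, L T &
  forall x, der_sub d T (L_vertex R x) = 0.
Proof.
move=> dd; have [vs [uvs hvs]] := finite_graph_seq finG.
have AV := A_vertex; have LV := @L_alg_vertex R G.
pose T : bop R P := - \sum_(x <- vs) d (L_vertex R x) * L_vertex R x.
exists T.
  by apply: L_alg_N; apply: L_alg_sum => x; apply: L_alg_M => //; exact: der_L.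
move=> y; rewrite /der_sub /T mulrN mulNr opprK.
set p := @L_vertex G R.
have h1 x : p y * (d (p x) * p x) = (if pselect (y = x) then d (p y) * p x else 0) - d (p y) * (p x * p x).
  have := derM dd (AV y) (AV x); rewrite vertexM -/p => h.
  rewrite !mulrA.
  have -> : p y * d (p x) = (if pselect (y = x) then d (p y) else 0) - d (p y) * p x.
    apply/eqP; rewrite eq_sym subr_eq addrC -h; apply/eqP.
    by case: pselect => ? /=//; rewrite der0.
  by rewrite mulrBl; case: pselect => ? /=//; rewrite mul0r.
rewrite mulr_sumr mulr_suml -/p.
under eq_bigr do rewrite h1.
rewrite sumrB.
have pp x : p x * p x = p x by rewrite /p vertexM; case: pselect.
have -> : \sum_(x <- vs) d (p y) * (p x * p x) = d (p y).
  under eq_bigr do rewrite pp.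
  by rewrite -mulr_sumr sum_vertex// mulr1.
have -> : \sum_(x <- vs) (if pselect (y = x) then d (p y) * p x else 0) = d (p y) * p y.
  rewrite (bigD1_seq (y : {classic V}))//= big1 ?addr0; first by case: pselect.
  by move=> x /eqP xy; case: pselect => // yx; case: xy.
have -> : \sum_(x <- vs) d (p x) * p x * p y = d (p y) * p y.
  rewrite (bigD1_seq (y : {classic V}))//= big1 ?addr0; first by rewrite -mulrA pp.
  move=> x /eqP xy; rewrite -mulrA /p vertexM; case: pselect => [yx|yx] /=; last by rewrite mulr0.
  by case: xy.
by rewrite opprD opprK addrAC subrr add0r subrr.
Qed.

End Der.

(** * Closed words and first returns *)

Section Free.
Variables (E : eqType).
Implicit Types (u v w p q s t y z : seq E).

Definition pw u k := flatten (nseq k u).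
Lemma pwS u k : pw u k.+1 = u ++ pw u k. Proof. by []. Qed.
Lemma pwD u j k : pw u (j + k) = pw u j ++ pw u k.
Proof. by rewrite /pw nseqD flatten_cat. Qed.
Lemma pw1 u : pw u 1 = u. Proof. exact: cats0. Qed.
Lemma pwSr u k : pw u k.+1 = pw u k ++ u.
Proof. by rewrite -addn1 pwD pw1. Qed.
Lemma size_pw u k : size (pw u k) = (k * size u)%N.
Proof. by elim: k => //= k IH; rewrite size_cat IH mulSn. Qed.

Lemma cat_cmp u v s t : u ++ s = v ++ t -> (size v <= size u)%N -> exists2 u', u = v ++ u' & t = u' ++ s.
Proof.
move=> h vu; exists (drop (size v) u).
  rewrite -{1}(cat_take_drop (size v) u); congr (_ ++ _).
  by move/(congr1 (take (size v))): h; rewrite takel_cat// take_size_cat.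
move/(congr1 (drop (size v))): h; rewrite (drop_size_cat t (erefl (size v))) => <-.
rewrite drop_cat; case: ltnP => // uv; have -> : size v = size u by lia.
by rewrite subnn drop0 drop_size.
Qed.

Lemma cat_cmpr u v s t : s ++ u = t ++ v -> (size v <= size u)%N -> exists2 u', u = u' ++ v & t = s ++ u'.
Proof.
move=> h vu.
have hs : (size s <= size t)%N by have := congr1 size h; rewrite !size_cat; lia.
by have [t' tt' ut'] := cat_cmp (esym h) hs; exists t'.
Qed.

Lemma cat_injl u s t : u ++ s = u ++ t -> s = t.
Proof. by move/(congr1 (drop (size u))); rewrite !drop_size_cat. Qed.
Lemma cat_injr u s t : s ++ u = t ++ u -> s = t.
Proof.
move=> h; have hs : size s = size t by have := congr1 size h; rewrite !size_cat; lia.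
by move/(congr1 (take (size s))): h; rewrite take_size_cat// hs take_size_cat.
Qed.

(* To be taken as the set of closed words at a vertex. *)
Variable cl : seq E -> Prop.
Hypothesis cl0 : cl [::].
Hypothesis clM : forall u v, cl u -> cl v -> cl (u ++ v).
Hypothesis cl_l : forall u v, cl u -> cl (u ++ v) -> cl v.
Hypothesis cl_r : forall u v, cl v -> cl (u ++ v) -> cl u.

Lemma cl_pw u k : cl u -> cl (pw u k).
Proof. by move=> cu; elim: k => [|k IH] //=; apply: clM. Qed.

Definition first_return u := [/\ cl u, u <> [::] & forall p s, u = p ++ s -> cl p -> p = [::] \/ s = [::]].

(** Of two prefixes of one word the shorter is a prefix of the longer, and a nonempty closed q
    shorter than u would be a proper closed prefix of a first return. So first returns form a prefix
    code and, by [fr_suffix], a suffix code. *)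
Lemma fr_prefix u q s t : first_return u -> cl q -> q <> [::] -> q ++ s = u ++ t ->
  exists2 q', q = u ++ q' & cl q'.
Proof.
move=> [cu u0 fu] cq q0 h; have [uq|uq] := leqP (size u) (size q).
  by have [q' qq' _] := cat_cmp h uq; exists q' => //; rewrite qq' in cq; exact: cl_l cq.
have [u' uu' _] := cat_cmp (esym h) (ltnW uq).
by have [//|u'0] := fu _ _ uu' cq; rewrite uu' u'0 cats0 ltnn in uq.
Qed.

Lemma fr_suffix u q s t : first_return u -> cl q -> q <> [::] -> s ++ q = t ++ u ->
  exists2 q', q = q' ++ u & cl q'.
Proof.
move=> [cu u0 fu] cq q0 h; have [uq|uq] := leqP (size u) (size q).
  by have [q' qq' _] := cat_cmpr h uq; exists q' => //; rewrite qq' in cq; exact: cl_r cq.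
have [u' uu' _] := cat_cmpr (esym h) (ltnW uq).
have cu' : cl u' by apply: cl_r cq _; rewrite -uu'.
by have [u'0|//] := fu _ _ uu' cu'; rewrite uu' u'0 ltnn in uq.
Qed.

Lemma fr_neq u v s t : first_return u -> first_return v -> u <> v -> u ++ s <> v ++ t.
Proof.
move=> fu fv uv h; have [cu u0 Fu] := fu; have [q uq cq] := fr_prefix fv cu u0 h.
have [cv v0 _] := fv; have [//|q0] := Fu _ _ uq cv.
by apply: uv; rewrite uq q0 cats0.
Qed.

Lemma fr_neqr u v s t : first_return u -> first_return v -> u <> v -> s ++ u <> t ++ v.
Proof.
move=> fu fv uv h; have [cu u0 Fu] := fu; have [q uq cq] := fr_suffix fv cu u0 h.
by have [cv v0 _] := fv; have [q0|//] := Fu _ _ uq cq; apply: uv; rewrite uq q0.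
Qed.

Lemma fr_pw_prefix u n v s : first_return u -> cl v -> v ++ s = pw u n -> exists a, v = pw u a.
Proof.
move=> fu; elim: n v => [|n IH] v cv.
  by case: v cv => // _ _; exists 0%N.
have [->|/eqP v0] := eqVneq v [::]; first by exists 0%N.
rewrite pwS => h; have [v' vv' cv'] := fr_prefix fu cv v0 h.
move: h; rewrite vv' -catA => /cat_injl /IH[//|a ->].
by exists a.+1.
Qed.

(** As u has at least one letter, the bound on the size of q keeps q within u^k, from which
    [fr_prefix] peels one u at a time. *)
Lemma prefix_pw u k q s t : first_return u -> cl q -> (size q <= k)%N ->
  q ++ s = pw u k ++ t -> exists a, q = pw u a.
Proof.
move=> fu; elim: k q => [|k IH] q cq qk.
  by case: q cq qk => // _ _ _; exists 0%N.
have [->|/eqP q0] := eqVneq q [::]; first by exists 0%N.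
rewrite pwS -catA => h; have [q' qq' cq'] := fr_prefix fu cq q0 h.
have u1 : (0 < size u)%N by case: fu => _; case: (u).
move: h; rewrite qq' -catA => /cat_injl /IH[//||a ->]; last by exists a.+1.
by move: qk; rewrite qq' size_cat; lia.
Qed.

Lemma suffix_pw u k q s t : first_return u -> cl q -> (size q <= k)%N ->
  s ++ q = t ++ pw u k -> exists a, q = pw u a.
Proof.
move=> fu; elim: k q => [|k IH] q cq qk.
  by case: q cq qk => // _ _ _; exists 0%N.
have [->|/eqP q0] := eqVneq q [::]; first by exists 0%N.
rewrite pwSr catA => h; have [q' qq' cq'] := fr_suffix fu cq q0 h.
have u1 : (0 < size u)%N by case: fu => _; case: (u).
move: h; rewrite qq' catA => /cat_injr /IH[//||a ->]; last by exists a.+1; rewrite pwSr.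
by move: qk; rewrite qq' size_cat; lia.
Qed.

(** Together with [fr_neq] this makes the closed words the free monoid on the first returns. *)
Lemma first_return_split w : cl w -> w <> [::] -> exists p s, [/\ w = p ++ s, first_return p & cl s].
Proof.
move=> cw w0.
have [n nw] := ubnP (size w); elim: n w cw w0 nw => // n IH w cw w0 nw.
have [fw|nf] := pselect (first_return w).
  by exists w, [::]; rewrite cats0.
have [p [s [ws cp p0 s0]]] : exists p s, [/\ w = p ++ s, cl p, p <> [::] & s <> [::]].
  apply: contrapT => h; apply: nf; split=> // p s ws cp.
  have [p0|p0] := pselect (p = [::]); first by left.
  by right; apply: contrapT => s0; apply: h; exists p, s.
have pn : (size p < n)%N.
  by move: nw; rewrite ws size_cat; case: (s) s0 => //= *; lia.
have [p' [s' [pp fp cs']]] := IH p cp p0 pn.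
exists p', (s' ++ s); split=> //; first by rewrite ws pp catA.
by case: fp => cp' _ _; apply: (cl_l cp'); rewrite catA -pp -ws.
Qed.

Variable R : realType.
Notation C := R[i].
Implicit Types F : seq E -> C.

(** If F is the symbol of T, then [lstrip u F] is that of L_u T and [rstrip u F] that of T L_u. *)
Definition lstrip u F q : C := if prefix u q then F (drop (size u) q) else 0.
Definition rstrip u F q : C := if suffix u q then F (take (size q - size u) q) else 0.

Lemma lstrip_cat u F q : lstrip u F (u ++ q) = F q.
Proof. by rewrite /lstrip prefix_prefix drop_size_cat. Qed.
Lemma rstrip_cat u F q : rstrip u F (q ++ u) = F q.
Proof. by rewrite /rstrip suffix_suffix size_cat addnK take_size_cat. Qed.
Lemma lstrip0 u F q : (forall q', q <> u ++ q') -> lstrip u F q = 0.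
Proof. by move=> h; rewrite /lstrip; case: prefixP => // -[q' /h]. Qed.
Lemma rstrip0 u F q : (forall q', q <> q' ++ u) -> rstrip u F q = 0.
Proof. by move=> h; rewrite /rstrip; case: suffixP => // -[q' /h]. Qed.
Lemma lstrip_zero u F q : (forall q', F q' = 0) -> lstrip u F q = 0.
Proof. by move=> h; rewrite /lstrip h; case: ifP. Qed.
Lemma rstrip_zero u F q : (forall q', F q' = 0) -> rstrip u F q = 0.
Proof. by move=> h; rewrite /rstrip h; case: ifP. Qed.

(* D u q stands for the coefficient of q in delta(L_u): D_cat is the Leibniz rule and
   D_bd the boundedness of delta, since all the L_u are contractions. *)
Variables (D : seq E -> seq E -> C) (M : R).
Hypothesis D_out : forall u q, cl u -> ~ cl q -> D u q = 0.
Hypothesis D_cat : forall u v q, cl u -> cl v ->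
  D (u ++ v) q = rstrip v (D u) q + lstrip u (D v) q.
Hypothesis D_bd : forall u (s : seq (seq E)), cl u -> uniq s -> \sum_(q <- s) nc (D u q) ^+ 2 <= M.

Lemma D_nil q : D [::] q = 0.
Proof.
have := D_cat q cl0 cl0; rewrite /= -{2}[q]cats0 rstrip_cat -{3}[q]/([::] ++ q) lstrip_cat.
by move/eqP; rewrite eq_sym -subr_eq0 addrK => /eqP.
Qed.

Lemma nc_bounded_eq0 (c : C) : (forall m : nat, m%:R * nc c ^+ 2 <= M) -> c = 0.
Proof.
move=> h; apply: Normc.eq0_normc; apply/eqP; apply: contrapT => /negP c0.
have cp : 0 < nc c ^+ 2 by rewrite exprn_gt0// lt_def c0 normc_ge0.
have := h (Num.bound (M / nc c ^+ 2)); apply/negP; rewrite -ltNge -ltr_pdivrMr//.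
by apply: archi_boundP; rewrite divr_ge0// ?(ltW cp)//; have := h 0%N; rewrite mul0r.
Qed.

(* k D u (u^a) is a coefficient of delta(L_{u^k}), for every k. *)
Lemma D_pw u a : cl u -> D u (pw u a) = 0.
Proof.
move=> cu.
have h k : D (pw u k.+1) (pw u (a + k)) = k.+1%:R * D u (pw u a).
  elim: k => [|k IH]; first by rewrite pw1 addn0 mul1r.
  rewrite pwSr D_cat//; last exact: cl_pw.
  rewrite addnS {1}(pwSr u (a + k)) rstrip_cat IH -addnS addnC pwD lstrip_cat.
  by rewrite -[in RHS]natr1 mulrDl mul1r.
apply: nc_bounded_eq0 => -[|m].
  by rewrite mul0r; have := D_bd cu (isT : uniq [::]); rewrite big_nil.
have := D_bd (cl_pw m.+1 cu) (isT : uniq [:: pw u (a + m)]); rewrite big_seq1 h.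
rewrite ncM exprMn; apply: le_trans.
have -> : nc (m.+1%:R : C) = m.+1%:R.
  have -> : (m.+1%:R : C) = (m.+1%:R : R)%:C by rewrite rmorph_nat.
  by rewrite /= expr0n addr0 sqrtr_sqr ger0_norm.
rewrite ler_wpM2r ?sqr_ge0// expr2 ler_peMr// ler1n //.
Qed.

(* The m words z^j y z^(m-1-j) are distinct and D (z^m) takes at each of them, for j large, the value N. *)
Lemma D_limit_eq0 z y (N : C) j0 : cl z -> (forall i t, z ++ t <> y ++ pw z i) ->
  (forall j, (j0 <= j)%N -> D (pw z j.+1) (pw z j ++ y) = N) -> N = 0.
Proof.
move=> cz hz hN.
pose W m j := pw z j ++ y ++ pw z (m - j).
have DW m j : (j <= m)%N -> (j0 <= j)%N -> D (pw z m.+1) (W m j) = N.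
  move=> jm j0j; have -> : m.+1 = (j.+1 + (m - j))%N by lia.
  rewrite pwD D_cat; try exact: cl_pw.
  rewrite /W catA rstrip_cat hN// lstrip0 ?addr0// => q'.
  by rewrite pwSr -!catA => /cat_injl/esym; exact: hz.
have Winj m j j' : (j < j')%N -> (j' <= m)%N -> W m j <> W m j'.
  move=> jj' j'm; have -> : j' = (j + (j' - j).-1.+1)%N by lia.
  by rewrite /W pwD (pwS z (j' - j).-1) -!catA => /cat_injl/esym; exact: hz.
apply: nc_bounded_eq0 => m.
have us : uniq [seq W (j0 + m) j | j <- iota j0 m].
  rewrite map_inj_in_uniq ?iota_uniq// => j j'; rewrite !mem_iota => hj hj' e.
  case: (ltngtP j j') => // jj'.
    by case: (Winj (j0 + m)%N _ _ jj'); first lia.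
  by case: (Winj (j0 + m)%N _ _ jj'); first lia.
have := D_bd (cl_pw (j0 + m).+1 cz) us; rewrite big_map; apply: le_trans.
rewrite big_seq (eq_bigr (fun=> nc N ^+ 2)); last first.
  by move=> j; rewrite mem_iota => hj; rewrite DW//; lia.
by rewrite -big_seq big_const_seq count_predT size_iota iter_addr_0 mulr_natl.
Qed.

Section StepA.
Variable u : seq E.
Hypothesis fu : first_return u.
Let cu : cl u. Proof. by case: fu. Qed.
Let u1 : (0 < size u)%N. Proof. by case: fu => _; case: (u). Qed.

Lemma D_pw_pw k a : D (pw u k) (pw u a) = 0.
Proof.
elim: k a => [|k IH] a; first by rewrite D_nil.
rewrite pwSr D_cat//; last exact: cl_pw.
case: a => [|a].
  rewrite rstrip0; last by move=> q' /(congr1 size); rewrite size_cat /=; lia.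
  rewrite add0r; have [k0|k0] := posnP k; first by rewrite k0 -[pw u 0]/([::] ++ [::]) lstrip_cat (@D_pw u 0).
  have ku : (0 < k * size u)%N by rewrite muln_gt0 k0.
  by rewrite lstrip0// => q' /(congr1 size); rewrite size_cat !size_pw /=; lia.
rewrite {1}pwSr rstrip_cat IH add0r.
have [ka|ka] := leqP k a.+1.
  have -> : a.+1 = (k + (a.+1 - k))%N by lia.
  by rewrite pwD lstrip_cat D_pw.
by rewrite lstrip0// => q' /(congr1 size); rewrite size_cat !size_pw; nia.
Qed.

Lemma D_pw_prefix k p s : p ++ s = pw u k -> D (pw u k) p = 0.
Proof.
move=> h; have [cp|cp] := pselect (cl p); last by rewrite D_out//; exact: cl_pw.
by have [a ->] := fr_pw_prefix fu cp h; exact: D_pw_pw.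
Qed.

(** In the Leibniz rule for u u^k the unwanted term is D u v with v u^k = u^(k+1) w. Since w is no
    longer than k, such a v is a prefix of u^(k+1), hence a power of u if closed, and [D_pw]
    applies. *)
Lemma D_quot_step k w : (size w <= k)%N ->
  D (pw u k.+1) (pw u k.+1 ++ w) = D (pw u k) (pw u k ++ w).
Proof.
move=> wk; have cuk := cl_pw k cu; rewrite {1}pwS D_cat//.
have -> : lstrip u (D (pw u k)) (pw u k.+1 ++ w) = D (pw u k) (pw u k ++ w).
  by rewrite pwS -catA lstrip_cat.
suff -> : rstrip (pw u k) (D u) (pw u k.+1 ++ w) = 0 by rewrite add0r.
rewrite /rstrip; case: suffixP => // -[v hv].
rewrite hv size_cat addnK take_size_cat//.
have [cv|cv] := pselect (cl v); last by rewrite D_out.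
have [|v' h1 _] := cat_cmp hv.
  by have := congr1 size hv; rewrite !size_cat !size_pw; nia.
by have [a ->] := fr_pw_prefix fu cv (esym h1); exact: D_pw.
Qed.

(* The eventual value of D (u^k) (u^k w). *)
Definition quot w := D (pw u (size w)) (pw u (size w) ++ w).

Lemma quotE k w : (size w <= k)%N -> D (pw u k) (pw u k ++ w) = quot w.
Proof.
move=> wk; have -> : k = (size w + (k - size w))%N by lia.
elim: (k - size w)%N => [|m IH]; first by rewrite addn0.
by rewrite addnS D_quot_step// leq_addr.
Qed.

Lemma quot_out w : ~ cl w -> quot w = 0.
Proof.
move=> cw; rewrite /quot D_out//; first exact: cl_pw.
by move=> h; apply: cw; apply: cl_l h; exact: cl_pw.
Qed.

(** Apply the Leibniz rule for u^k u at the word u^k q, with k large. If q begins with u, two of the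
    three terms are values of [quot]. Otherwise the left side does not depend on k, and
    [D_limit_eq0] makes it 0. *)
Lemma D_quot q : D u q = lstrip u quot q - rstrip u quot q.
Proof.
have [cq|cq] := pselect (cl q); last first.
  rewrite D_out// /lstrip /rstrip; case: prefixP => [[q' qq']|_].
    rewrite qq' drop_size_cat// (@quot_out q'); last by move=> h; apply: cq; rewrite qq'; apply: clM.
    case: suffixP => [[q2 qq2]|_]; last by rewrite subrr.
    rewrite qq2 size_cat addnK take_size_cat// quot_out ?subrr// => h.
    by apply: cq; rewrite qq' qq2; apply: clM.
  case: suffixP => [[q2 qq2]|_]; last by rewrite subrr.
  rewrite qq2 size_cat addnK take_size_cat// quot_out ?subrr// => h.
  by apply: cq; rewrite qq2; apply: clM.
have key k : D (pw u k.+1) (pw u k ++ q) = rstrip u (D (pw u k)) (pw u k ++ q) + D u q.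
  by rewrite pwSr D_cat ?lstrip_cat//; exact: cl_pw.
have [[q' qq']|np] := pselect (exists q', q = u ++ q').
  have := key (size q).
  have e1 : pw u (size q) ++ q = pw u (size q).+1 ++ q' by rewrite pwSr -catA -qq'.
  rewrite {1}e1 quotE; last by rewrite qq' size_cat; lia.
  have -> : rstrip u (D (pw u (size q))) (pw u (size q) ++ q) = rstrip u quot q.
    have [[q2 qq2]|ns] := pselect (exists q2, q = q2 ++ u).
      rewrite qq2 catA !rstrip_cat quotE//.
      by rewrite size_cat; lia.
    rewrite !rstrip0// => q2 qq2; apply: ns; first by exists q2.
    have [|q3 h3 _] := cat_cmpr qq2; last by exists q3.
    by rewrite qq' size_cat leq_addr.
  move=> e2; have -> : lstrip u quot q = quot q' by rewrite qq' lstrip_cat.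
  by rewrite e2 [X in X - _]addrC addrK.
rewrite lstrip0; last by move=> q' qq'; apply: np; exists q'.
rewrite sub0r; apply/eqP; rewrite -addr_eq0; apply/eqP.
have [->|/eqP q0] := eqVneq q [::].
  rewrite rstrip0 ?addr0; first exact: (@D_pw u 0).
  by move=> q' /(congr1 size); rewrite size_cat /=; lia.
apply: (@D_limit_eq0 u q _ (size q)) => //.
  by move=> i t /esym h; have [q' qq' _] := fr_prefix fu cq q0 h; apply: np; exists q'.
move=> j qj; rewrite key addrC; congr (_ + _).
have [[q2 qq2]|ns] := pselect (exists q2, q = q2 ++ u).
  rewrite qq2 catA !rstrip_cat quotE//.
  by move: qj; rewrite qq2 size_cat; lia.
rewrite !rstrip0// => q2 qq2; apply: ns; first by exists q2.
by have [q3 h3 _] := fr_suffix fu cq q0 qq2; exists q3.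
Qed.

End StepA.

Section StepB.
Variables u v : seq E.
Hypotheses (fu : first_return u) (fv : first_return v) (uv : u <> v).
Hypothesis Du : forall q, D u q = 0.
Let cu : cl u. Proof. by case: fu. Qed.
Let cv : cl v. Proof. by case: fv. Qed.

Let Dv1 : D v v = 0. Proof. by rewrite -[X in D _ X](pw1 v) D_pw. Qed.

Lemma Dpwu k q : D (pw u k) q = 0.
Proof.
elim: k q => [|k IH] q; first exact: D_nil.
rewrite pwS D_cat//; last exact: cl_pw.
by rewrite rstrip_zero// lstrip_zero// addr0.
Qed.

(** Put v and q between two copies of u^k, with k larger than the size of q. This leaves the
    coefficient unchanged, as D kills the powers of u, and [D_limit_eq0] applies to the longer words
    unless they overlap; an overlap forces q to be v u^a or u^a v. *)
Lemma D_support q : D v q <> 0 -> exists a, q = v ++ pw u a \/ q = pw u a ++ v.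
Proof.
move=> Dq; apply: contrapT => hq; apply: Dq.
have [cq|cq] := pselect (cl q); last exact: D_out.
have [k hk] : exists k, k = (size q).+1 by exists (size q).+1.
pose z := pw u k ++ v ++ pw u k; pose y := pw u k ++ q ++ pw u k.
have cuk : cl (pw u k) by exact: cl_pw.
have cz : cl z by apply: clM => //; apply: clM.
have -> : D v q = D z y.
  rewrite /z D_cat//; last exact: clM.
  rewrite rstrip_zero ?add0r; last exact: Dpwu.
  by rewrite lstrip_cat D_cat// rstrip_cat lstrip_zero ?addr0//; exact: Dpwu.
have kS : pw u k = u ++ pw u (size q) by rewrite hk.
apply: (@D_limit_eq0 z y _ 0%N) => //.
  move=> i t; rewrite {1}/z /y -!catA => /cat_injl h.
  have [q0|q0] := pselect (q = [::]).
    have h2 : v ++ pw u k ++ t = u ++ pw u (size q) ++ pw z i.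
      by rewrite h q0 cat0s kS q0 -catA.
    exact: (fr_neq fu fv uv (esym h2)).
  have [q' qq' cq'] := fr_prefix fv cq q0 (esym h).
  move: h; rewrite qq' -!catA => /cat_injl/esym h.
  have [|a qa] := prefix_pw fu cq' _ h; first by rewrite hk qq' size_cat; lia.
  by apply: hq; exists a; left; rewrite qq' qa.
move=> j _; rewrite pwSr D_cat//; last exact: cl_pw.
rewrite lstrip_cat rstrip0 ?add0r// => t.
rewrite /z /y !catA => /cat_injr h.
have [q0|q0] := pselect (q = [::]).
  by move: h; rewrite q0 cats0 hk pwSr !catA; exact: fr_neqr.
have [q' qq' cq'] := fr_suffix fv cq q0 h.
move: h; rewrite qq' !catA => /cat_injr h.
have [|a qa] := suffix_pw fu cq' _ h; first by rewrite hk qq' size_cat; lia.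
by apply: hq; exists a; right; rewrite qq' qa.
Qed.

(** Among the words allowed by [D_support] only the v u^a begin with v, and v itself is excluded
    because D v v = 0. *)
Lemma quotv_support w : D v (v ++ w) <> 0 -> exists a, w = pw u a.+1.
Proof.
move=> h; have [a [/cat_injl wa|]] := D_support h.
  case: a wa => [w0|a ->]; last by exists a.
  by case: h; rewrite w0 cats0 Dv1.
case: a => [/=|a].
  rewrite -{2}[v]cats0 => /cat_injl w0.
  by case: h; rewrite w0 cats0 Dv1.
by rewrite pwS -catA => /esym e; case: (fr_neq fu fv uv e).
Qed.

Hypothesis Dvv : forall w, D v (v ++ w) = 0.

(** Only words u^(a+1) v are left in the support of D v, so D (v^j) lives on words ending in v.
    Hence D (v^(j+1)) takes the same value at v^j q for all j, and [D_limit_eq0] applies. *)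
Lemma D_second_eq0 q : D v q = 0.
Proof.
have supp q' : D v q' <> 0 -> exists a, q' = pw u a.+1 ++ v.
  move=> h; have [a [qa|qa]] := D_support h; first by rewrite qa Dvv in h.
  case: a qa => [qa|a qa]; last by exists a.
  by case: h; rewrite qa /= Dv1.
apply: contrapT => Dq; have [a qa] := supp _ Dq; apply: Dq.
have ends j q' : D (pw v j) q' <> 0 -> exists t, q' = t ++ v.
  elim: j q' => [|j IH] q'; first by rewrite D_nil.
  rewrite pwSr D_cat//; last exact: cl_pw.
  move=> h; apply: contrapT => nt; apply: h.
  rewrite rstrip0 ?add0r; last by move=> t tt; apply: nt; exists t.
  rewrite /lstrip; case: prefixP => // -[t tt].
  rewrite tt drop_size_cat//; apply: contrapT => /supp[b tb]; apply: nt.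
  by exists (pw v j ++ pw u b.+1); rewrite tt tb catA.
apply: (@D_limit_eq0 v q _ 0%N) => //.
  by move=> i t; rewrite qa pwS -!catA => /esym; exact: fr_neq.
move=> j _; rewrite pwSr D_cat//; last exact: cl_pw.
rewrite lstrip_cat qa catA rstrip_cat (_ : D (pw v j) _ = 0) ?add0r//.
apply: contrapT => /ends[t]; rewrite pwSr catA; exact: fr_neqr.
Qed.
End StepB.

(** By [D_support], applied with u and with v, a word in the support of D v' is v' with powers of u
    on one side, and also v' with powers of v on one side. By freeness this leaves v' alone, where D
    vanishes by [D_pw]. *)
Lemma D_third_eq0 u v v' : first_return u -> first_return v -> first_return v' ->
  u <> v -> u <> v' -> v <> v' -> (forall q, D u q = 0) -> (forall q, D v q = 0) ->
  forall q, D v' q = 0.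
Proof.
move=> fu fv fv' uv uv' vv' Du Dv q; apply: contrapT => h.
have D0 : D v' v' = 0 by rewrite -[X in D _ X]pw1 D_pw//; case: fv'.
have [a qa] := D_support fu fv' uv' Du h.
have [b qb] := D_support fv fv' vv' Dv h.
have nq : q <> v' by move=> qv; rewrite qv D0 in h.
case: a qa => [|a]; first by rewrite cats0 /= => -[].
case: b qb => [|b]; first by rewrite cats0 /= => -[].
move=> qb [] qa; case: qb => qb; move: qb; rewrite qa.
- by rewrite !pwSr => /cat_injl; exact: fr_neqr.
- by rewrite pwS -catA; apply: fr_neq => // /esym.
- by rewrite [in LHS]pwS -!catA; exact: fr_neq.
- by rewrite !pwS -!catA; exact: fr_neq.
Qed.

Lemma D_all_eq0 : (forall u q, first_return u -> D u q = 0) -> forall w q, cl w -> D w q = 0.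
Proof.
move=> h w; have [n nw] := ubnP (size w); elim: n w nw => // n IH w nw q cw.
have [->|/eqP w0] := eqVneq w [::]; first exact: D_nil.
have [p [s [ws fp cs]]] := first_return_split cw w0.
have [cp p0 _] := fp.
rewrite ws D_cat// rstrip_zero ?lstrip_zero ?addr0// => q'; last exact: h.
apply: IH => //; move: nw; rewrite ws size_cat; case: (p) p0 => //= *; lia.
Qed.

End Free.

(** * Division of operators by words, and symbols of normalized derivations *)

Section SCC.
Variables (R : realType) (G : digraph).
Hypothesis finG : finite_graph G.
Notation V := (vertex G).
Notation E := (edge G).
Notation P := (dpath G).
Notation sym := (V -> seq E -> R[i]).
Notation A := (A_alg G R).
Notation L := (L_alg G R).
Implicit Types (S T X Y Z : bop R P) (x y z : V) (e : E) (u v w q : seq E) (p : P).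

Lemma basis_shift_norm (W : choiceType) (sigma : W -> option W)
  (h : forall (w w' q : W), sigma w = Some q -> sigma w' = Some q -> w = w') (f : ell2 R W) :
  ell2_norm (basis_shift R h f) <= ell2_norm f.
Proof. by rewrite ler_wsqrtr// fine_le ?sqnorm_fin//; exact: sqnorm_shift. Qed.

Lemma Lw_norm x w f : ell2_norm (Lw R x w f) <= ell2_norm f.
Proof.
elim: w f => [|e w IH] f; first exact: basis_shift_norm.
by rewrite Lw_cons; apply: le_trans (IH f); exact: basis_shift_norm.
Qed.

Lemma opnorm_Lw x w : opnorm (Lw R x w) <= 1.
Proof. by apply: opnorm_le => // f; rewrite mul1r Lw_norm. Qed.

Lemma cf_seq_sum X x (s : seq (seq {classic E})) : uniq s ->
  \sum_(q <- s) nc (cf X x q) ^+ 2 <= ell2_norm (X (one_ R x)) ^+ 2.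
Proof.
move=> us; pose g (q : seq {classic E}) : P :=
  if pselect (composable x (q : seq E)) is left h then DPath h else vpath x.
rewrite (bigID (fun q : seq {classic E} => `[< composable x (q : seq E) >]))/= [X in _ + X]big1 ?addr0; last first.
  by move=> q /asboolP h; rewrite cf_ncomp// nc0 expr0n.
rewrite -big_filter; set s' := seq.filter _ _.
have hs' (q : seq {classic E}) : q \in s' -> composable x (q : seq E) by rewrite mem_filter => /andP[/asboolP].
have gE (q : seq {classic E}) : q \in s' -> path_edges (g q) = q.
  by move=> /hs' h; rewrite /g; case: pselect.
have gi : {in s' &, injective g} by move=> q q' /gE + /gE + gg; rewrite gg => -> ->.
apply: (@le_trans _ _ (\sum_(p <- map g s') nc (X (one_ R x) p) ^+ 2)).
  rewrite big_map big_seq [leRHS]big_seq; apply: ler_sum => q /hs' h.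
  by rewrite cfE (at_comp _ h) /g; case: pselect => // h'; rewrite (Prop_irrelevance h h').
by apply: ell2_norm_sum; rewrite map_inj_in_uniq// filter_uniq.
Qed.

Lemma cf_LwM_cat x u X y v : composable x u -> word_range y v = x ->
  cf (Lw R x u * X) y (u ++ v) = cf X y v.
Proof. by move=> cu yv; rewrite cfE bop_mulE at_Lw_cat// cfE. Qed.

Lemma cf_LwM0 x u X y q : ~ (exists2 v, q = u ++ v & word_range y v = x) ->
  cf (Lw R x u * X) y q = 0.
Proof. by move=> h; rewrite cfE bop_mulE at_Lw0. Qed.

Lemma cf_MLw_cat x u X q : convform X -> composable x u ->
  cf (X * Lw R x u) x (q ++ u) = cf X (word_range x u) q.
Proof.
move=> cX cu; rewrite cfM// conv_sum.
have im : size q \in iota 0 (size (q ++ u)).+1 by rewrite mem_iota add0n ltnS size_cat leq_addr.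
rewrite (bigD1_seq _ im (iota_uniq _ _)) big_seq_cond big1 => [|i]; last first.
  rewrite mem_iota add0n ltnS => /andP[/andP[_ iq] /eqP iq'].
  rewrite cf_Lw// asboolF ?mulr0// => -[_ /(congr1 size)].
  by rewrite size_drop size_cat; move: iq; rewrite size_cat; lia.
by rewrite drop_size_cat// take_size_cat// cf_Lw// asboolT// mulr1 /= addr0.
Qed.

Lemma cf_MLw0 x u X y q : convform X -> composable x u ->
  ~ (y = x /\ exists q', q = q' ++ u) -> cf (X * Lw R x u) y q = 0.
Proof.
move=> cX cu h; rewrite cfM// conv_sum big1// => i _.
rewrite cf_Lw// asboolF ?mulr0// => -[yx qu]; apply: h; split=> //.
by exists (take i q); rewrite -qu cat_take_drop.
Qed.

Lemma conv_cat (a F : sym) x u w :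
  (forall s t y, u = s ++ t -> t <> [::] -> a y s = 0) ->
  cnv a F x (u ++ w) = cnv (fun y v => a y (u ++ v)) F x w.
Proof.
elim: u a => [//|e u IH] a h /=.
rewrite (h [::] (e :: u))// mul0r add0r IH// => s t y us t0.
by apply: (h (e :: s) t) => //; rewrite us.
Qed.

(** The convolution by t at q is the value of X f at u q, so the bound K passes from X to t. The
    pair X, u may depend on the finite set s, because the eventual values along the powers of a word
    are reached at an exponent that depends on s. *)
Lemma bounded_by_shift (t : sym) (K : R) : supp t -> 0 <= K ->
  (forall s : seq P, exists X u, [/\ convform X, opnorm X <= K,
     forall u1 u2 y, u = u1 ++ u2 -> u2 <> [::] -> cf X y u1 = 0 &
     forall p i, p \in s -> (i <= size (path_edges p))%N ->
       val_ t (lpath p i) = cf X (path_src (lpath p i)) (u ++ path_edges (lpath p i))]) ->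
  exists T, L T /\ cf T = t.
Proof.
move=> st K0 h.
have [f s us|T [cT cfT _]] := bounded_conv st K0; last first.
  by exists T; split=> //; apply/(L_algP _ finG).
have [X [u [cX XK hu hX]]] := h s.
have key (q : P) : q \in s -> val_ (cnv t (at_ f)) q = at_ (X f) (path_src q) (u ++ path_edges q).
  move=> qs; rewrite cX conv_cat// /val_ !conv_sum.
  rewrite big_seq [RHS]big_seq; apply: eq_bigr => i; rewrite mem_iota add0n ltnS => /andP[_ iq].
  by congr (_ * _); exact: (hX q i qs iq).
rewrite big_seq (eq_bigr (fun q : P => nc (at_ (X f) (path_src q) (u ++ path_edges q)) ^+ 2)); last first.
  by move=> q qs; rewrite key.
rewrite -big_seq.
pose g (q : P) : P := if pselect (composable (path_src q) (u ++ path_edges q)) is left c then DPath c else q.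
rewrite (bigID (fun q : P => `[< composable (path_src q) (u ++ path_edges q) >]))/= [X in _ + X]big1 ?addr0; last first.
  by move=> q /asboolP hq; rewrite at_ncomp// nc0 expr0n.
rewrite -big_filter; set s' := seq.filter _ _.
have hs' (q : P) : q \in s' -> composable (path_src q) (u ++ path_edges q) by rewrite mem_filter => /andP[/asboolP].
have gE (q : P) : q \in s' -> path_src (g q) = path_src q /\ path_edges (g q) = u ++ path_edges q.
  by move=> /hs' c; rewrite /g; case: pselect.
have gi : {in s' &, injective g}.
  move=> q q' /gE[h1 h2] /gE[h3 h4] gg; apply: path_inj; first by rewrite -h1 gg h3.
  by move: h2; rewrite gg h4 => /(@cat_injl {classic E}).
apply: (@le_trans _ _ (ell2_norm (X f) ^+ 2)).
  rewrite (_ : \sum_(q <- s') _ = \sum_(q <- map g s') nc (X f q) ^+ 2).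
    by apply: ell2_norm_sum; rewrite map_inj_in_uniq// filter_uniq.
  rewrite big_map big_seq [RHS]big_seq; apply: eq_bigr => q qs.
  by have [h1 h2] := gE q qs; rewrite -(at_path (X f) (g q)) h1 h2.
rewrite -exprMn ler_sqr ?nnegrE ?mulr_ge0 ?ell2_norm_ge0//.
by apply: le_trans (opnormP _ _) _; rewrite ler_wpM2r ?ell2_norm_ge0.
Qed.

(** T is X followed by the adjoint of L_u; the hypothesis on the proper prefixes of u makes it a
    convolution again. *)
Lemma left_quotient X u : L X ->
  (forall u1 u2 y, u = u1 ++ u2 -> u2 <> [::] -> cf X y u1 = 0) ->
  exists T, L T /\ cf T = (fun y v => cf X y (u ++ v)).
Proof.
move=> LX hu; have cX := L_alg_convform LX.
apply: (@bounded_by_shift _ (opnorm X)); first last.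
- by move=> s; exists X, u; split.
- exact: opnorm_ge0.
- by move=> y v nc; rewrite cf_ncomp// => /composable_cat[].
Qed.

Definition closed_at T x := forall y v, cf T y v <> 0 -> y = x /\ word_range x v = x.

Lemma closed_at0 x : closed_at 0 x.
Proof. by move=> y v; rewrite cf0. Qed.

Lemma closed_atD S T x : closed_at S x -> closed_at T x -> closed_at (S + T) x.
Proof.
move=> hS hT y v; rewrite cfD => h.
have [S0|S0] := pselect (cf S y v = 0); last exact: hS.
by apply: hT; move: h; rewrite S0 add0r.
Qed.

Lemma closed_at_vertexM T x y : L T -> closed_at T x ->
  L_vertex R y * T = if pselect (x = y) then T else 0.
Proof.
move=> LT hT; have cT := L_alg_convform LT.
have cV : convform (L_vertex R y * T) by apply: L_alg_convform; apply: L_alg_M => //; exact: L_alg_vertex.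
apply: convform_inj => //; first by case: pselect => //= _; exact: convform0.
move=> z v; rewrite cf_vertexM//.
have [h|h] := pselect (cf T z v = 0).
  by rewrite h; do 2?case: pselect => ? /=; rewrite ?cf0 ?h.
have [zx xv] := hT _ _ h; rewrite zx xv.
by do 2?case: pselect => //= ?; rewrite cf0.
Qed.

Lemma closed_at_Mvertex T x y : L T -> closed_at T x ->
  T * L_vertex R y = if pselect (x = y) then T else 0.
Proof.
move=> LT hT; have cT := L_alg_convform LT.
have cV : convform (T * L_vertex R y) by apply: L_alg_convform; apply: L_alg_M => //; exact: L_alg_vertex.
apply: convform_inj => //; first by case: pselect => //= _; exact: convform0.
move=> z v; rewrite cf_Mvertex//.
have [h|h] := pselect (cf T z v = 0).
  by rewrite h; do 2?case: pselect => ? /=; rewrite ?cf0 ?h.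
have [zx xv] := hT _ _ h; rewrite zx.
by do 2?case: pselect => //= ?; rewrite cf0.
Qed.

Definition normalized (d : bop R P -> bop R P) := forall x, d (L_vertex R x) = 0.

Lemma normalized_sub d T x : der d -> normalized d -> L T -> closed_at T x -> normalized (der_sub d T).
Proof.
move=> dd nd LT hT y; rewrite /der_sub nd (@closed_at_vertexM T x y LT hT) (@closed_at_Mvertex T x y LT hT).
by case: pselect => ? /=; rewrite ?subrr ?subr0// ?sub0r ?subrr.
Qed.

Section Normalized.
Variable d : bop R P -> bop R P.
Hypotheses (dd : der d) (nd : normalized d).

Lemma d_conv S : A S -> convform (d S).
Proof. by move=> AS; apply: L_alg_convform; exact: der_L. Qed.

Lemma d_vertexM x S : A S -> d (L_vertex R x * S) = L_vertex R x * d S.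
Proof. by move=> AS; rewrite derM// ?nd ?mul0r ?add0r//; exact: A_vertex. Qed.

Lemma d_Mvertex x S : A S -> d (S * L_vertex R x) = d S * L_vertex R x.
Proof. by move=> AS; rewrite derM// ?nd ?mulr0 ?addr0//; exact: A_vertex. Qed.

(** A normalized derivation commutes with multiplication by the L_x on either side, and therefore
    preserves sources and ranges. *)
Lemma d_Lw_supp x u y q : composable x u -> cf (d (Lw R x u)) y q <> 0 ->
  y = x /\ word_range x q = word_range x u.
Proof.
move=> cu; have AL := @A_Lw R G x u; rewrite (Lw_vertex _ cu) d_Mvertex// cf_Mvertex; last exact: d_conv.
case: pselect => //= ->; rewrite (vertex_Lw _ cu) d_vertexM// cf_vertexM; last exact: d_conv.
by case: pselect.
Qed.

Lemma d_Lw_cat x u v : composable x (u ++ v) ->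
  d (Lw R x (u ++ v)) = d (Lw R (word_range x v) u) * Lw R x v + Lw R (word_range x v) u * d (Lw R x v).
Proof. by move=> c; rewrite Lw_cat// derM//; exact: A_Lw. Qed.

Lemma d_bound : exists2 M : R, 0 <= M & forall S, A S -> opnorm (d S) <= M * opnorm S.
Proof.
have [_ _ _ [M hM]] := dd; exists `|M| => // S AS; apply: le_trans (hM S AS) _.
by rewrite ler_wpM2r ?opnorm_ge0 ?ler_norm.
Qed.

Lemma d_Lw_bound : exists2 M : R, 0 <= M & forall x u, opnorm (d (Lw R x u)) <= M.
Proof.
have [M M0 hM] := d_bound; exists M => // x u; apply: le_trans (hM _ (@A_Lw R G x u)) _.
by rewrite -[leRHS]mulr1 ler_wpM2l// opnorm_Lw.
Qed.

Lemma composable_src_inj a b (w : seq E) : composable a w -> composable b w -> w <> [::] -> a = b.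
Proof.
elim: w => [//|e [|e' w] IH] [ha ca] [hb cb] _; first exact: etrans (esym ha) hb.
exact: IH.
Qed.

Section At.
Variable x : V.
(** With [Dx], this is the instance at x of the abstract [cl] and [D]; [{classic E}] provides
    decidable equality of letters. *)
Definition clx (w : seq {classic E}) := composable x (w : seq E) /\ word_range x (w : seq E) = x.
Definition Dx (u q : seq {classic E}) : R[i] := cf (d (Lw R x u)) x q.

Lemma clx0 : clx [::]. Proof. by []. Qed.
Lemma clxM u v : clx u -> clx v -> clx (u ++ v).
Proof. by move=> [cu ux] [cv vx]; split; rewrite ?word_range_cat ?vx// composable_cat vx. Qed.
Lemma clx_l u v : clx u -> clx (u ++ v) -> clx v.
Proof.
move=> [cu ux] [/composable_cat[cu' cv]]; rewrite word_range_cat => h; split=> //.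
case: u cu ux cu' h => [//|e u] cu ux cu' h.
by rewrite -(composable_src_inj cu cu').
Qed.
Lemma clx_r u v : clx v -> clx (u ++ v) -> clx u.
Proof. by move=> [cv vx] [/composable_cat[]]; rewrite vx => cu _; rewrite word_range_cat vx. Qed.

Lemma Dx_out u q : clx u -> ~ clx q -> Dx u q = 0.
Proof.
move=> [cu ux] cq; apply: contrapT => h; apply: cq; split.
  by apply: contrapT => nq; apply: h; rewrite /Dx cf_ncomp.
by have [_ ->] := d_Lw_supp cu h.
Qed.

Lemma Dx_cat (u v q : seq {classic E}) : clx u -> clx v -> Dx (u ++ v) q = rstrip v (Dx u) q + lstrip u (Dx v) q.
Proof.
move=> [cu ux] [cv vx]; rewrite /Dx d_Lw_cat; last by rewrite composable_cat vx.
rewrite vx cfD; congr (_ + _).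
  have [[q' qq']|h] := pselect (exists q', q = q' ++ v).
    by rewrite qq' rstrip_cat cf_MLw_cat ?vx//; apply: d_conv; exact: A_Lw.
  rewrite rstrip0; last by move=> q' qq'; apply: h; exists q'.
  by rewrite cf_MLw0//; [apply: d_conv; exact: A_Lw|move=> -[]].
have [[q' qq']|h] := pselect (exists q', q = u ++ q'); last first.
  rewrite lstrip0; last by move=> q' qq'; apply: h; exists q'.
  by rewrite cf_LwM0// => -[q' qq' _]; apply: h; exists q'.
rewrite qq' lstrip_cat.
have [q'x|q'x] := pselect (word_range x q' = x); first by rewrite cf_LwM_cat.
rewrite cf_LwM0; last by move=> [q2 /(@cat_injl {classic E}) <-].
apply/esym; apply: contrapT => /(d_Lw_supp cv)[_]; by rewrite vx.
Qed.

Lemma Dx_bd : exists M : R, forall u (s : seq (seq {classic E})), clx u -> uniq s ->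
  \sum_(q <- s) nc (Dx u q) ^+ 2 <= M.
Proof.
have [M M0 hM] := d_Lw_bound; exists (M ^+ 2) => u s _ us.
apply: le_trans (cf_seq_sum _ x us) _; rewrite ler_sqr ?nnegrE ?ell2_norm_ge0//.
apply: le_trans (opnormP _ _) _; rewrite -[leRHS]mulr1 ler_pM ?opnorm_ge0 ?ell2_norm_ge0//.
exact: ell2_norm_basis.
Qed.

End At.
End Normalized.
End SCC.

(** * Inner corrections on a strong component *)

Section SCC.
Variables (R : realType) (G : digraph).
Hypothesis finG : finite_graph G.
Notation V := (vertex G).
Notation E := (edge G).
Notation E' := ({classic E}).
Notation P := (dpath G).
Notation sym := (V -> seq E -> R[i]).
Notation A := (A_alg G R).
Notation L := (L_alg G R).
Implicit Types (S T X Y Z : bop R P) (x y z : V) (e : E) (u v w q : seq E') (p : P).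
Implicit Types (d : bop R P -> bop R P).

Definition at_symbol x (f : seq E' -> R[i]) : sym := fun y v =>
  if `[< y = x /\ clx x v >] then f v else 0.

Lemma at_symbol_supp x f : supp (at_symbol x f).
Proof. by move=> y v h; rewrite /at_symbol asboolF// => -[yx [c _]]; apply: h; rewrite yx. Qed.

Lemma closed_at_symbol T x f : cf T = at_symbol x f -> closed_at T x.
Proof. by move=> cfT y v; rewrite cfT /at_symbol; case: asboolP => // -[yx [_ xv]]. Qed.

Lemma Dx_sub d T x u q : der d -> normalized d -> L T -> closed_at T x -> clx x u ->
  Dx (der_sub d T) x u q = Dx d x u q - (lstrip u (cf T x) q - rstrip u (cf T x) q).
Proof.
move=> dd nd LT hT [cu ux]; have cT := L_alg_convform LT.
rewrite /Dx /der_sub cfB cfB; congr (_ - (_ - _)).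
  have [[q' qq']|h] := pselect (exists q', q = u ++ q'); last first.
    rewrite lstrip0; last by move=> q' qq'; apply: h; exists q'.
    by rewrite cf_LwM0// => -[q' qq' _]; apply: h; exists q'.
  rewrite qq' lstrip_cat.
  have [q'x|q'x] := pselect (word_range x q' = x); first by rewrite cf_LwM_cat.
  rewrite cf_LwM0; last by move=> [q2 /(@cat_injl E') <-].
  by apply/esym; apply: contrapT => /hT[].
have [[q' qq']|h] := pselect (exists q', q = q' ++ u).
  by rewrite qq' rstrip_cat cf_MLw_cat// ux.
rewrite rstrip0; last by move=> q' qq'; apply: h; exists q'.
by rewrite cf_MLw0// => -[].
Qed.

(** The symbol [quot] is the entrywise limit of the left quotients of d(L_w) by w along the powers w
    of u, and the norms of d(L_w) are bounded uniformly in w. *)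
Lemma scc_kill_first d x u : der d -> normalized d -> first_return (clx x) u ->
  exists T, [/\ L T, closed_at T x & forall q, Dx (der_sub d T) x u q = 0].
Proof.
move=> dd nd fu.
have [M hM] := Dx_bd dd x.
have h1 := @clx0 _ x; have h2 := @clxM _ x; have h3 := @clx_l _ x; have h4 := @clx_r _ x.
have h5 := Dx_out dd nd (x := x); have h6 := Dx_cat dd nd (x := x).
have [cu u0 _] := fu.
have [K K0 hK] := d_Lw_bound dd.
pose f := quot (Dx d x) u.
have fout w : ~ clx x w -> f w = 0 by move=> cw; eapply quot_out; eassumption.
have [|s|T [LT cfT]] := @bounded_by_shift R G finG (at_symbol x f) K _ K0.
- exact: at_symbol_supp.
(* This k is at least the length of every left factor of a path in s, so the eventual value is
   attained there. *)
- pose k := (\sum_(p <- s) size (path_edges p))%N.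
  have cuk : clx x (pw u k) by exact: (cl_pw h1 h2).
  exists (d (Lw R x (pw u k))), (pw u k); split.
  + by apply: d_conv => //; exact: A_Lw.
  + exact: hK.
  + move=> v1 v2 y vv v0; apply: contrapT => h.
    have [yx _] := d_Lw_supp dd nd (proj1 cuk) h.
    apply: h; rewrite yx; change (Dx d x (pw u k) v1 = 0).
    by eapply (@D_pw_prefix E' (clx x)); try eassumption; exact: (esym vv).
  + move=> p i ps ip; set p' := lpath p i.
    have sk : (size (path_edges p') <= k)%N.
      rewrite /= size_takel//; apply: (leq_trans ip).
      by rewrite /k (perm_big _ (perm_to_rem ps)) big_cons leq_addr.
    have [px|px] := pselect (path_src p' = x); last first.
      rewrite /val_ /at_symbol asboolF; last by move=> [].
      apply/esym; apply: contrapT => nz; apply: px.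
      by have [] := d_Lw_supp dd nd (proj1 cuk) nz.
    have cp := Defs.pathP p'; rewrite px in cp.
    transitivity (f (path_edges p')).
      rewrite /val_ px /at_symbol; case: asboolP => // h; rewrite fout// => c; exact: h.
    rewrite px; apply/esym; change (Dx d x (pw u k) (pw u k ++ path_edges p') = quot (Dx d x) u (path_edges p')).
    by eapply (@quotE E' (clx x)); eassumption.
exists T; split=> //; first exact: closed_at_symbol cfT.
move=> q; rewrite Dx_sub//; last exact: closed_at_symbol cfT.
have -> : cf T x = f.
  apply: funext => w; rewrite cfT /at_symbol; case: asboolP => // h.
  by rewrite fout// => cw; apply: h.
have -> : Dx d x u q = lstrip u f q - rstrip u f q.
  by eapply (@D_quot E' (clx x)); eassumption.
by rewrite subrr.
Qed.

(** T is the left quotient of d(L_v) by v. By [quotv_support] its symbol lives on powers of u, hence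
    commutes with u, and the correction at v does not spoil the vanishing at u. *)
Lemma scc_kill_second d x u v : der d -> normalized d ->
  first_return (clx x) u -> first_return (clx x) v -> u <> v ->
  (forall q, Dx d x u q = 0) ->
  exists T, [/\ L T, closed_at T x,
    forall q, Dx (der_sub d T) x u q = 0 & forall q, Dx (der_sub d T) x v q = 0].
Proof.
move=> dd nd fu fv uv Du.
have [M hM] := Dx_bd dd x.
have h1 := @clx0 _ x; have h2 := @clxM _ x; have h3 := @clx_l _ x; have h4 := @clx_r _ x.
have h5 := Dx_out dd nd (x := x); have h6 := Dx_cat dd nd (x := x).
have [cu u0 _] := fu; have [cv v0 Fv] := fv.
have supp w : Dx d x v (v ++ w) <> 0 -> exists a, w = pw u a.+1.
  by move=> h; eapply (@quotv_support E' (clx x)); eassumption.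
have [|T [LT cfT]] := @left_quotient R G finG (d (Lw R x v)) v (der_L dd (A_Lw x v)).
  move=> u1 u2 y vE u20; apply: contrapT => h.
  have [yx xu1] := d_Lw_supp dd nd (proj1 cv) h.
  have cu1 : clx x u1.
    split; last by rewrite xu1; case: cv.
    by apply: contrapT => nc; apply: h; rewrite yx cf_ncomp.
  have [u10|//] := Fv _ _ vE cu1.
  apply: h; rewrite yx u10.
  by apply: (@D_pw E' (clx x) h1 h2 R _ M h6 hM v 0).
have hT : closed_at T x.
  move=> y w; rewrite cfT => h.
  have [yx xw] := d_Lw_supp dd nd (proj1 cv) h; split=> //.
  rewrite yx in h; have [a ->] := supp _ h.
  by case: (cl_pw h1 h2 a.+1 cu).
have tE w : cf T x w = Dx d x v (v ++ w) by rewrite cfT.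
have nd' := normalized_sub dd nd LT hT; have dd' := der_der_sub finG dd LT.
have Du' q : Dx (der_sub d T) x u q = 0.
  rewrite Dx_sub// Du sub0r; apply/eqP; rewrite oppr_eq0 subr_eq0; apply/eqP.
  have [[q' qq']|nq] := pselect (exists q', q = u ++ q'); last first.
    rewrite lstrip0; last by move=> q' qq'; apply: nq; exists q'.
    rewrite /rstrip; case: suffixP => // -[q' qq'].
    rewrite qq' size_cat addnK take_size_cat// tE; apply/esym; apply: contrapT => /supp[a qa].
    by apply: nq; exists (pw u a ++ u); rewrite qq' qa pwS -catA.
  rewrite qq' lstrip_cat.
  have [t0|nz] := pselect (cf T x q' = 0); last first.
    by move: nz; rewrite tE => /supp[a ->]; rewrite -pwS (pwSr u a.+1) rstrip_cat.
  rewrite t0 /rstrip; case: suffixP => // -[q2 qq2].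
  rewrite qq2 size_cat addnK take_size_cat//; apply/esym; apply: contrapT => nz.
  have [a qa] : exists a, q2 = pw u a.+1 by apply: supp; rewrite -tE.
  by apply: nz; move: qq2; rewrite qa -pwSr pwS => /(@cat_injl E') <-.
exists T; split=> // q.
have [M' hM'] := Dx_bd dd' x.
have h5' := Dx_out dd' nd' (x := x); have h6' := Dx_cat dd' nd' (x := x).
have Dvv w : Dx (der_sub d T) x v (v ++ w) = 0.
  rewrite Dx_sub// lstrip_cat tE opprB addrC subrK.
  rewrite /rstrip; case: suffixP => // -[q' qq'].
  rewrite qq' size_cat addnK take_size_cat// tE; apply: contrapT => /supp[a qa].
  by move: qq'; rewrite qa pwS -catA => /esym; eapply (@fr_neq E' (clx x)); eassumption.
exact: (@D_second_eq0 E' (clx x) h1 h2 h3 h4 R _ M' h5' h6' hM' u v fu fv uv Du' Dvv).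
Qed.

(** The cases are no first return, exactly one, and at least two; in the last case [D_third_eq0]
    disposes of all but the first two. *)
Lemma scc_closed d x : der d -> normalized d ->
  exists T, [/\ L T, closed_at T x & forall u q, clx x u -> Dx (der_sub d T) x u q = 0].
Proof.
move=> dd nd.
have h1 := @clx0 _ x; have h2 := @clxM _ x; have h3 := @clx_l _ x; have h4 := @clx_r _ x.
have [[u fu]|nu] := pselect (exists u, first_return (clx x) u); last first.
  exists 0; split; [by case: (@L_alg_sub R G)|exact: closed_at0|].
  have L0 : L (0 : bop R P) by case: (@L_alg_sub R G).
  have nd' := normalized_sub dd nd L0 (@closed_at0 R G x); have dd' := der_der_sub finG dd L0.
  have h5' := Dx_out dd' nd' (x := x); have h6' := Dx_cat dd' nd' (x := x).
  have all0 := @D_all_eq0 E' (clx x) h1 h3 R _ h6'.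
  by move=> u q cu; apply: all0 => // u' q' fu'; case: nu; exists u'.
have [T1 [LT1 hT1 D1]] := scc_kill_first dd nd fu.
have nd1 := normalized_sub dd nd LT1 hT1; have dd1 := der_der_sub finG dd LT1.
have [[v [fv uv]]|nv] := pselect (exists v, first_return (clx x) v /\ u <> v); last first.
  exists T1; split=> //.
  have h6' := Dx_cat dd1 nd1 (x := x).
  have all0 := @D_all_eq0 E' (clx x) h1 h3 R _ h6'.
  move=> w q cw; apply: all0 => // u' q' fu'.
  have [<-|uu'] := pselect (u = u'); first exact: D1.
  by case: nv; exists u'.
have [T2 [LT2 hT2 D2u D2v]] := scc_kill_second dd1 nd1 fu fv uv D1.
have nd2 := normalized_sub dd1 nd1 LT2 hT2; have dd2 := der_der_sub finG dd1 LT2.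
exists (T1 + T2); split; [exact: L_alg_D|exact: closed_atD|].
have -> : der_sub d (T1 + T2) = der_sub (der_sub d T1) T2.
  apply: funext => S; rewrite /der_sub -[RHS]addrA -opprD; congr (_ - _).
  by rewrite mulrDl mulrDr opprD addrACA.
have [M hM] := Dx_bd dd2 x.
have h5 := Dx_out dd2 nd2 (x := x); have h6 := Dx_cat dd2 nd2 (x := x).
have all0 := @D_all_eq0 E' (clx x) h1 h3 R _ h6.
move=> w q cw; apply: all0 => // u' q' fu'.
have [<-|uu'] := pselect (u = u'); first exact: D2u.
have [<-|vu'] := pselect (v = u'); first exact: D2v.
by eapply (@D_third_eq0 E' (clx x) h1 h2 h3 h4 _ _ M h5 h6 hM u v).
Qed.

Definition reach x y := clos_refl_trans _ (@Defs.adjacent G) x y.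

Lemma reachP x y : reach x y <-> exists w, composable x (w : seq E) /\ word_range x (w : seq E) = y.
Proof.
split.
  move=> h; elim: (clos_rt_rtn1 _ _ _ _ h) => [|y' z [e [se re]] _ [w [cw wr]]]; first by exists [::].
  by exists (e :: w); split=> //=; split=> //; rewrite se wr.
move=> [w [cw <-]]; elim: w cw => [|e w IH] /=; first by move=> _; exact: rt_refl.
move=> [ew cw]; apply: rt_trans (IH cw) _; apply: rt_step; exists e.
by rewrite ew.
Qed.

Lemma left_cancel y u Z : composable y (u : seq E) -> convform Z ->
  (forall z v, cf Z z v <> 0 -> word_range z v = y) -> Lw R y u * Z = 0 -> Z = 0.
Proof.
move=> cu cZ hZ h; apply: convform_inj => //; first exact: convform0.
move=> z v; rewrite cf0; apply: contrapT => nz; apply: (nz).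
by rewrite -(cf_LwM_cat Z cu (hZ _ _ nz)) h cf0.
Qed.

Lemma right_cancel y u Z : composable y (u : seq E) -> convform Z ->
  (forall z v, cf Z z v <> 0 -> z = word_range y u) -> Z * Lw R y u = 0 -> Z = 0.
Proof.
move=> cu cZ hZ h; apply: convform_inj => //; first exact: convform0.
move=> z v; rewrite cf0; apply: contrapT => nz; apply: (nz).
by rewrite (hZ _ _ nz) -cf_MLw_cat// h cf0.
Qed.

(** Let h be a shortest path from y to x. The support of d(L_h) consists of paths from y to x, none
    shorter than h. With g leading from x to y, d vanishes on the closed word h g, which forces the
    words in this support to begin with h; T is the left quotient by h. *)
Lemma quotient_at d x y : der d -> normalized d ->
  (forall u q, clx x u -> Dx d x u q = 0) -> reach x y -> reach y x ->
  exists T u, [/\ L T, closed_at T y, composable y (u : seq E), word_range y u = x &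
    d (Lw R y u) = Lw R y u * T /\ (y = x -> T = 0)].
Proof.
move=> dd nd Dx0 /reachP[g [cg gy]] /reachP hyx.
have [n [hn nmin]] : exists n, (exists w, [/\ composable y (w : seq E), word_range y (w : seq E) = x & size w = n]) /\
   forall w, composable y (w : seq E) -> word_range y (w : seq E) = x -> (n <= size w)%N.
  have ex : exists n, `[< exists w, [/\ composable y (w : seq E), word_range y (w : seq E) = x & size w = n] >].
    by have [w [cw wx]] := hyx; exists (size w); apply/asboolP; exists w.
  exists (ex_minn ex); case: ex_minnP => n /asboolP hn nm; split=> // w cw wx.
  by apply: nm; apply/asboolP; exists w.
have [h [ch hx hs]] := hn.
have ddh := der_L dd (A_Lw y h).
have cdh : convform (d (Lw R y h)) by exact: L_alg_convform.
have chg : composable x (h ++ g) by rewrite composable_cat gy.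
have supp w : cf (d (Lw R y h)) y w <> 0 -> exists w', w = h ++ w'.
  move=> nz; have [_ wx] := d_Lw_supp dd nd ch nz.
  have cw : composable y w by apply: contrapT => nc; apply: nz; rewrite cf_ncomp.
  have hw : (size h <= size w)%N by rewrite hs; apply: nmin => //; rewrite wx.
  have : Dx d x (h ++ g) (w ++ g) = 0.
    by apply: Dx0; split=> //; rewrite word_range_cat gy.
  rewrite /Dx d_Lw_cat// gy cfD -{1}gy cf_MLw_cat ?gy// => e0.
  have [[v [hv _]]|nv] := pselect (exists v, w ++ g = h ++ v /\ word_range x v = y).
    by have [w' ww' _] := @cat_cmp E' _ _ _ _ hv hw; exists w'.
  case: nz; move: e0; rewrite cf_LwM0 ?addr0// => -[v hv vy]; apply: nv; by exists v.
have [|T [LT cfT]] := @left_quotient R G finG (d (Lw R y h)) h ddh.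
  move=> u1 u2 z hE u20; apply: contrapT => nz.
  have [zy u1x] := d_Lw_supp dd nd ch nz; rewrite zy in nz.
  have cu1 : composable y u1 by apply: contrapT => nc; apply: nz; rewrite cf_ncomp.
  have := nmin u1 cu1; rewrite u1x => /(_ hx); rewrite -hs hE size_cat.
  by case: (u2) u20 => //= *; lia.
exists T, h; split=> //.
  move=> z v; rewrite cfT => nz; have [zy vx] := d_Lw_supp dd nd ch nz; split=> //.
  rewrite zy in nz *.
  have : composable y (h ++ v) by apply: contrapT => nc; apply: nz; rewrite cf_ncomp.
  move=> /composable_cat[ch' cv].
  have [h0|h0] := pselect (h = [::]); last exact: (composable_src_inj ch' ch).
  by move: vx; rewrite h0.
split.
  apply: convform_inj => //; first by apply: convformM; apply: L_alg_convform => //; exact: L_alg_Lw.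
  move=> z w; have [nz|nz] := pselect (cf (d (Lw R y h)) z w = 0).
    rewrite nz; have [[v wv vy]|nv] := pselect (exists2 v, w = h ++ v & word_range z v = y).
      by rewrite wv cf_LwM_cat// cfT -wv nz.
    by rewrite cf_LwM0.
  have [zy wx] := d_Lw_supp dd nd ch nz; rewrite zy in nz *.
  have [w' ww'] := supp _ nz.
  have cw : composable y (h ++ w') by rewrite -ww'; apply: contrapT => nc; apply: nz; rewrite cf_ncomp.
  rewrite ww' cf_LwM_cat ?cfT//.
  move: cw => /composable_cat[ch' cv].
  have [h0|h0] := pselect (h = [::]); last exact: (composable_src_inj ch' ch).
  by move: wx; rewrite ww' h0.
move=> yx; have h0 : h = [::].
  by apply/size0nil/eqP; rewrite -leqn0 hs; apply: (nmin [::]).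
apply: convform_inj; [exact: L_alg_convform|exact: convform0|].
move=> z v; rewrite cfT h0 -[Lw R y _]/(L_vertex R y) nd.
by rewrite !cf0.
Qed.

(** Let g lead from x to the source of e, and let [hs], [hr] be the words dividing at the source and
    the range of e. As d vanishes on the closed words [hs] g and [hr] e g, the first gives d(L_g),
    and the second gives the claim once the factors at both ends are cancelled. *)
Lemma scc_step d x : der d -> normalized d -> (forall u q, clx x u -> Dx d x u q = 0) ->
  exists T : V -> bop R P, [/\ forall y, L (T y) /\ closed_at (T y) y, T x = 0 &
    forall e, reach x (src e) -> reach (rng e) x ->
      d (L_edge R e) = L_edge R e * T (src e) - T (rng e) * L_edge R e].
Proof.
move=> dd nd Dx0.
have L0 : L (0 : bop R P) by case: (@L_alg_sub R G).
have /choice[T hT] y : exists T, [/\ L T, closed_at T y, y = x -> T = 0 & reach x y -> reach y x ->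
    exists u, [/\ composable y (u : seq E), word_range y u = x & d (Lw R y u) = Lw R y u * T]].
  have [[xy yx]|n] := pselect (reach x y /\ reach y x).
    have [T [u [h1 h2 h3 h4 [h5 h6]]]] := quotient_at dd nd Dx0 xy yx.
    by exists T; split=> // _ _; exists u.
  exists 0; split=> //; first exact: closed_at0.
  by move=> xy yx; case: n.
exists T; split; first by move=> y; case: (hT y).
  by case: (hT x) => _ _ ->.
move=> e xs rx.
have sr : reach (src e) (rng e) by apply: rt_step; exists e.
have xr : reach x (rng e) by exact: rt_trans xs sr.
have sx : reach (src e) x by exact: rt_trans sr rx.
have [LTs cTs _ /(_ xs sx)[hs [chs hsx dhs]]] := hT (src e).
have [LTr cTr _ /(_ xr rx)[hr [chr hrx dhr]]] := hT (rng e).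
have /reachP[g [cg gs]] := xs.
set Es := L_edge R e; set Ga := Lw R x g.
have AG : A Ga by exact: A_Lw.
have AE : A Es by exact: A_edge.
have Dzero w : composable x (w : seq E) -> word_range x (w : seq E) = x -> d (Lw R x w) = 0.
  move=> cw wx; have Aw := @A_Lw R G x w.
  apply: convform_inj; [exact: d_conv|exact: convform0|move=> z v].
  rewrite cf0; apply: contrapT => nz; have [zx _] := d_Lw_supp dd nd cw nz.
  by apply: nz; rewrite zx; exact: (Dx0 w v).
have LE : L Es by exact: L_alg_edge.
have LG : L Ga by exact: A_L.
have LdG : L (d Ga) by exact: der_L.
have LdE : L (d Es) by exact: der_L.
have cXE : composable (src e) [:: e] by [].
have rE : L_vertex R (rng e) * Es = Es by rewrite /Es -Lw_edge; exact: esym (vertex_Lw R cXE).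
have Es_ : Es * L_vertex R (src e) = Es by rewrite /Es -Lw_edge; exact: esym (Lw_vertex R cXE).
have sTs : L_vertex R (src e) * T (src e) = T (src e).
  by rewrite (closed_at_vertexM _ LTs cTs); case: pselect.
have Tss : T (src e) * L_vertex R (src e) = T (src e).
  by rewrite (closed_at_Mvertex _ LTs cTs); case: pselect.
have rTr : L_vertex R (rng e) * T (rng e) = T (rng e).
  by rewrite (closed_at_vertexM _ LTr cTr); case: pselect.
have sG : L_vertex R (src e) * Ga = Ga by rewrite -gs -vertex_Lw.
have rangeM y Z z v : convform Z -> L_vertex R y * Z = Z -> cf Z z v <> 0 -> word_range z v = y.
  by move=> cZ <-; rewrite cf_vertexM//; case: pselect.
have srcM y Z z v : convform Z -> Z * L_vertex R y = Z -> cf Z z v <> 0 -> z = y.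
  by move=> cZ <-; rewrite cf_Mvertex//; case: pselect.
have dG : d Ga = - (T (src e) * Ga).
  apply/eqP; rewrite -addr_eq0 addrC; apply/eqP.
  have LZ : L (T (src e) * Ga + d Ga) by apply: L_alg_D => //; exact: L_alg_M.
  apply: (@left_cancel (src e) hs) => //; first exact: L_alg_convform.
    move=> z v; apply: rangeM; first exact: L_alg_convform.
    by rewrite mulrDr mulrA sTs -d_vertexM// sG.
  have : d (Lw R x (hs ++ g)) = 0.
    by apply: Dzero; rewrite ?word_range_cat ?gs// composable_cat gs.
  rewrite d_Lw_cat//; last by rewrite composable_cat gs.
  by rewrite gs dhs -mulrA mulrDr.
(* The defect of the claimed equation; the closed word [hr] e g says that it vanishes between the
   factors of [hr] and g. *)
pose Y := T (rng e) * Es + d Es - Es * T (src e).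
have LY : L Y by apply: L_alg_B; [apply: L_alg_D => //|]; exact: L_alg_M.
have cY := L_alg_convform LY.
have rY : L_vertex R (rng e) * Y = Y.
  by rewrite /Y mulrBr mulrDr !mulrA rTr rE -d_vertexM// rE.
have Ys : Y * L_vertex R (src e) = Y.
  by rewrite /Y mulrBl mulrDl -!mulrA Es_ Tss -d_Mvertex// Es_.
suff Y0 : Y = 0.
  apply/eqP; rewrite eq_sym subr_eq eq_sym -subr_eq0 [d Es + _]addrC.
  by apply/eqP; exact: Y0.
apply: (@right_cancel x g) => //.
  by move=> z v; rewrite gs; apply: srcM.
have LYG : L (Y * Ga) by exact: L_alg_M.
apply: (@left_cancel (rng e) hr) => //; first exact: L_alg_convform.
  by move=> z v; apply: rangeM; [exact: L_alg_convform|rewrite mulrA rY].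
have : d (Lw R x (hr ++ e :: g)) = 0.
  by apply: Dzero; rewrite ?word_range_cat// composable_cat /=.
rewrite d_Lw_cat//; last by rewrite composable_cat /=.
rewrite -[Lw R x (e :: g)]/(Es * Ga) -[word_range x (e :: g)]/(rng e) dhr (derM dd AE AG) dG => <-.
rewrite /Y mulrBl mulrDl !mulrDr !mulrN !mulrA.
by rewrite addrA.
Qed.
End SCC.

(** * Edges on no directed cycle *)

Section Star.
Variables (G : digraph).
Notation V := (vertex G).
Notation E := (edge G).
Notation E' := ({classic E}).
Implicit Types (x y z : V) (e f : E) (u v w q : seq E').

Definition noncycle e := ~ reach (rng e) (src e).
Definition cyclic y := exists2 e, src e = y & reach (rng e) y.
Definition scc y z := reach y z /\ reach z y.
Definition adjacent_off e x y := exists2 f, f <> e & src f = x /\ rng f = y.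
Definition linked_off e := clos_refl_sym_trans _ (adjacent_off e).
(* Apart from e, the edges at the strong component of y form a circle when y is cyclic. *)
Definition pendant e y := forall z, scc y z -> forall f f', f <> e -> f' <> e ->
  (src f = z -> src f' = z -> f = f') /\ (rng f = z -> rng f' = z -> f = f').
Definition star e := [/\ ~ linked_off e (src e) (rng e),
  ~ (cyclic (src e) /\ cyclic (rng e)),
  cyclic (src e) -> pendant e (src e) & cyclic (rng e) -> pendant e (rng e)].

Lemma reach_edge e : reach (src e) (rng e).
Proof. by apply: rt_step; exists e. Qed.
Lemma reach_trans x y z : reach x y -> reach y z -> reach x z.
Proof. exact: rt_trans. Qed.
Lemma scc_refl x : scc x x. Proof. by split; exact: rt_refl. Qed.
Lemma scc_sym x y : scc x y -> scc y x. Proof. by case. Qed.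
Lemma scc_trans x y z : scc x y -> scc y z -> scc x z.
Proof. by move=> [h1 h2] [h3 h4]; split; [exact: reach_trans h1 h3|exact: reach_trans h4 h2]. Qed.

Lemma reach_word x w : composable x (w : seq E) -> reach x (word_range x (w : seq E)).
Proof. by move=> c; apply/reachP; exists w. Qed.

Lemma closed_word_edge x w1 e w2 : clx x (w1 ++ (e : E') :: w2) ->
  reach x (src e) /\ reach (rng e) x.
Proof.
move=> [/composable_cat[c1 [se c2]]]; rewrite word_range_cat /= => h; split.
  by rewrite se; exact: reach_word.
by have := reach_word c1; rewrite /= h.
Qed.

Lemma closed_cyclic x w : clx x w -> w <> [::] -> cyclic x.
Proof.
case/lastP: w => [//|w e] [c wr] _; move: c wr; rewrite -cats1 => /composable_cat[cw [/= se _]].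
by rewrite word_range_cat /= => wr; exists e => //; rewrite -[X in reach _ X]wr; exact: reach_word.
Qed.

Lemma cyclic_closed x : cyclic x -> exists2 w, clx x w & w <> [::].
Proof.
move=> [e se /reachP[w [cw wx]]]; exists (w ++ [:: e : E']); last by case: (w).
by split; rewrite ?word_range_cat//; apply/composable_cat.
Qed.

Lemma cyclic_in y : cyclic y -> exists2 e, rng e = y & reach y (src e).
Proof.
move=> /cyclic_closed[[|e w] // [[/= se cw] ry] _]; exists e => //.
by rewrite se; exact: reach_word.
Qed.

Lemma scc_edge x y : scc x y -> x <> y -> cyclic x.
Proof.
move=> [/reachP[w [cw wy]] yx] xy.
case/lastP: w cw wy => [//|w e]; rewrite -cats1 => /composable_cat[cw [/= se _]].
rewrite word_range_cat /= => wy; exists e => //; apply: reach_trans yx.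
by rewrite -[X in reach _ X]wy; exact: reach_word.
Qed.

Lemma scc_cyclic x y : cyclic x -> scc x y -> cyclic y.
Proof.
move=> cx sxy; have [<-//|xy] := pselect (x = y).
by apply: (scc_edge (scc_sym sxy)) => // yx; apply: xy.
Qed.

(* In-edges within the component are unique, so closed words are determined by their length. *)
Lemma pendant_compare e x u w : noncycle e -> pendant e x -> clx x u -> clx x w ->
  (size u <= size w)%N -> exists w', w = u ++ w'.
Proof.
move=> ne pe cu cw uw.
suff h n : (n <= size u)%N -> take n u = take n w.
  by exists (drop (size u) w); rewrite -{1}(take_size u) h// cat_take_drop.
elim: n => [|n IH] nu; first by rewrite !take0.
have [e1 [u2 uE]] : exists e1 u2, drop n u = e1 :: u2.
  by case E1 : (drop n u) => [|e1 u2]; [have := size_drop n u; rewrite E1 /=; lia|exists e1, u2].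
have [e2 [w2 wE]] : exists e1 u2, drop n w = e1 :: u2.
  by case E1 : (drop n w) => [|e3 u3]; [have := size_drop n w; rewrite E1 /=; lia|exists e3, u3].
have uE' : u = take n u ++ e1 :: u2 by rewrite -uE cat_take_drop.
have wE' : w = take n w ++ e2 :: w2 by rewrite -wE cat_take_drop.
have IH' := IH (ltnW nu).
rewrite uE' in cu; rewrite wE' -IH' in cw.
have [a1 b1] := closed_word_edge cu; have [a2 b2] := closed_word_edge cw.
have rr : rng e1 = rng e2.
  case/lastP: (take n u) cu cw => [[_ /= ->] [_ /= ->]//|t g].
  rewrite -!cats1 -!catA => -[/composable_cat[_ [/= g1 _]] _] [/composable_cat[_ [/= g2 _]] _].
  by rewrite -g1 g2.
have n1 f : reach x (src f) -> reach (rng f) x -> f <> e.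
  move=> h1 h2 fe; apply: ne; rewrite -fe; exact: reach_trans h2 h1.
have s1 : scc x (rng e1) by split=> //; apply: reach_trans a1 (reach_edge _).
have [_ /(_ erefl (esym rr)) e12] := pe _ s1 e1 e2 (n1 _ a1 b1) (n1 _ a2 b2).
have st : size (take n u) = n by rewrite size_takel// ltnW.
have tk (t : seq E') (g : E') r : size t = n -> take n.+1 (t ++ g :: r) = t ++ [:: g].
  by move=> tn; rewrite -cat1s catA take_size_cat// size_cat addn1 tn.
by rewrite {1}uE' {1}wE' -IH' !tk// e12.
Qed.

(** By [pendant_compare] closed words at x are comparable as prefixes, so there is only one first
    return. *)
Lemma pendant_powers e x u w : noncycle e -> pendant e x -> first_return (clx x) u -> clx x w ->
  exists a, w = pw u a.
Proof.
move=> ne pe fu; have [cu u0 Fu] := fu.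
have [n nw] := ubnP (size w); elim: n w nw => // n IH w nw cw.
have [->|/eqP w0] := eqVneq w [::]; first by exists 0%N.
have [q [s [ws fq cs]]] := first_return_split (@clx0 _ x) (@clx_l _ x) cw w0.
have [cq q0 Fq] := fq.
have uq : u = q.
  have [uq|uq] := leqP (size u) (size q).
    by have [r qr] := pendant_compare ne pe cu cq uq; have [//|r0] := Fq _ _ qr cu; rewrite qr r0 cats0.
  by have [r ur] := pendant_compare ne pe cq cu (ltnW uq); have [//|r0] := Fu _ _ ur cq; rewrite ur r0 cats0.
have [|a sa] := IH s _ cs.
  by move: nw; rewrite ws size_cat; case: (q) q0 => //= *; lia.
by exists a.+1; rewrite ws sa uq.
Qed.

Lemma cyclic_first_return x : cyclic x -> exists u, first_return (clx x) u.
Proof.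
move=> /cyclic_closed[w cw w0].
by have [p [s [_ fp _]]] := first_return_split (@clx0 _ x) (@clx_l _ x) cw w0; exists p.
Qed.

Lemma linked_off_word e x w : composable x (w : seq E) -> ~ (exists w1 w2, w = w1 ++ (e : E') :: w2) ->
  linked_off e x (word_range x (w : seq E)).
Proof.
elim: w => [|f w IH] /=; first by move=> _ _; exact: rst_refl.
move=> [sf cw] nw; apply: rst_trans (IH cw _) _.
  by move=> [w1 [w2 ww]]; apply: nw; exists (f :: w1), w2; rewrite ww.
apply: rst_step; exists f => // fe; apply: nw; exists [::], w; by rewrite fe.
Qed.

(** A path between the ends of a bridge has to cross it. The paths in the support of delta(L_e) are
    of this kind, so this determines the shape of its symbol. *)
Lemma bridge_parallel e w : ~ linked_off e (src e) (rng e) -> composable (src e) (w : seq E) ->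
  word_range (src e) (w : seq E) = rng e ->
  exists w1 w2, [/\ w = w1 ++ (e : E') :: w2, clx (rng e) w1 & clx (src e) w2].
Proof.
move=> br cw wr.
have [[w1 [w2 ww]]|nw] := pselect (exists w1 w2, w = w1 ++ (e : E') :: w2); last first.
  by case: br; rewrite -wr; exact: linked_off_word.
move: cw wr; rewrite ww => /composable_cat[c1 [/= s2 c2]]; rewrite word_range_cat /= => wr.
by exists w1, w2.
Qed.

Lemma noncyclic_closed x w : ~ cyclic x -> clx x w -> w = [::].
Proof. by move=> nx cw; apply: contrapT => w0; apply: nx; exact: closed_cyclic w0. Qed.

End Star.

(** * Circles attached to an edge *)

Lemma sum_supported (T : nmodType) (I : eqType) (F : I -> T) (s t : seq I) : uniq s -> uniq t ->
  {subset t <= s} -> (forall i, i \in s -> i \notin t -> F i = 0) -> \sum_(i <- s) F i = \sum_(i <- t) F i.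
Proof.
move=> us ut ts F0; rewrite (bigID (fun i => i \in t))/= [X in _ + X]big_seq_cond [X in _ + X]big1 ?addr0; last first.
  by move=> i /andP[/F0 h /h].
rewrite -big_filter; apply: perm_big; apply: uniq_perm => //; first by rewrite filter_uniq.
by move=> i; rewrite mem_filter; case: (boolP (i \in t)) => //= /ts ->.
Qed.

Section Pendant.
Variables (R : realType) (G : digraph).
Hypothesis finG : finite_graph G.
Notation V := (vertex G).
Notation E := (edge G).
Notation E' := ({classic E}).
Notation P := (dpath G).
Notation A := (A_alg G R).
Notation L := (L_alg G R).
Implicit Types (S T X Y Z : bop R P) (x y z : V) (e f : E) (u v w q : seq E') (p : P).
Implicit Types (d : bop R P -> bop R P).

Lemma at_sum_le (g : ell2 R P) (I : eqType) (s : seq I) (y : I -> V) (w : I -> seq E') : uniq s ->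
  {in s &, forall i j, y i = y j -> w i = w j -> i = j} ->
  \sum_(i <- s) nc (at_ g (y i) (w i)) ^+ 2 <= ell2_norm g ^+ 2.
Proof.
move=> us inj.
pose h i : P := if pselect (composable (y i) (w i : seq E)) is left c then DPath c else vpath (y i).
rewrite (bigID (fun i => `[< composable (y i) (w i : seq E) >]))/= [X in _ + X]big1 ?addr0; last first.
  by move=> i /asboolP c; rewrite at_ncomp// nc0 expr0n.
rewrite -big_filter; set s' := seq.filter _ _.
have hs' i : i \in s' -> composable (y i) (w i : seq E) /\ i \in s.
  by rewrite mem_filter => /andP[/asboolP].
have hE i : i \in s' -> path_src (h i) = y i /\ path_edges (h i) = w i.
  by move=> /hs'[c _]; rewrite /h; case: pselect.
have hi : {in s' &, injective h}.
  move=> i j si sj hij; have [h1 h2] := hE i si; have [h3 h4] := hE j sj.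
  apply: inj; first by case: (hs' _ si).
  - by case: (hs' _ sj).
  - by rewrite -h1 hij h3.
  - by rewrite -[w i]h2 hij h4.
apply: (@le_trans _ _ (\sum_(p <- map h s') nc (g p) ^+ 2)); last first.
  by apply: ell2_norm_sum; rewrite map_inj_in_uniq// filter_uniq.
rewrite big_map big_seq [leRHS]big_seq; apply: ler_sum => i si.
by have [h1 h2] := hE i si; rewrite -(at_path g (h i)) h1 h2.
Qed.

Lemma L_edgeM e T x : L T -> closed_at T x ->
  L_edge R e * T = if pselect (x = src e) then L_edge R e * T else 0.
Proof.
move=> LT hT; case: pselect => //= h.
rewrite -Lw_edge (Lw_vertex R (w := [:: e]) (conj erefl Logic.I)) -mulrA (closed_at_vertexM _ LT hT).
by case: pselect => //= _; rewrite mulr0.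
Qed.

Lemma M_L_edge e T x : L T -> closed_at T x ->
  T * L_edge R e = if pselect (x = rng e) then T * L_edge R e else 0.
Proof.
move=> LT hT; case: pselect => //= h.
rewrite -Lw_edge (vertex_Lw R (w := [:: e]) (conj erefl Logic.I)) mulrA (closed_at_Mvertex _ LT hT).
by case: pselect => //= _; rewrite mul0r.
Qed.

Definition gauge_family (T : V -> bop R P) := forall y, L (T y) /\ closed_at (T y) y.
Definition solves d (T : V -> bop R P) e := d (L_edge R e) = L_edge R e * T (src e) - T (rng e) * L_edge R e.

(** The member at x is prescribed, since at an attached edge e it is dictated by delta(L_e), while
    [scc_step] alone would put 0 there. *)
Lemma scc_family d x T : der d -> normalized d -> L T -> closed_at T x ->
  (forall u q, clx x u -> Dx (der_sub d T) x u q = 0) ->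
  exists F, [/\ gauge_family F, F x = T & forall e, reach x (src e) -> reach (rng e) x -> solves d F e].
Proof.
move=> dd nd LT hT D0.
have nd' := normalized_sub dd nd LT hT; have dd' := der_der_sub finG dd LT.
have [F [hF Fx sF]] := scc_step finG dd' nd' D0.
have L0 : L (0 : bop R P) by case: (@L_alg_sub R G).
exists (fun y => F y + if pselect (y = x) then T else 0); split.
- move=> y; have [LF cF] := hF y; case: pselect => [yx|yx] /=; last by rewrite addr0.
  by split; [exact: L_alg_D|apply: closed_atD => //; rewrite yx].
- by rewrite Fx add0r; case: pselect.
- move=> e h1 h2; rewrite /solves.
  have := sF e h1 h2; rewrite /der_sub => /eqP; rewrite subr_eq => /eqP ->.
  rewrite mulrDr mulrDl opprD addrACA; congr (_ + (_ - _)).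
    rewrite (L_edgeM e LT hT).
    case: (pselect (src e = x)) => h; case: (pselect (x = src e)) => h' /=; rewrite ?mulr0//.
      by case: h'.
    by case: h.
  rewrite (M_L_edge e LT hT).
  case: (pselect (rng e = x)) => h; case: (pselect (x = rng e)) => h' /=; rewrite ?mul0r//.
    by case: h'.
  by case: h.
Qed.

(** All closed words at x are powers of one first return u, and D u vanishes on them by [D_pw]. This
    leaves the choice of T at x free to serve the attached edge. *)
Lemma pendant_Dx0 d x e : der d -> normalized d -> noncycle e -> pendant e x ->
  forall u q, clx x u -> Dx d x u q = 0.
Proof.
move=> dd nd ne pe.
have [M hM] := Dx_bd dd x.
have h1 := @clx0 _ x; have h2 := @clxM _ x; have h3 := @clx_l _ x.
have h5 := Dx_out dd nd (x := x); have h6 := Dx_cat dd nd (x := x).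
have all0 := @D_all_eq0 E' (clx x) h1 h3 R _ h6.
move=> u q cu; apply: all0 => // u' q' fu'.
have [cq|cq] := pselect (clx x q'); last by apply: h5 => //; case: fu'.
have [a ->] := pendant_powers ne pe fu' cq.
by apply: (@D_pw E' (clx x) h1 h2 R _ M h6 hM); case: fu'.
Qed.

Lemma pendant_sub_Dx0 d x e T : der d -> normalized d -> noncycle e -> pendant e x ->
  L T -> closed_at T x -> forall u q, clx x u -> Dx (der_sub d T) x u q = 0.
Proof.
move=> dd nd ne pe LT hT u q cu.
exact: (pendant_Dx0 (der_der_sub finG dd LT) (normalized_sub dd nd LT hT) ne pe).
Qed.

Lemma d_edge_supp d e y w : der d -> normalized d -> cf (d (L_edge R e)) y w <> 0 ->
  [/\ y = src e, composable (src e) (w : seq E) & word_range (src e) (w : seq E) = rng e].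
Proof.
move=> dd nd nz; have c1 : composable (src e) [:: e] by [].
move: (nz); rewrite -Lw_edge => /(d_Lw_supp dd nd c1)[yE wE].
split=> //; rewrite -yE; apply: contrapT => nc; by apply: nz; rewrite cf_ncomp.
Qed.

(** The range of e is on no cycle, so the words in delta(L_e) are e w with w closed, and e is
    divided out on the left. *)
Lemma source_pendant d e : der d -> normalized d -> star e -> cyclic (src e) ->
  exists T, [/\ L T, closed_at T (src e) & d (L_edge R e) = L_edge R e * T].
Proof.
move=> dd nd [br nb _ _] cs.
have nr : ~ cyclic (rng e) by move=> cr; apply: nb.
have sr : src e <> rng e by move=> E; apply: nr; rewrite -E.
have LE : L (d (L_edge R e)) by apply: der_L => //; exact: A_edge.
have supp y w : cf (d (L_edge R e)) y w <> 0 -> y = src e /\ exists2 w2, w = (e : E') :: w2 & clx (src e) w2.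
  move=> /(d_edge_supp dd nd)[-> cw wr]; split=> //.
  have [w1 [w2 [-> c1 c2]]] := bridge_parallel br cw wr.
  by rewrite (noncyclic_closed nr c1); exists w2.
have [|T [LT cfT]] := @left_quotient R G finG _ [:: e] LE.
  move=> [|f u1] u2 y uE u20; first by apply: contrapT => /(supp y)[_ [w2]].
  by case: uE => _; case: (u1) => //= u2E; case: u20.
have hT : closed_at T (src e).
  by move=> y w; rewrite cfT => /(supp y)[-> [w2 [->] [c w2r]]].
exists T; split=> //; apply: convform_inj.
- exact: L_alg_convform.
- by apply: L_alg_convform; apply: L_alg_M => //; exact: L_alg_edge.
- move=> y w; rewrite -[in RHS]Lw_edge.
  have [[w2 wE w2r]|nw] := pselect (exists2 w2, w = [:: e] ++ w2 & word_range y w2 = src e).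
    by rewrite wE cf_LwM_cat// cfT.
  rewrite cf_LwM0//; apply: contrapT => /(supp y)[yE [w2 wE [_ cw2]]].
  by apply: nw; exists w2; rewrite ?yE.
Qed.

Section Range.
Variables (d : bop R P -> bop R P) (e : E) (u : seq E').
Hypotheses (dd : der d) (nd : normalized d) (ne : noncycle e) (se : star e).
Notation x := (rng e).
Hypotheses (cr : cyclic x) (fu : first_return (clx x) u).

(** Up to sign, the coefficient at u^b of the T sought. Here e stands on the right, where division
    gives no bound. *)
Definition rcoef b := cf (d (L_edge R e)) (src e) (pw u b ++ [:: e : E']).

Let cu : clx x u. Proof. by case: fu. Qed.
Let cpw b : clx x (pw u b). Proof. exact: (cl_pw (@clx0 _ x) (@clxM _ x)). Qed.
Let u1 : (0 < size u)%N. Proof. by case: fu => _; case: (u). Qed.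
Let nsrc : ~ cyclic (src e). Proof. by move=> cs; case: se => _ h _ _; apply: h. Qed.
Let pe : pendant e x. Proof. by case: se => _ _ _ /(_ cr). Qed.

Lemma e_notin_u w1 w2 : u <> w1 ++ (e : E') :: w2.
Proof.
move=> uE; have := cu; rewrite uE => /closed_word_edge[xs rx]; apply: ne; exact: xs.
Qed.

Lemma e_not_pw b w1 w2 : (e : E') :: w1 <> pw u b.+1 ++ w2.
Proof.
rewrite pwS; case uE : (u) => [|g t]; first by move: u1; rewrite uE.
by move=> [eg _]; apply: (@e_notin_u [::] t); rewrite uE eg.
Qed.

Lemma pw_e_inj b b' w w' : pw u b ++ (e : E') :: w = pw u b' ++ (e : E') :: w' -> b = b'.
Proof.
elim: b b' => [|b IH] [|b']//; first by move=> h; case: (@e_not_pw b' w _ h).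
  by move=> /esym h; case: (@e_not_pw b w' _ h).
by rewrite !pwS -!catA => /(@cat_injl E') /IH ->.
Qed.

Lemma d_edge_supp_range y w : cf (d (L_edge R e)) y w <> 0 ->
  y = src e /\ exists b, w = pw u b ++ [:: e : E'].
Proof.
move=> /(d_edge_supp dd nd)[-> cw wr]; split=> //.
have [br _ _ _] := se.
have [w1 [w2 [-> c1 c2]]] := bridge_parallel br cw wr.
rewrite (noncyclic_closed nsrc c2).
by have [b ->] := pendant_powers ne pe fu c1; exists b.
Qed.

(* delta is applied to the sum of the c_b L_{u^b e}, on which it acts through delta(L_e) alone. *)
Lemma toeplitz_bound : exists2 K : R, 0 <= K & forall N (c : nat -> R[i]),
  \sum_(a <- iota 0 N) nc (\sum_(b <- iota 0 a.+1) rcoef (a - b) * c b) ^+ 2 <=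
    K ^+ 2 * \sum_(a <- iota 0 N) nc (c a) ^+ 2.
Proof.
have [M M0 hM] := d_bound dd; exists M => // N c.
have cpe b : composable (src e) (pw u b ++ [:: e : E']).
  by apply/composable_cat; case: (cpw b).
pose Pn : bop R P := \sum_(b <- iota 0 N) c b *: Lw R (src e) (pw u b ++ [:: e : E']).
have AP : A Pn by apply: A_sum => b; apply: A_Z; exact: A_Lw.
have Dx0 := pendant_Dx0 dd nd ne pe.
have dpw b : d (Lw R x (pw u b)) = 0.
  apply: convform_inj; [by apply: d_conv => //; exact: A_Lw|exact: convform0|move=> z v].
  rewrite cf0; apply: contrapT => nz; have [zx _] := d_Lw_supp dd nd (proj1 (cpw b)) nz.
  by apply: nz; rewrite zx; exact: (Dx0 _ v (cpw b)).
have dPn : d Pn = \sum_(b <- iota 0 N) c b *: (Lw R x (pw u b) * d (L_edge R e)).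
  rewrite der_sum//; last by move=> b; apply: A_Z; exact: A_Lw.
  apply: eq_bigr => b _; rewrite derZ//; last exact: A_Lw.
  by rewrite d_Lw_cat// -[word_range (src e) [:: e]]/x dpw mul0r add0r Lw_edge.
have cfdP a : (a < N)%N -> cf (d Pn) (src e) (pw u a ++ [:: e : E']) =
    \sum_(b <- iota 0 a.+1) rcoef (a - b) * c b.
  move=> aN; rewrite dPn cf_sum.
  (* For b > a the word u^a e does not begin with u^b, because e does not occur in u. *)
  transitivity (\sum_(b <- iota 0 a.+1) cf (c b *: (Lw R x (pw u b) * d (L_edge R e))) (src e) (pw u a ++ [:: e : E'])).
    apply: sum_supported; try exact: iota_uniq.
      by move=> i; rewrite !mem_iota; lia.
    move=> b _; rewrite mem_iota add0n -leqNgt => ab; rewrite cfZ cf_LwM0 ?mulr0// => -[v].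
    have -> : b = (a + (b - a).-1.+1)%N by lia.
    by rewrite pwD -catA => /(@cat_injl E') h; case: (e_not_pw h).
  rewrite big_seq [RHS]big_seq; apply: eq_bigr => b; rewrite mem_iota add0n => /andP[_ ba].
  have -> : pw u a ++ [:: e : E'] = pw u b ++ (pw u (a - b) ++ [:: e : E']).
    by rewrite catA -pwD; congr (pw u _ ++ _); lia.
  rewrite cfZ mulrC; congr (_ * _); rewrite cf_LwM_cat; first by rewrite /rcoef.
    exact: (proj1 (cpw b)).
  by rewrite word_range_cat; exact: (proj2 (cpw (a - b))).
apply: (@le_trans _ _ (ell2_norm (d Pn (one_ R (src e))) ^+ 2)).
  apply: le_trans (at_sum_le (d Pn (one_ R (src e))) (s := iota 0 N) (y := fun=> src e) (w := fun a => pw u a ++ [:: e : E']) (iota_uniq _ _) _).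
    rewrite big_seq [leRHS]big_seq; apply: ler_sum => a; rewrite mem_iota => /andP[_ aN].
    by rewrite -cfE cfdP.
  by move=> a a' _ _ _ /pw_e_inj.
have -> : M ^+ 2 * \sum_(a <- iota 0 N) nc (c a) ^+ 2 = (M * Num.sqrt (\sum_(a <- iota 0 N) nc (c a) ^+ 2)) ^+ 2.
  by rewrite exprMn sqr_sqrtr// sumr_ge0// => *; rewrite sqr_ge0.
set B := Num.sqrt _.
have B0 : 0 <= B by exact: sqrtr_ge0.
rewrite ler_sqr ?nnegrE ?ell2_norm_ge0 ?mulr_ge0//.
apply: le_trans (opnormP _ _) _; apply: (@le_trans _ _ (opnorm (d Pn))).
  by rewrite -[leRHS]mulr1 ler_wpM2l ?opnorm_ge0// ell2_norm_basis.
apply: le_trans (hM _ AP) _; rewrite ler_wpM2l//.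
have cP : convform Pn by apply: L_alg_convform; exact: A_L.
have cfP y w : cf Pn y w = \sum_(b <- iota 0 N) c b * (`[< y = src e /\ w = pw u b ++ [:: e : E'] >])%:R.
  by rewrite cf_sum; apply: eq_bigr => b _; rewrite cfZ cf_Lw.
have cfP_supp p : val_ (cf Pn) p != 0 -> exists b, path_edges p = pw u b ++ [:: e : E'].
  move=> nz; apply: contrapT => nb; move/negP: nz; apply; apply/eqP; rewrite /val_ cfP big1// => b _.
  by rewrite asboolF ?mulr0// => -[_ pE]; apply: nb; exists b.
apply: opnorm_le => // f; apply: ell2_norm_le; first by rewrite mulr_ge0 ?ell2_norm_ge0.
move=> s us; rewrite exprMn.
(* In u^b e the letter e occurs only at the end, so these words are prefix-free and the norm of [Pn]
   is at most B. *)
apply: le_trans (@unique_prefix_bound _ _ (cf Pn) B f s _ _ _ _ us) => //.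
- by apply: ler_sum => p _; rewrite -at_path cP.
- by move=> ? ?; exact: cf_ncomp.
- move=> s' us'; rewrite sqr_sqrtr ?sumr_ge0// => [|*]; last by rewrite sqr_ge0.
  (* Recovers the exponent b of a path u^b e; 0 is a default value. *)
  pose g (p : P) := xget 0%N [set b | (b < N)%N /\ path_src p = src e /\ path_edges p = pw u b ++ [:: e : E']].
  have gP p b : (b < N)%N -> path_src p = src e -> path_edges p = pw u b ++ [:: e : E'] -> g p = b.
    move=> bN h1 h2; rewrite /g; case: xgetP => [b' _ [_ [_]]|/(_ b)[]//].
    by rewrite h2 => /pw_e_inj.
  rewrite (bigID (fun p => `[< exists b, (b < N)%N /\ path_src p = src e /\ path_edges p = pw u b ++ [:: e : E'] >]))/= [X in _ + X]big1 ?addr0.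
    rewrite -big_filter; set s2 := seq.filter _ _.
    have hs2 p : p \in s2 -> exists b, [/\ (b < N)%N, path_src p = src e, path_edges p = pw u b ++ [:: e : E'] & g p = b].
      by rewrite mem_filter => /andP[/asboolP[b [bN [h1 h2]]] _]; exists b; split=> //; exact: gP.
    apply: (@le_trans _ _ (\sum_(p <- s2) nc (c (g p)) ^+ 2)).
      rewrite big_seq [leRHS]big_seq; apply: ler_sum => p /hs2[b [bN h1 h2 h3]].
      rewrite /val_ cfP h1 h2 h3 (bigD1_seq b) ?mem_iota ?iota_uniq//= asboolT// mulr1 big1 ?addr0// => b' bb'.
      by rewrite asboolF ?mulr0// => -[_ /pw_e_inj] bE; rewrite bE eqxx in bb'.
    apply: (@sum_le_inj _ _ _ g (fun b => nc (c b) ^+ 2)).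
    - by move=> b; rewrite sqr_ge0.
    - by rewrite filter_uniq.
    - move=> p p' /hs2[b [_ h1 h2 h3]] /hs2[b' [_ h1' h2' h3']]; rewrite h3 h3' => bb.
      by apply: path_inj; rewrite ?h1 ?h1'// h2 h2' bb.
    - by move=> p /hs2[b [bN _ _ ->]]; rewrite mem_iota.
  move=> p /asboolP np; rewrite /val_ cfP big_seq big1 ?nc0 ?expr0n// => b; rewrite mem_iota => /andP[_ bN].
  by rewrite asboolF ?mulr0// => -[h1 h2]; apply: np; exists b.
- move=> p i j ip jp /cfP_supp[b /= hb] /cfP_supp[b' /= hb'].
  have h1 : path_edges p = pw u b ++ e :: drop i (path_edges p).
    by rewrite -{1}(cat_take_drop i (path_edges p)) hb -catA.
  have h2 : path_edges p = pw u b' ++ e :: drop j (path_edges p).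
    by rewrite -{1}(cat_take_drop j (path_edges p)) hb' -catA.
  have bb : b = b' by apply: (@pw_e_inj b b' (drop i (path_edges p)) (drop j (path_edges p))); rewrite -h1 -h2.
  by rewrite -(size_takel ip) -(size_takel jp) hb hb' bb.
Qed.

End Range.
End Pendant.

Section Pendant.
Variables (R : realType) (G : digraph).
Hypothesis finG : finite_graph G.
Notation V := (vertex G).
Notation E := (edge G).
Notation E' := ({classic E}).
Notation P := (dpath G).
Notation sym := (V -> seq E -> R[i]).
Notation A := (A_alg G R).
Notation L := (L_alg G R).
Implicit Types (S T X Y Z : bop R P) (x y z : V) (e f : E) (u v w q : seq E') (p : P).
Implicit Types (d : bop R P -> bop R P).

Lemma pw_decompose u w : (0 < size u)%N ->
  exists a q, w = pw u a ++ q /\ ~ exists r, q = u ++ r.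
Proof.
move=> u1; have [n nw] := ubnP (size w); elim: n w nw => // n IH w nw.
have [[r wr]|nr] := pselect (exists r, w = u ++ r); last by exists 0%N, w.
have [|a [q [rE nq]]] := IH r; first by move: nw; rewrite wr size_cat; lia.
by exists a.+1, q; rewrite wr rE pwS catA.
Qed.

Lemma pw_decompose_inj u a b q r : ~ (exists s, q = u ++ s) -> ~ (exists s, r = u ++ s) ->
  pw u a ++ q = pw u b ++ r -> a = b /\ q = r.
Proof.
move=> nq nr; elim: a b => [|a IH] [|b].
- by [].
- by rewrite pwS -catA /= => qE; case: nq; exists (pw u b ++ r).
- by rewrite pwS -catA /= => rE; case: nr; exists (pw u a ++ q).
- by rewrite !pwS -!catA => /(@cat_injl E') /IH[-> ->].
Qed.

(* A vector splits along the orbits q, uq, uuq, ... of left translation by u; on each orbit the convolution is the same Toeplitz operator. *)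
Lemma orbit_bound x u (F : nat -> R[i]) (K : R) (t : sym) : first_return (clx x) u -> 0 <= K ->
  (forall N (c : nat -> R[i]),
    \sum_(a <- iota 0 N) nc (\sum_(b <- iota 0 a.+1) F (a - b)%N * c b) ^+ 2 <=
    K ^+ 2 * \sum_(a <- iota 0 N) nc (c a) ^+ 2) ->
  (forall b, t x (pw u b) = F b) -> (forall y w, t y w <> 0 -> y = x /\ exists b, w = pw u b) ->
  forall (g : ell2 R P) s, uniq s ->
  \sum_(p <- s) nc (val_ (cnv t (at_ g)) p) ^+ 2 <= K ^+ 2 * ell2_norm g ^+ 2.
Proof.
move=> fu K0 toep tF tsupp g s us.
have [[cu ux] u0 _] := fu.
have u1 : (0 < size u)%N by case: (u) u0.
have cpw b : clx x (pw u b) by apply: (cl_pw (@clx0 _ x) (@clxM _ x)).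
have /choice[dec hdec] (w : seq E') : exists aq : nat * seq E', w = pw u aq.1 ++ aq.2 /\ ~ exists r, aq.2 = u ++ r.
  by have [a [q h]] := pw_decompose w u1; exists (a, q).
(* A path is u^a q with q not beginning with u: its source and q label the orbit, and [al] is the
   position a on it. *)
pose o (p : P) : {classic V} * seq E' := (path_src p, (dec (path_edges p)).2).
pose al (p : P) := (dec (path_edges p)).1.
pose H (z : ({classic V} * seq E') * nat) : R :=
  nc (\sum_(b <- iota 0 z.2.+1) F (z.2 - b)%N * at_ g z.1.1 (pw u b ++ z.1.2)) ^+ 2.
have key p : nc (val_ (cnv t (at_ g)) p) ^+ 2 <= H (o p, al p).
  have [px|px] := pselect (word_range (path_src p) (path_edges p) = x); last first.
    rewrite conv_path big1 ?nc0 ?expr0n ?sqr_ge0// => i _.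
    have [->|nz] := pselect (val_ t (lpath p i) = 0); first by rewrite mul0r.
    have /= [h1 [b h2]] := tsupp _ _ nz; case: px.
    by rewrite -(cat_take_drop i (path_edges p)) word_range_cat h1 h2; case: (cpw b).
  rewrite le_eqVlt; apply/orP; left; apply/eqP; congr (nc _ ^+ 2).
  have [pE nq] := hdec (path_edges p); rewrite /val_ conv_sum /= -/(al p).
  rewrite -/(al p) in pE; set q := (dec (path_edges p)).2 in pE nq *; set a := al p in pE *.
  have su b : size (pw u b) = (b * size u)%N by exact: size_pw.
  have dropE b : (b <= a)%N -> take (b * size u) (path_edges p) = pw u b /\
      drop (b * size u) (path_edges p) = pw u (a - b) ++ q.
    move=> ba; have -> : path_edges p = pw u b ++ (pw u (a - b) ++ q).
      by rewrite catA -pwD subnKC.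
    by rewrite -(su b) take_size_cat// drop_size_cat.
  have rangeE b : (b <= a)%N -> word_range (path_src p) (pw u b ++ q) = x.
    case: (posnP a) => [a0|a0] ba.
      by move: px; rewrite pE a0; move: ba; rewrite a0 leqn0 => /eqP ->.
    have := Defs.pathP p; rewrite pE => /composable_cat[]; case: (a) a0 => // a' _.
    rewrite pwSr => /composable_cat[_ cu'] _.
    by rewrite word_range_cat -(composable_src_inj cu cu' u0); case: (cpw b).
  rewrite -[0%N :: _]/(iota 0 (size (path_edges p)).+1).
  (* Only the left factors u^b with b <= a contribute: a higher power would make q begin with u. *)
  transitivity (\sum_(i <- [seq (b * size u)%N | b <- iota 0 a.+1]) t (word_range (path_src p) (drop i (path_edges p))) (take i (path_edges p)) * at_ g (path_src p) (drop i (path_edges p))).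
    apply: sum_supported; first exact: iota_uniq.
    - rewrite map_inj_uniq ?iota_uniq// => b b' /eqP; rewrite eqn_pmul2r// => /eqP //.
    - move=> i /mapP[b + ->]; rewrite !mem_iota /= !add0n !ltnS => ba.
      by have := congr1 size pE; rewrite size_cat su => ->; nia.
    - move=> i; rewrite mem_iota add0n ltnS => /andP[_ ip] ni.
      have [->|nz] := pselect (t (word_range (path_src p) (drop i (path_edges p))) (take i (path_edges p)) = 0).
        by rewrite mul0r.
      have [_ [b tb]] := tsupp _ _ nz; case/negP: ni; apply/mapP; exists b; last first.
        by rewrite -su -tb size_takel.
      rewrite mem_iota /= add0n ltnS leqNgt; apply/negP => ab.
      apply: nq; exists (pw u (b - a).-1 ++ drop i (path_edges p)).
      have := cat_take_drop i (path_edges p); rewrite {3}pE tb.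
      have -> : b = (a + (b - a).-1.+1)%N by lia.
      rewrite pwD -catA => /(@cat_injl E') <-; rewrite pwS -catA.
      by congr (_ ++ (pw u _ ++ _)); lia.
  rewrite big_map.
  transitivity (\sum_(b <- iota 0 a.+1) F b * at_ g (path_src p) (pw u (a - b) ++ q)).
    rewrite big_seq [RHS]big_seq; apply: eq_bigr => b; rewrite mem_iota add0n ltnS => /andP[_ ba].
    by have [-> ->] := dropE b ba; rewrite rangeE ?leq_subr// tF.
  rewrite (perm_big [seq (a - b)%N | b <- iota 0 a.+1]).
    rewrite big_map big_seq [RHS]big_seq; apply: eq_bigr => b; rewrite mem_iota add0n ltnS => /andP[_ ba].
    by rewrite subKn.
  apply: uniq_perm; first exact: iota_uniq.
    rewrite map_inj_in_uniq ?iota_uniq// => b b'; rewrite !mem_iota; lia.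
  move=> b; rewrite mem_iota; apply/idP/mapP => [bm|[b' + ->]]; last by rewrite mem_iota; lia.
  by exists (a - b)%N; rewrite ?mem_iota; lia.
pose O := undup (map o s); pose N := (\sum_(p <- s) al p).+1.
apply: (@le_trans _ _ (\sum_(p <- s) H (o p, al p))); first by apply: ler_sum => p _; exact: key.
apply: (@le_trans _ _ (\sum_(z <- [seq (o', a) | o' <- O, a <- iota 0 N]) H z)).
  apply: (@sum_le_inj _ _ _ (fun p => (o p, al p))) => //.
  - by move=> z; rewrite sqr_ge0.
  - move=> p p' _ _ [e1 e2 e3]; apply: path_inj => //.
    have [-> _] := hdec (path_edges p); have [-> _] := hdec (path_edges p').
    have e3' : (dec (path_edges p)).1 = (dec (path_edges p')).1 := e3.
    by rewrite e2 e3'.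
  - move=> p ps; apply: allpairs_f; first by rewrite mem_undup map_f.
    rewrite mem_iota add0n leq0n /N ltnS -[X in (X <= _)%N]/(al p).
    by rewrite (perm_big _ (perm_to_rem ps)) big_cons leq_addr.
rewrite big_allpairs.
apply: (@le_trans _ _ (\sum_(o' <- O) K ^+ 2 * \sum_(a <- iota 0 N) nc (at_ g o'.1 (pw u a ++ o'.2)) ^+ 2)).
  by apply: ler_sum => o' _; exact: (toep N (fun b => at_ g o'.1 (pw u b ++ o'.2))).
rewrite -mulr_sumr ler_wpM2l ?sqr_ge0//.
apply: (@le_trans _ _ (\sum_(z <- [seq (o', a) | o' <- O, a <- iota 0 N]) nc (at_ g z.1.1 (pw u z.2 ++ z.1.2)) ^+ 2)).
  by rewrite big_allpairs.
set sz := (X in \sum_(z <- X) _).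
pose yz (z : ({classic V} * seq E') * nat) : V := z.1.1.
pose wz (z : ({classic V} * seq E') * nat) : seq E' := pw u z.2 ++ z.1.2.
have usz : uniq sz.
  by apply: allpairs_uniq; [exact: undup_uniq|exact: iota_uniq|move=> [[y1 q1] a1] [[y2 q2] a2] _ _ /= [-> -> ->]].
have hO o' : o' \in O -> ~ exists r, o'.2 = u ++ r.
  by rewrite mem_undup => /mapP[p _ ->]; case: (hdec (path_edges p)).
apply: (at_sum_le g (s := sz) (y := yz) (w := wz) usz).
move=> [ o1 a1] [ o2 a2] h1 h2; rewrite /yz /wz /=.
have [[ o1' b1] [ho1 _ [-> ->]]] := allpairsP h1; have [[ o2' b2] [ho2 _ [-> ->]]] := allpairsP h2.
move=> /= yy h; have [-> qq] := pw_decompose_inj (hO _ ho1) (hO _ ho2) h.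
by case: (o1') (o2') yy qq => [? ?] [? ?] /= -> ->.
Qed.

Lemma range_pendant d e : der d -> normalized d -> noncycle e -> star e -> cyclic (rng e) ->
  exists T, [/\ L T, closed_at T (rng e) & d (L_edge R e) = - (T * L_edge R e)].
Proof.
move=> dd nd ne se cr; have [u fu] := cyclic_first_return cr.
have [K K0 toep] := toeplitz_bound finG dd nd ne se cr fu.
have cpw b : clx (rng e) (pw u b) by case: fu => cu _ _; apply: (cl_pw (@clx0 _ _) (@clxM _ _)).
pose t : sym := fun y w => if `[< y = rng e /\ exists b, w = pw u b >]
  then cf (d (L_edge R e)) (src e) (w ++ [:: e : E']) else 0.
have st : supp t.
  move=> y w nc; rewrite /t asboolF// => -[yx [b wb]]; apply: nc; rewrite yx wb.
  by case: (cpw b).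
have tF b : t (rng e) (pw u b) = rcoef d e u b by rewrite /t asboolT//; split=> //; exists b.
have tsupp y w : t y w <> 0 -> y = rng e /\ exists b, w = pw u b.
  by rewrite /t; case: asboolP.
have [T [cT cfT _]] := bounded_conv st K0 (orbit_bound fu K0 toep tF tsupp).
have LT : L T by apply/(L_algP _ finG).
exists (- T); split; first exact: L_alg_N.
  move=> y w; rewrite cfN cfT => /eqP; rewrite oppr_eq0 => /eqP /tsupp[-> [b ->]].
  by split=> //; case: (cpw b).
rewrite mulNr opprK; apply: convform_inj.
- by apply: d_conv => //; exact: A_edge.
- by apply: L_alg_convform; apply: L_alg_M => //; exact: L_alg_edge.
- move=> y w; rewrite -[in RHS]Lw_edge; have ce : composable (src e) [:: e] by [].
  have [[yE [b wb]]|nw] := pselect (y = src e /\ exists b, w = pw u b ++ [:: e : E']).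
    rewrite yE wb cf_MLw_cat// cfT -[word_range (src e) [:: e]]/(rng e) tF //.
  rewrite (_ : cf (d (L_edge R e)) y w = 0); last first.
    by apply: contrapT => /(d_edge_supp_range dd nd ne se cr fu)[yE [b wb]]; apply: nw; split=> //; exists b.
  have [[yE [q wq]]|nq] := pselect (y = src e /\ exists q, w = q ++ [:: e : E']); last by rewrite cf_MLw0.
  rewrite yE wq cf_MLw_cat// cfT; apply/esym; apply: contrapT => /tsupp[_ [b qb]].
  by apply: nw; split=> //; exists b; rewrite wq qb.
Qed.

(** A cycle through x already has an edge out of x and an edge into x; if f were not e, [pendant]
    would identify it with one of these, although f is on no cycle. *)
Lemma pendant_unique e f x : noncycle e -> pendant e x -> cyclic x -> noncycle f ->
  src f = x \/ rng f = x -> f = e.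
Proof.
move=> ne pe cx nf h; apply: contrapT => fe.
have sx := scc_refl x.
case: h => h.
  have [g gx rg] := cx.
  have ge : g <> e by move=> ge; apply: ne; rewrite -ge gx.
  have [/(_ h gx) fg _] := pe x sx f g fe ge.
  by apply: nf; rewrite fg gx.
have [g gx rg] := cyclic_in cx.
have ge : g <> e by move=> ge; apply: ne; rewrite -ge gx.
have [_ /(_ h gx) fg] := pe x sx f g fe ge.
by apply: nf; rewrite fg gx.
Qed.

(** * Gluing the corrections of the strong components *)

Hypothesis hstar : forall e : E, noncycle e -> star e.

(** At most one edge off the cycles is attached at x. If there is one, it dictates the member of the
    family at x; otherwise [scc_closed] supplies it. *)
Lemma local_family d x : der d -> normalized d -> exists F : V -> bop R P, [/\ gauge_family F,
  forall e, reach x (src e) -> reach (rng e) x -> solves d F e,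
  forall e, noncycle e -> src e = x -> cyclic x -> d (L_edge R e) = L_edge R e * F x,
  forall e, noncycle e -> rng e = x -> cyclic x -> d (L_edge R e) = - (F x * L_edge R e) &
  ~ cyclic x -> forall y, F y = 0].
Proof.
move=> dd nd.
have [cx|ncx] := pselect (cyclic x); last first.
  exists (fun=> 0); split=> //.
    by move=> y; split; [case: (@L_alg_sub R G)|exact: closed_at0].
  move=> e h1 h2; case: ncx.
  have [ex|ex] := pselect (src e = x); first by exists e.
  apply: (scc_edge (y := src e)); last by move=> E0; apply: ex.
  by split=> //; apply: reach_trans (reach_edge e) h2.
have [[e [ne he]]|none] := pselect (exists e, noncycle e /\ (src e = x \/ rng e = x)); last first.
  have [T [LT cT D0]] := scc_closed finG x dd nd.
  have [F [hF _ sF]] := scc_family finG dd nd LT cT D0.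
  exists F; split=> //.
  - by move=> e ne ex; case: none; exists e; split=> //; left.
  - by move=> e ne ex; case: none; exists e; split=> //; right.
have se := hstar ne.
have pe : pendant e x by case: se => _ _ p1 p2; case: he => he; rewrite -he; [apply: p1|apply: p2]; rewrite he.
have uniq_e f : noncycle f -> src f = x \/ rng f = x -> f = e by move=> nf; exact: pendant_unique ne pe cx nf.
have sr : src e <> rng e by move=> E0; apply: ne; rewrite E0; exact: rt_refl.
case: he => he.
  have [|T [LT cT dE]] := source_pendant finG dd nd se; first by rewrite he.
  rewrite he in cT.
  have D0 := pendant_sub_Dx0 finG dd nd ne pe LT cT.
  have [F [hF Fx sF]] := scc_family finG dd nd LT cT D0.
  exists F; split=> //.
  - by move=> f nf fx _; rewrite (uniq_e f nf (or_introl fx)) Fx.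
  - move=> f nf fx _; have fe := uniq_e f nf (or_intror fx).
    by case: sr; rewrite he -fx fe.
have [|T [LT cT dE]] := range_pendant dd nd ne se; first by rewrite he.
rewrite he in cT.
have D0 := pendant_sub_Dx0 finG dd nd ne pe LT cT.
have [F [hF Fx sF]] := scc_family finG dd nd LT cT D0.
exists F; split=> //.
- move=> f nf fx _; have fe := uniq_e f nf (or_introl fx).
  by case: sr; rewrite he -fx fe.
- by move=> f nf fx _; rewrite (uniq_e f nf (or_intror fx)) Fx.
Qed.

Definition touches y := exists e : E, noncycle e /\ (src e = y \/ rng e = y).

(** Choosing from the class as a set gives all its members the same choice. A vertex with an
    attached edge is preferred, because [local_family] has to be applied there. *)
Lemma representative : exists rep : V -> V, [/\ forall y, scc y (rep y),
  forall y z, scc y z -> rep y = rep z & forall y, touches y -> touches (rep y)].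
Proof.
have /choice[ o ho] (S : set V) : exists o : option V, (exists y, S y) ->
    exists z, [/\ o = Some z, S z & (exists z', S z' /\ touches z') -> touches z].
  have [[z [Sz tz]]|nt] := pselect (exists z, S z /\ touches z).
    by exists (Some z) => _; exists z.
  have [[z Sz]|ns] := pselect (exists z, S z); last by exists None.
  by exists (Some z) => _; exists z; split=> // h; case: nt.
exists (fun y => odflt y (o [set z | scc y z])); split.
- move=> y; have [|z [-> Sz _]//] := ho [set z | scc y z].
  by exists y; exact: scc_refl.
- move=> y z yz.
  have -> : [set t | scc y t] = [set t | scc z t].
    apply/seteqP; split=> t /=; apply: scc_trans => //; exact: scc_sym.
  have [|t [-> _ _]//] := ho [set t | scc z t].
  by exists z; exact: scc_refl.
- move=> y ty; have [|z [-> _ /= h]] := ho [set z | scc y z]; first by exists y; exact: scc_refl.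
  by apply: h; exists y; split=> //; exact: scc_refl.
Qed.

(** Each strong component uses the family of its representative. An edge off the cycles with one end
    on a cycle is solved too, as that end is the representative and the operator at the other end is
    0. Only edges between two vertices on no cycle can be left. *)
Lemma glued_family d : der d -> normalized d -> exists T : V -> bop R P, gauge_family T /\
  forall e, ~ solves d T e -> [/\ noncycle e, ~ cyclic (src e), ~ cyclic (rng e), T (src e) = 0 & T (rng e) = 0].
Proof.
move=> dd nd; have [rep [r1 r2 r3]] := representative.
have /choice[F hF] x := local_family x dd nd.
have zero y : ~ cyclic y -> F (rep y) y = 0.
  move=> ncy; have [_ _ _ _ h] := hF (rep y); apply: h => cr; apply: ncy.
  by apply: scc_cyclic cr _; exact: scc_sym.
have repE e y : noncycle e -> (src e = y \/ rng e = y) -> cyclic y -> rep y = y.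
  move=> ne he cy; have ty : touches y by exists e.
  have [f [nf hf]] := r3 y ty.
  have [_ _ p1 p2] := hstar ne.
  have pe : pendant e y by case: he => he; rewrite -he; [apply: p1|apply: p2]; rewrite he.
  have pr : pendant e (rep y).
    by move=> z rz; apply: pe; apply: scc_trans rz; exact: r1.
  have fe : f = e by apply: pendant_unique ne pr _ nf hf; apply: scc_cyclic cy _; exact: r1.
  rewrite fe in hf; have [h1 h2] := r1 y.
  case: hf he => hf [] he.
  - by rewrite -hf -he.
  - by case: ne; rewrite he hf.
  - by case: ne; rewrite he hf.
  - by rewrite -hf -he.
exists (fun y => F (rep y) y); split; first by move=> y; have [h _ _ _ _] := hF (rep y); exact: h.
move=> e ns.
have ne : noncycle e.
  move=> rs; apply: ns; rewrite /solves.
  have sc : scc (src e) (rng e) by split=> //; exact: reach_edge.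
  have [h1 h2] := r1 (src e).
  rewrite -(r2 _ _ sc); have [_ h _ _ _] := hF (rep (src e)); apply: h => //.
  exact: reach_trans rs h1.
have [_ nb _ _] := hstar ne.
have ncs : ~ cyclic (src e).
  move=> cs; apply: ns; have ncr : ~ cyclic (rng e) by move=> cr; apply: nb.
  rewrite /solves (zero _ ncr) mul0r subr0 (repE e)//; last by left.
  by have [_ _ h _ _] := hF (src e); exact: h.
have ncr : ~ cyclic (rng e).
  move=> cr; apply: ns; rewrite /solves (zero _ ncs) mulr0 sub0r (repE e)//; last by right.
  by have [_ _ _ h _] := hF (rng e); exact: h.
by split=> //; exact: zero.
Qed.

(** There may be infinitely many edges, but a bridge has no parallel edge, so it is determined by
    its ends. *)
Lemma bridge_list : exists bs : seq E', uniq bs /\ forall e, noncycle e <-> (e : E') \in bs.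
Proof.
have [vs [uvs hvs]] := finite_graph_seq finG.
pose pk (yz : {classic V} * {classic V}) : option E' :=
  if pselect (exists e, noncycle e /\ (src e = yz.1 /\ rng e = yz.2)) is left h then Some (projT1 (cid h)) else None.
exists (undup (pmap pk [seq (y, z) | y <- vs, z <- vs])); split; first exact: undup_uniq.
move=> e; rewrite mem_undup mem_pmap; split.
  move=> ne; apply/mapP; exists ((src e : {classic V}), (rng e : {classic V})); first by apply: (allpairs_f (fun y z : {classic V} => (y, z))); exact: hvs.
  rewrite /pk; case: pselect => [h|[]]; last by exists e.
  case: cid => e' /= [ne' [se' re']]; congr Some; apply: contrapT => ee'.
  have [br _ _ _] := hstar ne; apply: br; apply: rst_step; exists e' => // E0; exact: ee'.
by move=> /mapP[yz _]; rewrite /pk; case: pselect => // h [->]; case: cid => e' /= [].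
Qed.

(* Each bridge e contributes - c_e on the side of its range. *)
Lemma edge_potential (c : E -> R[i]) : (forall e, c e <> 0 -> noncycle e) ->
  exists a : V -> R[i], forall e, a (src e) - a (rng e) = c e.
Proof.
move=> hc; have [bs [ubs hbs]] := bridge_list.
pose h (e : E) y : R[i] := if pselect (linked_off e y (rng e)) then - c e else 0.
exists (fun y => \sum_(e <- bs) h e y) => e; rewrite -sumrB.
have hE (f : E) : f <> e -> h f (src e) - h f (rng e) = 0.
  move=> fe; have lk : linked_off f (src e) (rng e) by apply: rst_step; exists e => // E0; exact: fe.
  rewrite /h; case: pselect => l1; case: pselect => l2 /=; rewrite ?subrr//.
    by case: l2; apply: rst_trans l1; apply: rst_sym.
  by case: l1; apply: rst_trans l2.
have [ebs|nbs] := boolP ((e : E') \in bs).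
  rewrite (bigD1_seq (e : E'))//= big1 ?addr0; last by move=> f /eqP fe; exact: hE.
  have [br _ _ _] : star e by apply: hstar; apply/hbs.
  rewrite /h; case: pselect => //= _; case: pselect => [l|[]] /=; last exact: rst_refl.
  by rewrite opprK add0r.
rewrite big_seq big1; last by move=> f fb; apply: hE => fe; move: fb; rewrite fe (negPf nbs).
apply/esym; apply: contrapT => /hc/hbs; by rewrite (negPf nbs).
Qed.

Theorem star_H1_vanishes : H1_vanishes A L.
Proof.
move=> d0 dd0; have [T0 LT0 nd] := normalize_vertices finG dd0.
apply: (inner_der_sub LT0); set d := der_sub d0 T0 in nd *.
have dd : der d by exact: der_der_sub.
have [T [hT sT]] := glued_family dd nd.
have [vs [uvs hvs]] := finite_graph_seq finG.
(* When neither end lies on a cycle, the only path parallel to the bridge e is e itself, so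
   delta(L_e) is a multiple of L_e. *)
have c_ex e : exists c : R[i], d (L_edge R e) = L_edge R e * T (src e) - T (rng e) * L_edge R e + c *: L_edge R e /\ (c <> 0 -> noncycle e).
  have [s|ns] := pselect (solves d T e); first by exists 0; split=> //; rewrite scale0r addr0.
  have [ne ncs ncr -> ->] := sT e ns; exists (cf (d (L_edge R e)) (src e) [:: e]); split=> //.
  rewrite mulr0 mul0r subr0 add0r.
  have [br _ _ _] := hstar ne.
  have LE := @L_alg_edge R G e.
  apply: convform_inj; [by apply: d_conv => //; exact: A_edge|by apply: L_alg_convform; exact: L_alg_Z|].
  have ce : composable (src e) [:: e] by [].
  move=> y w; have E1 : cf (L_edge R e) y w = (`[< y = src e /\ w = [:: e] >])%:R.
    by rewrite -Lw_edge cf_Lw.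
  rewrite cfZ E1.
  case: asboolP => [[-> ->]|h]; first by rewrite mulr1.
  rewrite mulr0; apply: contrapT => /(d_edge_supp dd nd)[ys cw wr]; apply: h; split=> //.
  have [w1 [w2 [-> c1 c2]]] := bridge_parallel br cw wr.
  by rewrite (noncyclic_closed ncr c1) (noncyclic_closed ncs c2).
have /choice[c hc] := c_ex.
have [a ha] := edge_potential (fun e => proj2 (hc e)).
(* The scalar multiples of the L_y commute with all the L_x, and their commutator with L_e is the
   difference of the potential at the ends of e, times L_e. *)
pose U y := T y + a y *: L_vertex R y.
have LU y : L (U y) by apply: L_alg_D; [case: (hT y)|apply: L_alg_Z; exact: L_alg_vertex].
have cU y : closed_at (U y) y.
  apply: closed_atD; first by case: (hT y).
  move=> z v; rewrite cfZ cf_L_vertex; case: asboolP => [[-> ->] //|_]; by rewrite mulr0.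
apply: (@inner_of_gens R G finG d (\sum_(y <- vs) U y)) => //.
- exact: L_alg_sum.
- move=> e; rewrite mulr_sumr mulr_suml.
  rewrite (bigD1_seq (src e : {classic V}))//= big1 ?addr0; last first.
    move=> y /eqP ye; rewrite (L_edgeM e (LU y) (cU y)).
    by case: pselect.
  rewrite [X in _ - X](bigD1_seq (rng e : {classic V}))//= [X in _ - (_ + X)]big1 ?addr0; last first.
    move=> y /eqP ye; rewrite (M_L_edge e (LU y) (cU y)).
    by case: pselect.
  rewrite (proj1 (hc e)) /U mulrDr mulrDl opprD addrACA; congr (_ + _).
  have ce : composable (src e) [:: e] by [].
  have -> : L_edge R e * (a (src e) *: L_vertex R (src e)) = a (src e) *: L_edge R e.
    rewrite -{2}Lw_edge (Lw_vertex R ce) Lw_edge.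
    by apply: bopP => f; rewrite bop_mulE !bop_scaleE bopZ.
  have -> : (a (rng e) *: L_vertex R (rng e)) * L_edge R e = a (rng e) *: L_edge R e.
    rewrite -{2}Lw_edge (vertex_Lw R ce) Lw_edge.
    by apply: bopP.
  by rewrite -scalerBl ha.
- move=> x; rewrite nd mulr_sumr mulr_suml -sumrB big1// => y _.
  rewrite (closed_at_vertexM x (LU y) (cU y)) (closed_at_Mvertex x (LU y) (cU y)).
  by rewrite subrr.
Qed.

End Pendant.

(** * Insertion derivations *)

Section Outer.
Variables (R : realType) (G : digraph).
Hypothesis finG : finite_graph G.
Notation V := (vertex G).
Notation E := (edge G).
Notation E' := ({classic E}).
Notation P := (dpath G).
Notation A := (A_alg G R).
Notation L := (L_alg G R).
Implicit Types (T X Y Z : bop R P) (x y z : V) (e f : E) (u v w q : seq E') (p : P).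

(** Between two occurrences of e a path would lead from the range of e back to its source. *)
Lemma noncycle_once e x u v u' v' : noncycle e -> composable x (u ++ (e : E') :: v) ->
  u ++ (e : E') :: v = u' ++ (e : E') :: v' -> u = u' /\ v = v'.
Proof.
move=> ne.
wlog uu' : u v u' v' / (size u <= size u')%N.
  move=> H c h; have [uu|uu] := leqP (size u) (size u'); first exact: H.
  rewrite h in c; have [-> ->] // := H _ _ _ _ (ltnW uu) c (esym h).
move=> c h.
have [t u't tv] := @cat_cmp E' _ _ _ _ (esym h) uu'.
case: t u't tv => [|g t] u't /=; first by move=> [->]; rewrite u't cats0.
move=> [eg vE]; case: ne.
move: c; rewrite vE => /composable_cat[_ /= [se ct]].
rewrite se word_range_cat /=.
by move: ct => /composable_cat[ct _]; exact: reach_word ct.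
Qed.

Section Shift.
Variables (e : E) (al be : seq E').
Hypotheses (ne : noncycle e) (cal : clx (rng e) al) (cbe : clx (src e) be).

Definition ins u v : seq E' := u ++ al ++ (e : E') :: be ++ v.

Lemma ins_composable x u v : composable x (u ++ (e : E') :: v) <-> composable x (ins u v).
Proof.
have [ca ra] := cal; have [cb rb] := cbe.
rewrite /ins; split.
  move=> /composable_cat[/= cu [se cv]]; apply/composable_cat; split.
    by rewrite word_range_cat /= ra.
  apply/composable_cat; split=> //=; split.
    by rewrite word_range_cat -se rb.
  by apply/composable_cat; rewrite -se.
move=> /composable_cat[]; rewrite word_range_cat /= ra => cu /composable_cat[_ /= [se /composable_cat[cb' cv]]].
apply/composable_cat; split=> //=; split=> //.
move: se; rewrite word_range_cat.
have [b0|b0] := pselect (be = [::]); first by rewrite b0.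
by rewrite -(composable_src_inj cb cb' b0) rb.
Qed.

Lemma ins_inj x u v u' v' : composable x (ins u v) -> ins u v = ins u' v' -> u = u' /\ v = v'.
Proof.
rewrite /ins !(catA _ al) => c h; have [h1 h2] := noncycle_once ne c h.
by split; [exact: (@cat_injr E' al)|exact: (@cat_injl E' be)].
Qed.

Lemma ins_range x u v : word_range x (ins u v) = word_range x (u ++ (e : E') :: v).
Proof. by rewrite /ins !word_range_cat /=; case: cal => _ ->. Qed.

(* Unambiguous since e, lying on no cycle, occurs at most once in a path. *)
Definition ins_path p : option P :=
  if pselect (exists u, exists v, path_edges p = u ++ (e : E') :: v) is left h then
    let u := projT1 (cid h) in let v := projT1 (cid (projT2 (cid h))) in
    if pselect (composable (path_src p) (ins u v)) is left c then Some (DPath c) else None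
  else None.

Lemma ins_pathE p u v (c : composable (path_src p) (ins u v)) :
  path_edges p = u ++ (e : E') :: v -> ins_path p = Some (DPath c).
Proof.
move=> pE; rewrite /ins_path; case: pselect => [h|[]]; last by exists u, v.
case: (cid h) => u' hu' /=; case: cid => v' hv' /=.
have := Defs.pathP p; rewrite hv' => c'; rewrite hv' in pE.
have [uu vv] := noncycle_once ne c' pE; rewrite uu vv.
by case: pselect => // c2; congr Some; apply: path_inj.
Qed.

Lemma ins_path_some p (q : P) : ins_path p = Some q ->
  exists u v, [/\ path_src q = path_src p, path_edges p = u ++ (e : E') :: v & path_edges q = ins u v].
Proof.
rewrite /ins_path; case: pselect => // h; case: (cid h) => u' hu' /=; case: cid => v' hv' /=.
by case: pselect => // c [<-]; exists u', v'.
Qed.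

Lemma ins_path_inj p p' (q : P) : ins_path p = Some q -> ins_path p' = Some q -> p = p'.
Proof.
move=> /ins_path_some[u [v [h1 h2 h3]]] /ins_path_some[u' [v' [h1' h2' h3']]].
have c : composable (path_src q) (ins u v) by rewrite -h3; exact: Defs.pathP.
rewrite h3 in h3'; have [uu vv] := ins_inj c h3'.
by apply: path_inj; [rewrite -h1 h1'|rewrite h2 h2' uu vv].
Qed.

Definition ins_op : bop R P := basis_shift R ins_path_inj.

Lemma at_ins_op (g : ell2 R P) y u v : composable y (u ++ (e : E') :: v) ->
  at_ (ins_op g) y (ins u v) = at_ g y (u ++ (e : E') :: v).
Proof.
move=> c; have c' := proj1 (ins_composable _ _ _) c.
rewrite (at_comp _ c) (at_comp _ c') /=; apply: shift_fun_some; first exact: ins_path_inj.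
exact: (@ins_pathE (DPath c) u v c').
Qed.

Lemma at_ins_op0 (g : ell2 R P) y w :
  ~ (exists u v, composable y (u ++ (e : E') :: v) /\ w = ins u v) -> at_ (ins_op g) y w = 0.
Proof.
move=> h; have [c|c] := pselect (composable y w); last by rewrite at_ncomp.
rewrite (at_comp _ c) /=; apply: shift_fun_none => p /ins_path_some[u [v [h1 h2 h3]]].
apply: h; exists u, v; rewrite /= in h1 h3; split=> //.
by rewrite h1 -h2; exact: Defs.pathP.
Qed.

Lemma ins_op_vertex x : ins_op * L_vertex R x = L_vertex R x * ins_op.
Proof.
apply: bopP => g; apply: at_inj => y w; rewrite !bop_mulE at_L_vertex.
have [[u [v [c ->]]]|h] := pselect (exists u v, composable y (u ++ (e : E') :: v) /\ w = ins u v).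
  by rewrite !at_ins_op// at_L_vertex ins_range.
by rewrite !at_ins_op0//; case: pselect.
Qed.

(** Prepending f leaves the occurrence of e alone. The delicate case is a word al e be v whose first
    letter f belongs to al: once f is removed, the part left of e is shorter than al, so the rest is
    not in the range of the insertion. *)
Lemma ins_op_edge f : f <> e -> ins_op * L_edge R f = L_edge R f * ins_op.
Proof.
move=> fe; apply: bopP => g; apply: at_inj => y w; rewrite !bop_mulE.
have [[u [v [c ->]]]|h] := pselect (exists u v, composable y (u ++ (e : E') :: v) /\ w = ins u v).
  rewrite at_ins_op//; have c' := proj1 (ins_composable _ _ _) c.
  case: u c c' => [|h u] c c'.
    rewrite [LHS]at_L_edge_neq//; last by move=> ef; apply: fe.
    have [E1|[h [al' E1]]] : al = [::] \/ exists h al', al = h :: al'.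
    - by case: (al) => [|h al']; [left|right; exists h, al'].
    - have -> : ins [::] v = (e : E') :: be ++ v by rewrite /ins E1.
      by rewrite at_L_edge_neq// => ef; apply: fe.
    have insE : ins [::] v = h :: (al' ++ (e : E') :: be ++ v) by rewrite /ins E1.
    rewrite insE in c' *; have [sh c3] := c'.
    have [hf|hf] := pselect (h = f); last by rewrite at_L_edge_neq.
    rewrite hf at_L_edge_cons -?hf// at_ins_op0// => -[u2 [v2 [c2 h2]]].
    move: h2; rewrite /ins catA => h2; have [h3 _] := noncycle_once ne c3 h2.
    by have := congr1 size h3; rewrite size_cat E1 /=; lia.
  rewrite -[ins (h :: u) v]/(h :: ins u v) -[(h :: u) ++ _]/(h :: u ++ (e : E') :: v).
  have [hf|hf] := pselect (h = f); last by rewrite !at_L_edge_neq.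
  rewrite hf in c c' *; have [s1 c1] := c; have [s2 c2] := c'.
  rewrite at_L_edge_cons//; rewrite [RHS]at_L_edge_cons//.
  by rewrite at_ins_op.
rewrite at_ins_op0//; case: w h => [|h w] hw; first by rewrite at_L_edge_nil.
have [hf|hf] := pselect (h = f); last by rewrite at_L_edge_neq.
rewrite hf in hw *.
have [sf|sf] := pselect (src f = word_range y w); last by rewrite at_ncomp// => -[].
rewrite at_L_edge_cons// at_ins_op0// => -[u [v [c wE]]]; apply: hw; exists (f :: u), v.
by split; [split=> //; rewrite sf wE ins_range|rewrite wE].
Qed.

(** A path produced by the insertion contains e already, and cannot be followed by e again. *)
Lemma edge_ins_op : L_edge R e * ins_op = 0.
Proof.
apply: bopP => g; apply: at_inj => y w; rewrite !bop_mulE at0.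
case: w => [|h w]; first by rewrite at_L_edge_nil.
have [hf|hf] := pselect (h = e); last by rewrite at_L_edge_neq.
rewrite hf; have [sf|sf] := pselect (src e = word_range y w); last by rewrite at_ncomp// => -[].
rewrite at_L_edge_cons// at_ins_op0// => -[u [v [c wE]]].
have c' : composable y (([::] : seq E') ++ (e : E') :: w).
  by split=> //; rewrite wE; exact: (proj1 (ins_composable _ _ _) c).
have [h1 _] : [::] = (e : E') :: u ++ al /\ w = be ++ v.
  apply: (noncycle_once ne c'); by rewrite wE /ins /= catA.
by [].
Qed.

Lemma ins_op_L_edge : ins_op * L_edge R e = Lw R (src e) (al ++ (e : E') :: be).
Proof.
have [ca ra] := cal; have [cb rb] := cbe.
have cw : composable (src e) (al ++ (e : E') :: be).
  by apply/composable_cat; split=> //=.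
apply: bopP => g; apply: at_inj => y w; rewrite !bop_mulE.
have [cyw|cyw] := pselect (composable y w); last by rewrite !at_ncomp.
have [[u [v [c wE]]]|h] := pselect (exists u v, composable y (u ++ (e : E') :: v) /\ w = ins u v).
  rewrite wE at_ins_op//; case: u c wE => [|h u] c wE.
    have [se cv] := c; rewrite [LHS]at_L_edge_cons//.
    by rewrite /ins /= -cat_cons catA at_Lw_cat.
  have c' := proj1 (ins_composable _ _ _) c.
  rewrite [LHS]at_L_edge_neq; last first.
    move=> he; rewrite he in c.
    by have [] := @noncycle_once e y [::] (u ++ (e : E') :: v) ((e : E') :: u) v ne c erefl.
  rewrite at_Lw0// => -[v' h1 _].
  have [] : (h :: u) ++ al = al /\ be ++ v = be ++ v'.
    have h2 : ((h :: u) ++ al) ++ (e : E') :: be ++ v = al ++ (e : E') :: be ++ v'.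
      by rewrite -catA; apply: (etrans h1); rewrite -catA.
    apply: (@noncycle_once e y _ _ _ _ ne) h2.
    by rewrite -catA.
  by move/(congr1 size); rewrite size_cat /=; lia.
rewrite at_ins_op0// at_Lw0// => -[v h1 h2]; apply: h.
exists [::], v; split; last by rewrite h1 /ins /= -cat_cons catA.
by split=> //; move: cyw; rewrite h1 => /composable_cat[].
Qed.

Definition ins_der X := ins_op * X - X * ins_op.

(** The point is that the values lie in [L_alg], though [ins_op] itself need not be a convolution.
    The commutators with the generators do lie there, and the operators of [A_alg] with this
    property form a norm closed algebra. *)
Lemma ins_der_der : der ins_der.
Proof.
split.
- move=> X AX; suff : (A `&` [set X | L (ins_der X)]) X by case.
  have dSD c Y Z : ins_der (c *: Y + Z) = c *: ins_der Y + ins_der Z.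
    rewrite /ins_der mulrDr mulrDl opprD addrACA scalerBr.
    have -> : ins_op * (c *: Y) = c *: (ins_op * Y) by apply: bopP => g; rewrite bop_mulE !bop_scaleE bopZ.
    by have -> : (c *: Y) * ins_op = c *: (Y * ins_op) by apply: bopP.
  have dSM Y Z : ins_der (Y * Z) = ins_der Y * Z + Y * ins_der Z.
    by rewrite /ins_der mulrBl mulrBr !mulrA addrA subrK.
  move: X AX; apply: A_min; first split.
  + split; first exact: A_0.
    by rewrite /= /ins_der mulr0 mul0r subrr; case: (@L_alg_sub R G).
  + move=> c Y Z [AY LY] [AZ LZ]; split; first by apply: A_D => //; exact: A_Z.
    by rewrite /= dSD; apply: L_alg_D => //; exact: L_alg_Z.
  + move=> Y Z [AY LY] [AZ LZ]; split; first exact: A_M.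
    by rewrite /= dSM; apply: L_alg_D; apply: L_alg_M => //; exact: A_L.
  + move=> T hT; split; first by apply: A_norm_closed => t /hT[Y [[AY _] Ye]]; exists Y.
    apply/(L_algP _ finG); apply: convform_norm_closed => t t0.
    pose K := 2 * (2 * opnorm ins_op) + 1.
    have K0 : 0 < K by rewrite ltr_wpDl// !mulr_ge0// opnorm_ge0.
    have [Y [[AY LY] Yt]] := hT (t / K) (divr_gt0 t0 K0).
    exists (ins_der Y); split; first exact: L_alg_convform.
    have -> : ins_der T - ins_der Y = ins_der (T - Y).
      have -> : T - Y = -1 *: Y + T by rewrite scaleN1r addrC.
      by rewrite dSD scaleN1r addrC.
    apply: (@le_lt_trans _ _ (K * opnorm (T - Y))).
      rewrite /K mulrDl mul1r; apply: le_trans (opnormD_le _ _) _; rewrite opnormN.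
      have := opnormM_le ins_op (T - Y); have := opnormM_le (T - Y) ins_op; have := opnorm_ge0 (T - Y).
      lra.
    by rewrite mulrC -ltr_pdivlMr.
  + move=> _ [[f _ <-]|[x _ <-]]; split=> /=; [exact: A_edge| |exact: A_vertex|]; last first.
      by rewrite /ins_der ins_op_vertex subrr; case: (@L_alg_sub R G).
    rewrite /ins_der; have [->|fe] := pselect (f = e).
      by rewrite edge_ins_op subr0 ins_op_L_edge; exact: L_alg_Lw.
    by rewrite ins_op_edge// subrr; case: (@L_alg_sub R G).
- move=> c Y Z _ _; rewrite /ins_der mulrDr mulrDl opprD addrACA scalerBr.
  have -> : ins_op * (c *: Y) = c *: (ins_op * Y) by apply: bopP => g; rewrite bop_mulE !bop_scaleE bopZ.
  by have -> : (c *: Y) * ins_op = c *: (Y * ins_op) by apply: bopP.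
- by move=> Y Z _ _; rewrite /ins_der mulrBl mulrBr !mulrA addrA subrK.
- exists (2 * (2 * opnorm ins_op)) => X _; apply: le_trans (opnormD_le _ _) _; rewrite opnormN.
  have := opnormM_le ins_op X; have := opnormM_le X ins_op; lra.
Qed.

Hypothesis vanish : H1_vanishes A L.

Lemma inner_symbol : exists T, [/\ L T, forall x, L_vertex R x * T = T * L_vertex R x,
  forall f, f <> e -> L_edge R f * T = T * L_edge R f &
  Lw R (src e) (al ++ (e : E') :: be) = L_edge R e * T - T * L_edge R e].
Proof.
have [T LT h] := vanish ins_der_der; exists T; split=> //.
- move=> x; have := h _ (@A_vertex R G x); rewrite /ins_der ins_op_vertex subrr => /esym/eqP.
  by rewrite subr_eq0 => /eqP.
- move=> f fe; have := h _ (@A_edge R G f); rewrite /ins_der ins_op_edge// subrr => /esym/eqP.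
  by rewrite subr_eq0 => /eqP.
- by have := h _ (@A_edge R G e); rewrite /ins_der edge_ins_op subr0 ins_op_L_edge.
Qed.
End Shift.

Lemma cf_edgeM e X y v : convform X -> word_range y v = src e ->
  cf (L_edge R e * X) y ((e : E') :: v) = cf X y v.
Proof.
by move=> cX yv; rewrite -Lw_edge -[(e : E') :: v]/([:: (e : E')] ++ v) cf_LwM_cat.
Qed.

Lemma cf_edgeM_neq e X y w : ~ (exists v, w = (e : E') :: v) -> cf (L_edge R e * X) y w = 0.
Proof. by move=> h; rewrite -Lw_edge cf_LwM0// => -[v wE _]; apply: h; exists v. Qed.

Lemma cf_Medge e X v : convform X -> cf (X * L_edge R e) (src e) (v ++ [:: e : E']) = cf X (rng e) v.
Proof. by move=> cX; rewrite -Lw_edge cf_MLw_cat. Qed.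

Lemma cf_Medge_neq e X y w : convform X -> ~ (exists v, w = v ++ [:: e : E']) -> cf (X * L_edge R e) y w = 0.
Proof. by move=> cX h; rewrite -Lw_edge cf_MLw0// => -[_]. Qed.

(** Let g be closed at z with nonzero coefficient in T, and let f leave z. Comparing L_f T with T
    L_f at f g shows that this word is g' f, where g' has nonzero coefficient too. So f is the last
    letter of g, hence unique, and the support moves along f around the strong component. For edges
    into z the first letter of g plays the same part. *)
Lemma pendant_of_central e T y ga : noncycle e -> L T ->
  (forall f, f <> e -> L_edge R f * T = T * L_edge R f) ->
  clx y ga -> ga <> [::] -> cf T y ga <> 0 -> pendant e y.
Proof.
move=> ne LT cT cga ga0 nz; have cvT := L_alg_convform LT.
have push z g f : word_range z (g : seq E) = z -> cf T z g <> 0 -> f <> e -> src f = z -> exists g', (f : E') :: g = g' ++ [:: f : E'] /\ cf T (rng f) g' <> 0.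
  move=> gz gnz fe sf.
  have E1 : cf (T * L_edge R f) z ((f : E') :: g) = cf T z g by rewrite -cT// cf_edgeM// gz sf.
  have [[g' gE]|ng] := pselect (exists g', (f : E') :: g = g' ++ [:: f : E']); last first.
    by case: gnz; rewrite -E1 cf_Medge_neq.
  by exists g'; split=> //; rewrite -(cf_Medge f g' cvT) sf -gE E1.
have all_z z : scc y z -> exists g, [/\ clx z g, g <> [::] & cf T z g <> 0].
  move=> [yz zy]; have h := clos_rt_rtn1 _ _ _ _ yz.
  elim: h zy => [|z1 z2 [f [sf rf]] h1 IH] z2y; first by exists ga.
  have yz1 : reach y z1 by exact: clos_rtn1_rt.
  have z1z2 : reach z1 z2 by rewrite -sf -rf; exact: reach_edge.
  have [g [cg g0 gnz]] := IH (reach_trans z1z2 z2y).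
  have fe : f <> e.
    move=> fe; apply: ne; rewrite -fe sf rf; exact: reach_trans z2y yz1.
  have [g' [gE g'nz]] := push z1 g f (proj2 cg) gnz fe sf; rewrite rf in g'nz.
  have sg : size g' = size g by have := congr1 size gE; rewrite size_cat /=; lia.
  exists g'; split=> //; last by move=> g'0; move: sg; rewrite g'0; case: (g) g0.
  have cfg : composable z1 ((f : E') :: g) by split; [rewrite (proj2 cg)|exact: (proj1 cg)].
  rewrite gE in cfg; move: (cfg) => /composable_cat[cg' _]; rewrite /= rf in cg'; split=> //.
  have : word_range z1 (g' ++ [:: f : E']) = rng f by rewrite -gE.
  by rewrite word_range_cat /= rf.
move=> z yz f f' fe f'e; have [g [cg g0 gnz]] := all_z z yz; split.
  move=> sf sf'; have [g1 [h1 _]] := push z g f (proj2 cg) gnz fe sf.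
  have [g2 [h2 _]] := push z g f' (proj2 cg) gnz f'e sf'.
  case/lastP: g g0 h1 h2 {cg gnz} => [//|g h _] h1 h2.
  have e1 : h = f by have := congr1 (last f) h1; rewrite last_cat /= last_rcons.
  have e2 : h = f' by have := congr1 (last f) h2; rewrite last_cat /= last_rcons.
  by rewrite -e1 e2.
have pull f0 : f0 <> e -> rng f0 = z -> exists v, g = (f0 : E') :: v.
  move=> f0e rf0.
  have E1 : cf (L_edge R f0 * T) (src f0) (g ++ [:: f0 : E']) = cf T z g by rewrite cT// cf_Medge// rf0.
  have [[v vE]|nv] := pselect (exists v, g ++ [:: f0 : E'] = (f0 : E') :: v); last first.
    by case: gnz; rewrite -E1 cf_edgeM_neq.
  by case: (g) g0 vE => [//|h g'] _ /= [-> _]; exists g'.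
move=> rf rf'; have [v gv] := pull _ fe rf; have [v' gv'] := pull _ f'e rf'.
by move: gv'; rewrite gv => -[].
Qed.

Theorem H1_vanishes_star : H1_vanishes A L -> forall e, noncycle e -> star e.
Proof.
move=> vanish e ne.
have nil_closed x : clx x ([::] : seq E') by exact: clx0.
have eq_false u v : (e : E') :: u = v ++ [:: e : E'] -> composable (src e) ((e : E') :: u) -> u = [::].
  move=> h c; have [h1 h2] : ([::] : seq E') = v /\ u = [::] by apply: (@noncycle_once e (src e) [::] u v [::] ne).
  exact: h2.
split.
(* With both words empty: the coefficients of T at the paths of length 0 agree across each f other
   than e, but differ by 1 across e. *)
- have [T [LT cv cedge hT]] := inner_symbol ne (nil_closed (rng e)) (nil_closed (src e)) vanish.
  have cT := L_alg_convform LT.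
  have key f : f <> e -> cf T (src f) [::] = cf T (rng f) [::].
    move=> fe; rewrite -(@cf_edgeM f T (src f) [::] cT erefl) cedge//; exact: (cf_Medge f [::] cT).
  have conn x y : linked_off e x y -> cf T x [::] = cf T y [::].
    by elim=> [x1 y1 [f fe [<- <-]]|//|x1 y1 _ ->|x1 y1 z1 _ -> _ ->] //; exact: key.
  move=> /conn h.
  have := congr1 (fun X => cf X (src e) [:: e : E']) hT; cbv beta.
  rewrite cf_Lw// asboolT// cfB cf_edgeM// -[X in _ - cf _ _ X]/([::] ++ [:: e : E']) cf_Medge// h subrr.
  by move/eqP; rewrite oner_eq0.
(* With both words nonempty, al e be neither begins nor ends with e, so its coefficient 1 cannot
   come from L_e T - T L_e. *)
- move=> [/cyclic_closed[be cbe b0] /cyclic_closed[al cal a0]].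
  have [T [LT cv cedge hT]] := inner_symbol ne cal cbe vanish.
  have cT := L_alg_convform LT.
  have cw : composable (src e) (al ++ (e : E') :: be).
    by apply/composable_cat; case: cal => ? ?; split=> //=; case: cbe.
  have := congr1 (fun X => cf X (src e) (al ++ (e : E') :: be)) hT; cbv beta.
  rewrite cf_Lw// asboolT// cfB cf_edgeM_neq ?cf_Medge_neq//.
  + by rewrite subrr => /eqP; rewrite oner_eq0.
  + by move=> [v h]; have [_ h2] := noncycle_once ne cw (v' := [::]) h.
  + by move=> [v h]; have [h1 _] := noncycle_once ne cw (u' := [::]) h.
(* The word e be does not end with e, so T has coefficient 1 at be. *)
- move=> /cyclic_closed[be cbe b0].
  have [T [LT cv cedge hT]] := inner_symbol ne (nil_closed (rng e)) cbe vanish.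
  have cT := L_alg_convform LT.
  have cw : composable (src e) ((e : E') :: be) by case: cbe.
  apply: (pendant_of_central ne LT cedge cbe b0).
  have := congr1 (fun X => cf X (src e) ((e : E') :: be)) hT; cbv beta.
  rewrite cf_Lw// asboolT// cfB cf_edgeM//; last by case: cbe.
  rewrite cf_Medge_neq//; last by move=> [v h]; apply: b0; exact: eq_false h cw.
  by rewrite subr0 => <- /eqP; rewrite oner_eq0.
(* The word al e does not begin with e, so T has coefficient -1 at al. *)
- move=> /cyclic_closed[al cal a0].
  have [T [LT cv cedge hT]] := inner_symbol ne cal (nil_closed (src e)) vanish.
  have cT := L_alg_convform LT.
  have cw : composable (src e) (al ++ [:: e : E']).
    by apply/composable_cat; case: cal.
  apply: (pendant_of_central ne LT cedge cal a0).
  have := congr1 (fun X => cf X (src e) (al ++ [:: e : E'])) hT; cbv beta.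
  rewrite cf_Lw// asboolT// cfB cf_Medge// cf_edgeM_neq.
    by rewrite sub0r => h /eqP; rewrite -oppr_eq0 -h oner_eq0.
  by move=> [v h]; have [h1 _] := noncycle_once ne cw (u' := [::]) h.
Qed.
End Outer.

(** * Fruit trees *)

Section Bridges.
Variable G : digraph.
Notation V := (vertex G).
Notation E := (edge G).
Notation E' := ({classic E}).
Implicit Types (x y z : V) (e f t : E) (w : seq E').

(** A path from the range of e back to its source that crosses e has visited the source before, so
    it can be shortened until it avoids e. *)
Lemma bridge_noncycle e : ~ linked_off e (src e) (rng e) -> noncycle e.
Proof.
move=> br /reachP[w [cw wE]].
have [n nw] := ubnP (size w); elim: n w nw cw wE => // n IH w nw cw wE.
have [[w1 [w2 ww]]|nw'] := pselect (exists w1 w2, w = w1 ++ (e : E') :: w2).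
  move: cw; rewrite ww => /composable_cat[_ /= [se cw2]].
  by apply: (IH w2) => //; move: nw; rewrite ww size_cat /=; lia.
by apply: br; apply: rst_sym; rewrite -wE; exact: linked_off_word.
Qed.

Definition joins f x y := (src f = x /\ rng f = y) \/ (src f = y /\ rng f = x).

Lemma linked_off_path e x y : linked_off e x y -> exists p : seq {classic V},
  path (fun u v : {classic V} => `[< exists2 f, f <> e & joins f u v >]) x p /\ last (x : {classic V}) p = y.
Proof.
move=> h; elim: (clos_rst_rst1n _ _ _ _ h) => [u|u v z uv _ [p [pp pl]]]; first by exists [::].
exists (v :: p); split=> //=; rewrite pp andbT; apply/asboolP.
by case: uv => -[f fe ?]; exists f => //; [left|right].
Qed.

(** A detour around t, freed of repeated vertices, closes up with t to a polygon. *)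
Lemma polygon_of_linked t : linked_off t (src t) (rng t) ->
  exists n (v : 'I_n -> V) (e : 'I_n -> E), (0 < n)%N /\ polygon v e.
Proof.
move=> /linked_off_path[p [pp pl]].
case/shortenP: pp pl => q qp uq _ ql.
set x : {classic V} := src t in qp uq ql.
have /choice[pk hpk] (uv : {classic V} * {classic V}) : exists f, `[< exists2 f, f <> t & joins f uv.1 uv.2 >] -> f <> t /\ joins f uv.1 uv.2.
  case: asboolP => [[f h1 h2]|_]; first by exists f.
  by exists t.
pose m := size q.
pose vv (j : nat) : {classic V} := nth x (x :: q) j.
(* Edge j joins the vertices j and j + 1 of the detour, and t has index m. If t is a loop, then m =
   0 and the polygon has length 1. *)
pose ee (j : nat) : E := if (j < m)%N then pk (vv j, vv j.+1) else t.
have vinj i j : (i <= m)%N -> (j <= m)%N -> vv i = vv j -> i = j.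
  by move=> im jm /eqP; rewrite nth_uniq //= => /eqP.
have eeP j : (j < m)%N -> ee j <> t /\ joins (ee j) (vv j) (vv j.+1).
  move=> jm; rewrite /ee jm; apply: (hpk (vv j, vv j.+1)).
  by have /(pathP x) := qp; apply.
have vm : vv m = rng t by rewrite /vv /m nth_last.
exists m.+1, (fun j => vv j), (fun j => ee j); split=> //; split.
- by move=> i j /vinj ij; apply: val_inj; apply: ij; rewrite -ltnS.
- move=> i j eij; apply: val_inj => /=.
  have im : (i <= m)%N by rewrite -ltnS.
  have jm : (j <= m)%N by rewrite -ltnS.
  wlog ij : i j eij im jm / (i <= j)%N.
    by move=> H; have [h|h] := leqP i j; [exact: H|symmetry; apply: H => //; exact: ltnW].
  move: ij; rewrite leq_eqVlt => /orP[/eqP//|ij].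
  have im' : (i < m)%N by apply: leq_trans ij jm.
  have [it ji] := eeP i im'.
  have [jm'|jm'] := ltnP j m; last by case: it; rewrite eij /ee ltnNge jm'.
  have [_ jj] := eeP j jm'.
  (* Equal edges have equal pairs of ends, so vertex i is vertex j or j + 1, against i < j. *)
  have [vi|vi] : vv i = vv j \/ vv i = vv j.+1.
  + move: ji jj; rewrite eij => -[[s1 r1]|[s1 r1]] [[s2 r2]|[s2 r2]].
    * by left; rewrite -s1 s2.
    * by right; rewrite -s1 s2.
    * by right; rewrite -r1 r2.
    * by left; rewrite -r1 r2.
  + by have := vinj _ _ im jm vi; lia.
  + by have := vinj _ _ im jm' vi; lia.
- move=> j; have jm : (j <= m)%N by rewrite -ltnS.
  have [jm'|jm'] := ltnP j m.
    have [_ jj] := eeP j jm'; rewrite /= modn_small ?ltnS//.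
    by case: jj => -[-> ->]; [rewrite setUC|].
  have jE : j = m :> nat by apply/eqP; rewrite eqn_leq jm jm'.
  rewrite /= jE modnn /ee ltnn vm; by [].
Qed.

End Bridges.

Lemma sval_inj (T : Type) (P : T -> Prop) (a b : {x | P x}) : sval a = sval b -> a = b.
Proof. by case: a b => [a ha] [b hb] /= ab; subst b; congr exist; exact: Prop_irrelevance. Qed.

(** * Restriction to a connected component *)

Section Component.
Variables (G : digraph) (x : vertex G).
Notation K := (component x).
Implicit Types (a b : vertex K) (e f : edge K).

Lemma comp_reach a b : reach a b <-> reach (sval a) (sval b).
Proof.
split.
  elim=> [u v [e [<- <-]]|u|u v w _ h1 _ h2]; [|exact: rt_refl|exact: reach_trans h1 h2].
  exact: reach_edge (sval e).
case: a b => [a ha] [b hb] /= h; have h' := clos_rt_rtn1 _ _ _ _ h.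
elim: h' hb => [|y z [e [se re]] _ IH] hb.
  by rewrite (Prop_irrelevance ha hb); exact: rt_refl.
have hy : linked x y.
  by apply: rst_trans hb _; apply: rst_sym; apply: rst_step; exists e.
apply: reach_trans (IH hy) _; apply: rt_step.
have he : linked x (src e) by rewrite se.
by exists (exist _ e he); split; exact: sval_inj.
Qed.

Lemma comp_scc a b : scc a b <-> scc (sval a) (sval b).
Proof. by rewrite /scc !comp_reach. Qed.

Lemma comp_noncycle e : noncycle e <-> noncycle (sval e).
Proof. by rewrite /noncycle comp_reach. Qed.

Lemma comp_cyclic a : cyclic a <-> cyclic (sval a).
Proof.
split=> [[e <- /comp_reach h]|[e se h]]; first by exists (sval e).
have he : linked x (src e) by rewrite se; exact: svalP.
exists (exist _ e he); first exact: sval_inj.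
by apply/comp_reach.
Qed.

Lemma comp_linked_off e a b : linked_off e a b <-> linked_off (sval e) (sval a) (sval b).
Proof.
split.
  elim=> [u v [f fe [<- <-]]|u|u v _ h|u v w _ h1 _ h2].
  - by apply: rst_step; exists (sval f) => // fe'; apply: fe; exact: sval_inj.
  - exact: rst_refl.
  - exact: rst_sym.
  - exact: rst_trans h1 h2.
case: a b => [a ha] [b hb] /= h.
have lk u v : linked_off (sval e) u v -> linked u v.
  elim=> [u' v' [f _ [<- <-]]|u'|u' v' _ h1|u' v' w _ h1 _ h2].
  - by apply: rst_step; exists f.
  - exact: rst_refl.
  - exact: rst_sym.
  - exact: rst_trans h1 h2.
elim: h ha hb => [u v [f fe [sf rf]]|u|u v _ IH|u v w huv IH1 hvw IH2] ha hb.
- have he : linked x (src f) by rewrite sf.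
  apply: rst_step; exists (exist _ f he).
    by move=> E0; apply: fe; rewrite -E0.
  by split; exact: sval_inj.
- by rewrite (Prop_irrelevance ha hb); exact: rst_refl.
- by apply: rst_sym; exact: IH.
- have hv : linked x v by apply: rst_trans ha (lk _ _ huv).
  exact: rst_trans (IH1 ha hv) (IH2 hv hb).
Qed.

Lemma comp_pendant e a : pendant e a <-> pendant (sval e) (sval a).
Proof.
split=> h.
  move=> z az f f' fe f'e.
  have hz : linked x z.
    have lk u v : reach u v -> linked u v.
      by elim=> [u' v' k|u'|u' v' w _ h1 _ h2]; [exact: rst_step|exact: rst_refl|exact: rst_trans h1 h2].
    by apply: rst_trans (svalP a) _; apply: lk; case: az.
  have az' : scc a (exist _ z hz) by apply/comp_scc.
  have lf g : src g = z \/ rng g = z -> linked x (src g).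
    case=> [->//|gz]; apply: (rst_trans _ _ _ z); first exact: hz.
    by apply: rst_sym; apply: rst_step; exists g.
  have ne (g : edge G) (hg : linked x (src g)) : g <> sval e -> exist _ g hg <> e.
    by move=> ge E0; apply: ge; rewrite -E0.
  split=> fz f'z.
    have h1 := lf _ (or_introl fz); have h2 := lf _ (or_introl f'z).
    have [h3 _] := h _ az' (exist _ f h1) (exist _ f' h2) (ne f h1 fe) (ne f' h2 f'e).
    suff /(congr1 sval) : exist (fun k : edge G => linked x (src k)) f h1 = exist _ f' h2 by [].
  by apply: h3; exact: sval_inj.
  have h1 := lf _ (or_intror fz); have h2 := lf _ (or_intror f'z).
  have [_ h3] := h _ az' (exist _ f h1) (exist _ f' h2) (ne f h1 fe) (ne f' h2 f'e).
  suff /(congr1 sval) : exist (fun k : edge G => linked x (src k)) f h1 = exist _ f' h2 by [].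
  by apply: h3; exact: sval_inj.
move=> z /comp_scc az f f' fe f'e.
have ne (g : edge K) : g <> e -> sval g <> sval e.
  by move=> ge E0; apply: ge; exact: sval_inj.
have [h1 h2] := h _ az (sval f) (sval f') (ne _ fe) (ne _ f'e).
split=> fz f'z; apply: sval_inj.
  by apply: h1; [rewrite -fz|rewrite -f'z].
by apply: h2; [rewrite -fz|rewrite -f'z].
Qed.

Lemma comp_star e : star e <-> star (sval e).
Proof.
have [l1 l2] := comp_linked_off e (src e) (rng e).
have [s1 s2] := comp_cyclic (src e); have [r1 r2] := comp_cyclic (rng e).
have [p1 p2] := comp_pendant e (src e); have [q1 q2] := comp_pendant e (rng e).
by split=> -[h1 h2 h3 h4]; split;
  [move/l2|case=> /s2 ? /r2 ?; apply: h2|move/s2/h3/p1|move/r2/h4/q1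
  |move/l1|case=> /s1 ? /r1 ?; apply: h2|move/s1/h3/p2|move/r1/h4/q2].
Qed.

End Component.

Lemma iter_ordS m (j : 'I_m) k : val (iter k (@ordS m) j) = ((j + k) %% m)%N.
Proof.
elim: k => [|k IH] /=; first by rewrite addn0 modn_small.
by rewrite IH addnS -addn1 modnDml addn1.
Qed.

(** * Edges of a fruit tree *)

Section FruitStar.
Variables (G Gt : digraph) (Vs : set (vertex Gt)) (n : {v | Vs v} -> nat) (base : forall lam, 'I_(n lam)).
Notation circ := (graph_bigsum (fun lam => circle_graph (n lam))).
Notation K0 := (graph_sum Gt circ).
Hypotheses (tree : generalized_tree Gt) (leaves : Vs `<=` @leaf Gt) (VsT : Vs <> [set: vertex Gt]).
Hypothesis n0 : forall lam, (0 < n lam)%N.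
Notation idr := (fun x y : vertex K0 => exists lam, x = inl (sval lam) /\ y = inr (existT _ lam (base lam))).
Variables (phi : vertex K0 -> vertex G) (psi : edge K0 -> edge G).
Hypotheses (phi_surj : forall y, exists x, phi x = y)
  (phi_eq : forall x x', phi x = phi x' <-> clos_refl_sym_trans _ idr x x')
  (psi_bij : bijective psi)
  (psiE : forall e, src (psi e) = phi (src e) /\ rng (psi e) = phi (rng e)).

(** Collapses each circle to the leaf that carries it. *)
Definition proj0 (z : vertex K0) : vertex Gt :=
  match z with inl v => v | inr a => sval (projT1 a) end.

Lemma proj0_eq z z' : phi z = phi z' -> proj0 z = proj0 z'.
Proof.
move=> /phi_eq; elim=> [u v [lam [-> ->]]|//|u v _ ->|u v w _ -> _ ->] //.
Qed.

Definition proj (y : vertex G) : vertex Gt := proj0 (projT1 (cid (phi_surj y))).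

Lemma projE z : proj (phi z) = proj0 z.
Proof. by apply: proj0_eq; rewrite /proj; case: cid. Qed.

(** A normal form, constant on the classes of identified vertices and injective on circle vertices,
    which shows that these stay distinct. *)
Definition nrm0 (z : vertex K0) : vertex K0 :=
  match z with
  | inl v => if pselect (Vs v) is left h then inr (existT _ (exist _ v h) (base (exist _ v h))) else inl v
  | inr a => inr a
  end.

Lemma phi_inr_inj (a b : vertex circ) : phi (inr a) = phi (inr b) -> a = b.
Proof.
move=> /phi_eq h; suff : nrm0 (inr a) = nrm0 (inr b) by case.
elim: h => [u v [[lam hl] [-> ->]]|//|u v _ ->|u v w _ -> _ ->] //=.
by case: pselect => // h; rewrite (Prop_irrelevance h hl).
Qed.

Lemma edge_cases (e : edge G) : (exists t, e = psi (inl t)) \/ (exists c, e = psi (inr c)).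
Proof.
have [psi' h1 h2] := psi_bij; rewrite -(h2 e).
by case: (psi' e) => [t|c]; [left; exists t|right; exists c].
Qed.

(** Collapsing the circles turns a detour around t into one inside [Gt], hence into a polygon. *)
Lemma tree_edge_bridge t : ~ linked_off (psi (inl t)) (src (psi (inl t))) (rng (psi (inl t))).
Proof.
move=> h.
have key a b : linked_off (psi (inl t)) a b -> linked_off t (proj a) (proj b).
  elim=> [u v [f fe [<- <-]]|u|u v _ h1|u v w _ h1 _ h2].
  - have [[t' ft]|[c fc]] := edge_cases f.
      rewrite ft in fe *; have [-> ->] := psiE (inl t'); rewrite !projE /=.
      by apply: rst_step; exists t' => // tt; apply: fe; rewrite tt.
    by rewrite fc; have [-> ->] := psiE (inr c); rewrite !projE /=; exact: rst_refl.
  - exact: rst_refl.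
  - exact: rst_sym.
  - exact: rst_trans h1 h2.
move/key: h; have [-> ->] := psiE (inl t); rewrite !projE /= => /polygon_of_linked[m [v [e [m0 pol]]]].
by case: tree => _ _ /(_ m v e m0).
Qed.

(** Edge j of a circle runs from vertex j + 1 to vertex j, so indices decrease along a path. *)
Lemma circle_reach lam (j : 'I_(n lam)) k :
  reach (phi (inr (existT _ lam (iter k (@ordS _) j)))) (phi (inr (existT _ lam j))).
Proof.
elim: k => [|k IH]; first exact: rt_refl.
apply: reach_trans IH.
have [h1 h2] := psiE (inr (existT _ lam (iter k (@ordS _) j))).
have := reach_edge (psi (inr (existT _ lam (iter k (@ordS _) j)))).
by rewrite h1 h2.
Qed.

Lemma circle_edge_cycle c : ~ noncycle (psi (inr c)).
Proof.
move=> nc; apply: nc; have [-> ->] := psiE (inr c).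
case: c => lam j; rewrite /=.
have := circle_reach (ordS j) (n lam).-1.
have -> // : iter (n lam).-1 (@ordS _) (ordS j) = j.
apply: val_inj; rewrite iter_ordS /= modnDml.
have -> : (j.+1 + (n lam).-1 = j + n lam)%N by have := n0 lam; lia.
by rewrite modnDr modn_small.
Qed.

Lemma noncycle_tree e : noncycle e -> exists t, e = psi (inl t).
Proof.
by move=> ne; have [//|[c ec]] := edge_cases e; rewrite ec in ne; case: (circle_edge_cycle ne).
Qed.

Lemma cycle_circle e : ~ noncycle e -> exists c, e = psi (inr c).
Proof.
move=> ne; have [[t et]|//] := edge_cases e; case: ne; rewrite et.
by apply: bridge_noncycle; exact: tree_edge_bridge.
Qed.

Lemma cyclic_circle y : cyclic y -> exists a, y = phi (inr a).
Proof.
move=> [e se re].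
have [[lam j] ec] : exists c, e = psi (inr c) by apply: cycle_circle => ne; apply: ne; rewrite se.
by exists (existT _ lam (ordS j)); rewrite -se ec; have [-> _] := psiE (inr (existT _ lam j)).
Qed.

(** The edges of a path inside a strong component lie on cycles, hence on circles, and [proj] is
    constant along them. *)
Lemma scc_proj y z : scc y z -> proj z = proj y.
Proof.
move=> [yz zy]; have h := clos_rt_rtn1 _ _ _ _ yz.
elim: h zy => [//|z1 z2 [e [se re]] h1 IH] z2y.
have yz1 : reach y z1 by exact: clos_rtn1_rt.
have z12 : reach z1 z2 by rewrite -se -re; exact: reach_edge.
rewrite -(IH (reach_trans z12 z2y)).
have [c ec] : exists c, e = psi (inr c).
  by apply: cycle_circle => ne; apply: ne; rewrite se re; exact: reach_trans z2y yz1.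
by rewrite -se -re ec; have [-> ->] := psiE (inr c); rewrite !projE.
Qed.

(** The tree has only the edge t at the leaf v, so the other edges at z belong to a circle, each
    vertex of which has one edge out and one in. *)
Lemma leaf_pendant t v : Vs v -> src t = v \/ rng t = v -> pendant (psi (inl t)) (phi (inl v)).
Proof.
move=> Vv tv z yz f f' fe f'e.
have pz : proj z = v by rewrite (scc_proj yz) projE.
have [t0 [_ tu]] : exists t0 : edge Gt, unique (fun e => src e = v \/ rng e = v) t0.
  by have [t0 h] := leaves Vv; exists t0.
have tuniq t' : src t' = v \/ rng t' = v -> t' = t by move=> h; rewrite -(tu _ h) (tu _ tv).
have circ_f g : g <> psi (inl t) -> src g = z \/ rng g = z -> exists c, g = psi (inr c).
  move=> ge gz; have [[t' gt]|//] := edge_cases g; case: ge; rewrite gt; congr (psi (inl _)).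
  apply: tuniq; rewrite gt in gz; have [h1 h2] := psiE (inl t').
  by case: gz => gz; [left|right]; rewrite -pz -gz ?h1 ?h2 projE.
pose up (a : vertex circ) : vertex circ := existT _ (projT1 a) (ordS (projT2 a)).
pose dn (a : vertex circ) : vertex circ := existT _ (projT1 a) (ord_pred (projT2 a)).
have updn a : dn (up a) = a by case: a => lam j; rewrite /dn /up /= ordSK.
split=> fz f'z.
  have [c fc] := circ_f f fe (or_introl fz); have [c' fc'] := circ_f f' f'e (or_introl f'z).
  rewrite fc fc'; congr (psi (inr _)).
  suff : up c = up c' by move/(congr1 dn); rewrite !updn.
  apply: phi_inr_inj.
  have [h1 _] := psiE (inr c); have [h2 _] := psiE (inr c').
  by rewrite -[LHS]h1 -[RHS]h2 -fc -fc' fz.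
have [c fc] := circ_f f fe (or_intror fz); have [c' fc'] := circ_f f' f'e (or_intror f'z).
rewrite fc fc'; congr (psi (inr _)); case: c c' fc fc' => [l j] [l' j'] fc fc'.
apply: phi_inr_inj.
have [_ h1] := psiE (inr (existT _ l j)); have [_ h2] := psiE (inr (existT _ l' j')).
by rewrite -[LHS]h1 -[RHS]h2 -fc -fc' fz.
Qed.

Lemma cyclic_leaf v : cyclic (phi (inl v)) -> Vs v.
Proof.
move=> /cyclic_circle[[lam j] h]; have := proj0_eq h => /= ->.
exact: svalP.
Qed.

Lemma fruit_star (e : edge G) : noncycle e -> star e.
Proof.
move=> ne; have [t et] := noncycle_tree ne; rewrite et.
have [hs hr] := psiE (inl t).
split; first exact: tree_edge_bridge.
(* If both ends of t were leaves in [Vs], connectedness would leave no other vertex in the tree, and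
   [Vs] would be all of it. *)
- rewrite hs hr => -[/cyclic_leaf Vsrc /cyclic_leaf Vrng]; apply: VsT; apply/seteqP; split=> // v _.
  have [con _ _] := tree.
  have tS s : Vs s -> src t = s \/ rng t = s -> forall t', src t' = s \/ rng t' = s -> t' = t.
    by move=> Vs_ ts t' t's; have [t0 [_ tu]] := leaves Vs_; rewrite -(tu _ t's) (tu _ ts).
  have h u w : linked u w -> (u = src t \/ u = rng t) <-> (w = src t \/ w = rng t).
    elim=> [a b [f [<- <-]]|//|a b _ ->//|a b c _ -> _ -> //].
    split=> -[h|h].
    - by rewrite (tS _ Vsrc (or_introl erefl) f (or_introl h)); right.
    - by rewrite (tS _ Vrng (or_intror erefl) f (or_introl h)); right.
    - by rewrite (tS _ Vsrc (or_introl erefl) f (or_intror h)); left.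
    - by rewrite (tS _ Vrng (or_intror erefl) f (or_intror h)); left.
  have [h1 _] := h _ _ (con (src t) v).
  by have [->|->] := h1 (or_introl erefl).
- by rewrite hs => /cyclic_leaf Vv; apply: leaf_pendant => //; left.
- by rewrite hr => /cyclic_leaf Vv; apply: leaf_pendant => //; right.
Qed.

End FruitStar.

Theorem components_star (G : digraph) :
  (forall x : vertex G, strongly_connected (component x) \/ fruit_tree (component x)) ->
  forall e : edge G, noncycle e -> star e.
Proof.
move=> h e ne.
pose e' : edge (component (src e)) := exist _ e (rst_refl _ _ _).
have ne' : noncycle e' by apply/comp_noncycle.
apply/(@comp_star G (src e) e').
case: (h (src e)) => [sc|[[Gt [Vs [n [base [h1 h2 h3 h4 [phi [psi [k1 k2 k3 k4]]]]]]]] _]].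
  case: ne'; have [p <- <-] := sc (rng e') (src e').
  apply/reachP; exists (path_edges p); split=> //; exact: Defs.pathP.
exact: (fruit_star h1 h2 h3 h4 k1 k2 k3 k4).
Qed.

Lemma set2_eq T (a b c d : T) : [set a; b]%classic = [set c; d]%classic ->
  (a = c /\ b = d) \/ (a = d /\ b = c).
Proof.
move=> h; have := h => /seteqP[s1 s2].
have [ac|ad] := s1 a (or_introl erefl); have [bc|bd] := s1 b (or_intror erefl).
- by have [da|db] := s2 d (or_intror erefl); left; split; congruence.
- by left.
- by right.
- by have [ca|cb] := s2 c (or_introl erefl); left; split; congruence.
Qed.

(** The other edges form the detour, followed from vertex j + 1 around to vertex j. *)
Lemma polygon_linked_off (G : digraph) n (v : 'I_n -> vertex G) (e : 'I_n -> edge G) j :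
  polygon v e -> linked_off (e j) (src (e j)) (rng (e j)).
Proof.
move=> [_ einj pol].
have side i : i <> j -> linked_off (e j) (v i) (v (ordS i)).
  move=> ij; have ne : e i <> e j by move=> /einj.
  have [[<- <-]|[<- <-]] := set2_eq (pol i); [apply: rst_sym|]; by apply: rst_step; exists (e i).
have arc k : (k < n)%N -> linked_off (e j) (v (ordS j)) (v (iter k.+1 (@ordS _) j)).
  elim: k => [|k IH] kn; first exact: rst_refl.
  apply: rst_trans (IH (ltnW kn)) _; apply: side => /(congr1 val); rewrite iter_ordS /=.
  have jn := ltn_ord j; have [h|h] := ltnP (j + k.+1) n; first by rewrite modn_small// => E1; lia.
  by rewrite -(subnK h) modnDr modn_small => [E1|]; lia.
have jn := ltn_ord j.
have back : linked_off (e j) (v (ordS j)) (v j).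
  have := arc n.-1; rewrite prednK; last by lia.
  have -> : iter n (@ordS _) j = j by apply: val_inj; rewrite iter_ordS modnDr modn_small.
  by apply; lia.
by have [[-> ->]|[-> ->]] := set2_eq (pol j); [|apply: rst_sym].
Qed.

(** * Reconstruction of the tree and its circles *)

Section TreeOfStar.
Variable K : digraph.
Notation V := (vertex K).
Notation E := (edge K).
Notation E' := ({classic E}).
Hypothesis con : Defs.connected K.
Hypothesis hstar : forall e : E, noncycle e -> star e.
Variable e0 : E.
Hypothesis ne0 : noncycle e0.
Implicit Types (x y z : V) (e f : E) (u w : seq E').

Lemma scc_off_noncycle e : ~ noncycle e -> scc (src e) (rng e).
Proof. by move=> /contrapT h; split=> //; exact: reach_edge. Qed.

(** Otherwise no edge would leave or enter the strong component of y, which would then be the whole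
    connected graph and contain the ends of [e0]. *)
Lemma scc_touches y : exists2 z, scc y z & touches z \/ ~ cyclic z.
Proof.
have [cy|] := pselect (cyclic y); last by exists y; [exact: scc_refl|right].
apply: contrapT => none.
have cls e : scc y (src e) <-> scc y (rng e).
  have [ne|/scc_off_noncycle se] := pselect (noncycle e).
    split=> h; exfalso; apply: none; [exists (src e)|exists (rng e)] => //; left; exists e.
      by split=> //; left.
    by split=> //; right.
  by split=> h; apply: scc_trans h _ => //; exact: scc_sym.
have h (a b : V) : linked a b -> (scc y a <-> scc y b).
  by elim=> [{}a {}b [e [<- <-]]|//|{}a {}b _ ->|{}a {}b c _ -> _ ->].
have [h1 _] := h _ _ (con y (src e0)).
apply: none; exists (src e0); first by apply: h1; exact: scc_refl.
by left; exists e0; split=> //; left.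
Qed.

Lemma touches_pendant y : cyclic y -> touches y -> exists e,
  [/\ noncycle e, src e = y \/ rng e = y & pendant e y].
Proof.
move=> cy [e [ne ey]]; exists e; split=> //.
by have [_ _ h1 h2] := hstar ne; case: ey => ey; rewrite -ey; [apply: h1|apply: h2]; rewrite ey.
Qed.

Lemma pendant_scc e y z : scc y z -> pendant e y -> pendant e z.
Proof. by move=> yz h t zt; apply: h; exact: scc_trans zt. Qed.

Lemma touches_unique y z : cyclic y -> touches y -> touches z -> scc y z -> y = z.
Proof.
move=> cy ty [f [nf fz]] yz; have [e [ne ey pe]] := touches_pendant cy ty.
have fe : f = e by apply: (pendant_unique ne (pendant_scc yz pe) (scc_cyclic cy yz) nf).
rewrite fe in fz; case: yz => yz zy.
by case: ey fz => ey [] fz; try congruence; case: ne; rewrite ey fz.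
Qed.

Definition branching y := ~ cyclic y \/ touches y.

(* The tree of the fruit tree: each circle is reduced to the vertex where it is attached. *)
Definition bough : digraph := @Digraph {y | branching y} {e : E | noncycle e}
  (fun a => exist _ (src (sval a)) (or_intror (ex_intro _ (sval a) (conj (svalP a) (or_introl erefl)))))
  (fun a => exist _ (rng (sval a)) (or_intror (ex_intro _ (sval a) (conj (svalP a) (or_intror erefl))))).
Implicit Types (t : vertex bough).

(** With [scc_touches] this puts the vertices of [bough] in bijection with the strong components. *)
Lemma bough_scc t t' : scc (sval t) (sval t') -> t = t'.
Proof.
move=> h; apply: sval_inj; apply: contrapT => tt.
have ct := scc_edge h tt.
have ct' : cyclic (sval t') by exact: scc_cyclic ct h.
by apply: tt; apply: touches_unique => //; [case: (svalP t)|case: (svalP t')].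
Qed.

Lemma bough_projection : exists rv : V -> vertex bough, [/\ forall y, scc y (sval (rv y)) &
  forall t, rv (sval t) = t].
Proof.
have /choice[rv h] y : exists t, scc y (sval t).
  by have [z yz tz] := scc_touches y; exists (exist _ z (proj2 (or_comm _ _) tz)).
exists rv; split=> // t; apply: bough_scc; exact: scc_sym.
Qed.

(** Connectedness passes to the strong components. A polygon would contain a detour around one of
    its edges, all of which are bridges. *)
Lemma bough_tree : generalized_tree bough.
Proof.
split.
- have [rv [r1 r2]] := bough_projection.
  have h a b : linked a b -> linked (rv a) (rv b).
    elim=> [x y [e [<- <-]]|x|x y _|x y z _ h1 _ h2].
    + have [ne|/scc_off_noncycle se] := pselect (noncycle e).
        have := r2 (src (exist _ e ne : edge bough)); have := r2 (rng (exist _ e ne : edge bough)).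
        by move=> /= -> ->; apply: rst_step; exists (exist _ e ne).
      have -> : rv (src e) = rv (rng e); last exact: rst_refl.
      by apply: bough_scc; apply: scc_trans (r1 _); apply: scc_trans se; exact: scc_sym.
    + exact: rst_refl.
    + exact: rst_sym.
    + exact: rst_trans h1 h2.
  by move=> t t'; rewrite -(r2 t) -(r2 t'); apply: h; exact: con.
- pose b := exist _ e0 ne0 : edge bough.
  exists (src b), (rng b) => /(congr1 sval) /= E0.
  by apply: ne0; rewrite E0; exact: rt_refl.
- move=> n v e n0 pol; have := polygon_linked_off (Ordinal n0) pol.
  set b := e _ => h.
  have [nb _ _ _] := hstar (svalP b); apply: nb.
  have k t t' : linked_off b t t' -> linked_off (sval b) (sval t) (sval t').
    elim=> [u w [f fe [<- <-]]|u|u w _|u w z _ h1 _ h2].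
    + by apply: rst_step; exists (sval f) => // fE; apply: fe; exact: sval_inj.
    + exact: rst_refl.
    + exact: rst_sym.
    + exact: rst_trans h1 h2.
  exact: k h.
Qed.

Lemma shortest_closed y : cyclic y -> exists u, [/\ clx y u, u <> [::] &
  forall w, clx y w -> w <> [::] -> (size u <= size w)%N].
Proof.
move=> /cyclic_closed[w0 cw0 w00].
have ex : exists n, `[< exists w, [/\ clx y w, w <> [::] & size w = n] >].
  by exists (size w0); apply/asboolP; exists w0.
case: (ex_minnP ex) => n /asboolP[u [cu u0 un]] nmin; exists u; split=> // w cw w0'.
by rewrite un; apply: nmin; apply/asboolP; exists w.
Qed.

(** A cycle numbered as in [circle_graph], each vertex being the range of the edge of the same
    index; the last component of c marks the position of y. *)
Definition cycle_at y (c : {n & (('I_n -> E) * 'I_n)%type}) :=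
  [/\ rng ((projT2 c).1 (projT2 c).2) = y,
    forall j, src ((projT2 c).1 j) = rng ((projT2 c).1 (ordS j)),
    injective (fun j => rng ((projT2 c).1 j)) &
    forall j, scc y (rng ((projT2 c).1 j)) /\ ~ noncycle ((projT2 c).1 j)].

(** A shortest closed word repeats no vertex, since the part between two visits could be cut out. *)
Lemma cycle_exists y : cyclic y -> exists c, cycle_at y c.
Proof.
move=> /shortest_closed[u [[cu uy] u0 umin]].
pose n := size u.
have n0 : (0 < n)%N by rewrite /n; case: (u) u0.
case E1 : u => [//|g0 u'].
pose g (j : 'I_n) : E := nth (g0 : E') u j.
have cat_ j : u = take j u ++ drop j u by rewrite cat_take_drop.
have dropE j : (j < n)%N -> drop j u = nth (g0 : E') u j :: drop j.+1 u.
  by move=> jn; exact: drop_nth.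
have cd j : composable y (drop j u).
  by move: cu; rewrite {1}(cat_ j) => /composable_cat[].
have wd j : (j < n)%N -> word_range y (drop j u) = rng (nth (g0 : E') u j).
  by move=> jn; rewrite dropE.
exists (existT _ n (g, Ordinal n0)); split=> /=.
- by rewrite /g /= nth0 -uy E1.
- move=> j; rewrite /g /=.
  have [] : src (nth (g0 : E') u j) = word_range y (drop j.+1 u) /\ composable y (drop j.+1 u).
    by have := cd j; rewrite dropE.
  move=> -> _; have [jn|jn] := ltnP j.+1 n; first by rewrite wd// modn_small.
  have -> : j.+1 = n by apply/eqP; rewrite eqn_leq jn ltn_ord.
  by rewrite modnn drop_size /= nth0 -uy E1.
- move=> i j /= ij; apply: val_inj => /=.
  wlog lt : i j ij / (i < j)%N.
    move=> H; have [h|h|//] := ltngtP i j; first exact: H.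
    by apply/esym; apply: H.
  exfalso; pose w : seq E' := take i u ++ drop j u.
  have wr : word_range y (drop j u) = word_range y (drop i u) by rewrite !wd.
  have cw : clx y w.
    split; last by rewrite word_range_cat wr -word_range_cat -cat_.
    apply/composable_cat; split=> //; rewrite wr.
    by move: cu; rewrite {1}(cat_ i) => /composable_cat[].
  have sw : size w = (i + (n - j))%N by rewrite size_cat size_takel ?size_drop// ltnW.
  have jn := ltn_ord j.
  have w0 : w <> [::] by move=> w0; move: sw; rewrite w0 /=; lia.
  by have := umin w cw w0; rewrite sw -/n; lia.
- move=> j; have uE : u = take j u ++ (g j : E') :: drop j.+1 u by rewrite -dropE.
  have [|h1 h2] := @closed_word_edge K y (take j u) (g j) (drop j.+1 u); first by rewrite -uE.
  have h3 := reach_edge (g j).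
  by split; [split=> //; exact: reach_trans h1 h3|move=> nc; apply: nc; exact: reach_trans h2 h1].
Qed.

(** Apart from the attached edge k, each vertex of the component has at most one edge out, so paths
    from y within the component stay on the cycle; uniqueness of edges in then gives the claim. *)
Lemma cycle_covers y c : cyclic y -> touches y -> cycle_at y c ->
  forall e, scc y (rng e) -> ~ noncycle e -> exists j, e = (projT2 c).1 j.
Proof.
move=> cy ty [bE sE inj ncE]; have [k [nk ky pk]] := touches_pendant cy ty.
have cov z : scc y z -> exists j, rng ((projT2 c).1 j) = z.
  move=> [yz zy]; have h := clos_rt_rtn1 _ _ _ _ yz; elim: h zy => [|z1 z2 [e [se re]] h1 IH] z2y.
    by exists (projT2 c).2.
  have yz1 : reach y z1 by exact: clos_rtn1_rt.
  have z12 : reach z1 z2 by rewrite -se -re; exact: reach_edge.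
  have z1y := reach_trans z12 z2y.
  have [j jE] := IH z1y; exists (ord_pred j).
  have sj : src ((projT2 c).1 (ord_pred j)) = z1 by rewrite sE ord_predK.
  have [_ nj] := ncE (ord_pred j).
  have n1 : (projT2 c).1 (ord_pred j) <> k by move=> E1; rewrite E1 in nj.
  have n2 : e <> k by move=> ek; apply: nk; rewrite -ek se re; exact: reach_trans z2y yz1.
  by have [/(_ sj se) ->] := pk z1 (conj yz1 z1y) _ _ n1 n2.
move=> e ye ne; have [j jE] := cov _ ye; exists j; have [_ nj] := ncE j.
have n1 : e <> k by move=> E1; rewrite E1 in ne.
have n2 : (projT2 c).1 j <> k by move=> E1; rewrite E1 in nj.
by have [_ /(_ erefl jE)] := pk _ ye _ _ n1 n2.
Qed.

Lemma star_fruit : generalized_fruit_tree K.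
Proof.
pose Vs : set (vertex bough) := [set t | cyclic (sval t)].
have /choice[c hc] (lam : {t | Vs t}) : exists c, cycle_at (sval (sval lam)) c.
  by apply: cycle_exists; exact: svalP lam.
have tch (lam : {t | Vs t}) : touches (sval (sval lam)).
  by case: (svalP (sval lam)) => // h; case: h; exact: svalP lam.
have lam_eq (l l' : {t | Vs t}) : scc (sval (sval l)) (sval (sval l')) -> l = l'.
  move=> /bough_scc; case: l l' => [a ha] [b hb] /= ab; subst b; congr exist; exact: Prop_irrelevance.
pose n lam := projT1 (c lam).
pose g lam (j : 'I_(n lam)) : E := (projT2 (c lam)).1 j.
pose base lam : 'I_(n lam) := (projT2 (c lam)).2.
exists bough, Vs, n, base; split.
- exact: bough_tree.
- move=> t ct.
  have tt : touches (sval t) by case: (svalP t).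
  have [e [ne te pe]] := touches_pendant ct tt.
  exists (exist _ e ne : edge bough); split.
    by case: te => te; [left|right]; exact: sval_inj.
  move=> b bt; apply: sval_inj => /=; apply/esym.
  apply: (pendant_unique ne pe ct (svalP b)).
  by case: bt => <-; [left|right].
(* An end of [e0] on no cycle is a vertex of the tree outside [Vs]. *)
- move=> VT; pose b := exist _ e0 ne0 : edge bough.
  have [_ nb _ _] := hstar ne0; apply: nb; split.
    by have : Vs (src b) by rewrite VT.
  by have : Vs (rng b) by rewrite VT.
- by move=> lam; apply: leq_ltn_trans (ltn_ord (base lam)).
set circ := graph_bigsum _.
pose phi (z : vertex (graph_sum bough circ)) : V :=
  match z with inl t => sval t | inr a => rng (g (projT1 a) (projT2 a)) end.
pose psi (z : edge (graph_sum bough circ)) : E :=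
  match z with inl t => sval t | inr a => g (projT1 a) (projT2 a) end.
have gs lam j : scc (sval (sval lam)) (rng (g lam j)) by have [_ _ _ /(_ j)[]] := hc lam.
have gn lam j : ~ noncycle (g lam j) by have [_ _ _ /(_ j)[]] := hc lam.
have gi lam : injective (fun j => rng (g lam j)) by have [_ _ h _] := hc lam.
have gb lam : rng (g lam (base lam)) = sval (sval lam) by have [] := hc lam.
have cover y : cyclic y -> exists lam : {t | Vs t}, scc (sval (sval lam)) y.
  move=> cy; have [rv [r1 _]] := bough_projection.
  have cr : Vs (rv y) by exact: scc_cyclic cy (r1 y).
  by exists (exist _ _ cr); exact: scc_sym.
have inr_inj l (j : 'I_(n l)) l' (j' : 'I_(n l')) : rng (g l j) = rng (g l' j') ->
    existT (fun l => 'I_(n l)) l j = existT _ l' j'.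
  move=> E1; have ll : l = l'.
    by apply: lam_eq; apply: scc_trans (gs l j) _; rewrite E1; apply: scc_sym.
  by subst l'; rewrite (gi _ _ _ E1).
exists phi, psi; split.
(* A vertex missing from the tree lies on a cycle, hence on the circle of its strong component. *)
- move=> y; have [by_|nby] := pselect (branching y); first by exists (inl (exist _ y by_)).
  have cy : cyclic y by apply: contrapT => ncy; apply: nby; left.
  have [lam sl] := cover y cy.
  have [e ey ry] := cyclic_in cy.
  have [||j ej] := @cycle_covers _ (c lam) (svalP lam) (tch lam) (hc lam) e.
  + by rewrite ey.
  + by apply; rewrite ey.
  by exists (inr (existT _ lam j)); rewrite /= -[g _ _]ej.
(* A tree vertex on circle l is the vertex where l is attached, because its strong component
   contains no other tree vertex. *)
- have mixed t l j : sval t = rng (g l j) -> clos_refl_sym_trans _ (fun x y : vertex (graph_sum bough circ) =>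
      exists lam, x = inl (sval lam) /\ y = inr (existT _ lam (base lam))) (inl t) (inr (existT _ l j)).
    move=> E1; have E2 : t = sval l.
      by apply: bough_scc; rewrite E1; apply: scc_sym.
    apply: rst_step; exists l; split; first by rewrite E2.
    by rewrite (@inr_inj l j l (base l))// gb -E1 E2.
  move=> x x'; split.
    case: x x' => [t|[l j]] [t'|[l' j']] /= h.
    + by rewrite (sval_inj h); exact: rst_refl.
    + exact: mixed.
    + by apply: rst_sym; apply: mixed.
    + by rewrite (inr_inj _ _ _ _ h); exact: rst_refl.
  by elim=> [a b [lam [-> ->]]|//|a b _ ->|a b d _ -> _ ->] //=; rewrite gb.
- have psi_inj : injective psi.
    case=> [t|[l j]] [t'|[l' j']] /= h.
    + by rewrite (sval_inj h).
    + by case: (gn l' j'); rewrite -h; exact: svalP.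
    + by case: (gn l j); rewrite h; exact: svalP.
    + by rewrite (inr_inj l j l' j')// h.
  have /choice[psi' hpsi] e : exists k, psi k = e.
    have [ne|ne] := pselect (noncycle e); first by exists (inl (exist _ e ne)).
    have se := scc_off_noncycle ne.
    have cy : cyclic (rng e).
      by apply: (@scc_cyclic _ (src e)) => //; exists e => //; case: se.
    have [lam sl] := cover _ cy.
    have [//|//|j ej] := @cycle_covers _ (c lam) (svalP lam) (tch lam) (hc lam) e.
    by exists (inr (existT _ lam j)); rewrite ej.
  by exists psi' => // k; apply: psi_inj; rewrite hpsi.
- case=> [t|[l j]] //=; split=> //.
  by have [_ h _ _] := hc l; exact: h.
Qed.

End TreeOfStar.

Lemma component_connected (G : digraph) (x : vertex G) : Defs.connected (component x).
Proof.
suff h (u v : vertex G) : linked u v -> forall hu hv,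
    linked (exist _ u hu : vertex (component x)) (exist _ v hv).
  by move=> [u hu] [v hv]; apply: h; apply: rst_trans hv; exact: rst_sym.
elim=> [a b [e [se re]]|a|a b _ IH|a b c hab IH1 hbc IH2] hu hv.
- have he : linked x (src e) by rewrite se.
  by apply: rst_step; exists (exist _ e he); split; exact: sval_inj.
- by rewrite (Prop_irrelevance hu hv); exact: rst_refl.
- by apply: rst_sym; exact: IH.
- have hb : linked x b by exact: rst_trans hu hab.
  exact: rst_trans (IH1 hu hb) (IH2 hb hv).
Qed.

Lemma component_finite (G : digraph) (x : vertex G) : finite_graph G -> finite_graph (component x).
Proof.
move=> fG; rewrite /finite_graph -(preimage_setT (sval : vertex (component x) -> vertex G)).
by apply: finite_preimage => // a b _ _; exact: sval_inj.
Qed.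

(** If every edge of the component lies on a cycle, each edge can be traversed back, so linked
    vertices reach each other. Otherwise an edge on no cycle serves as [e0] in [star_fruit]. *)
Theorem star_components (G : digraph) : finite_graph G -> (forall e : edge G, noncycle e -> star e) ->
  forall x : vertex G, strongly_connected (component x) \/ fruit_tree (component x).
Proof.
move=> fG st x; have con := @component_connected G x.
have [[e0 ne0]|nn] := pselect (exists e : edge (component x), noncycle e).
  right; split; last exact: component_finite.
  apply: (star_fruit con _ ne0) => e ne; apply/comp_star; apply: st; exact/comp_noncycle.
left=> a b.
have /reachP[w [cw wb]] : reach a b.
  suff [] : scc a b by [].
  elim: (con a b) => [u v [e [<- <-]]|u|u v _|u v w _ h1 _ h2].
  - by apply: scc_off_noncycle => ne; apply: nn; exists e.
  - exact: scc_refl.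
  - exact: scc_sym.
  - exact: scc_trans h1 h2.
by exists (DPath cw).
Qed.

Theorem mainTheorem3 (R : realType) (G : digraph) (finG : finite_graph G) :
  H1_vanishes (A_alg G R) (L_alg G R) <->
  forall x : vertex G,
    strongly_connected (component x) \/ fruit_tree (component x).
Proof.
split=> [h|h].
  by apply: star_components => // e ne; exact: (H1_vanishes_star finG h ne).
by apply: star_H1_vanishes => // e; exact: components_star.
Qed.
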